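(* Consider the closed-loop system described in the context, and let $r_e\in\mathbb{R}$, $d_e\in L^2(0,L)$. Assume that $r(t)\to r_e$ and $d(t)\to d_e$ (in $L^2(0,L)$) as $t\to+\infty$. Then, as $t\to+\infty$, $w(t)\to w_e$ in $H_0^1(0,L)$ norm, $y(t)\to y_e$ in both $L^\infty(0,L)$ and $L^2(0,L)$ norms, $u(t)\to u_e$, and $\zeta(t)\to\zeta_e$, with exponential vanishing of the contribution of the initial conditions; that is, each of the quantities $\Vert w(t)-w_e\Vert_{H_0^1(0,L)}$, $\Vert y(t)-y_e\Vert_{L^\infty(0,L)}$, $\Vert y(t)-y_e\Vert_{L^2(0,L)}$, $\vert u(t)-u_e\vert$, $\vert\zeta(t)-\zeta_e\vert$ is bounded for all $t\geq0$ by $$Ce^{-\kappa t}\left(\vert\Delta u_D(0)\vert+\vert\Delta\zeta(0)\vert+\Vert\Delta w(0)\Vert_{H_0^1(0,L)}\right)+\rho(t),$$ where $C,\kappa>0$ are constants that do not depend on the initial conditions $(y_0,z_0)$ nor on $r,d$, and $\rho(t)\to0$ as $t\to+\infty$ with $\rho$ not depending on the initial conditions $(y_0,z_0)$.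
   Context: Notation. $\mathbb{R}_+=[0,+\infty)$, $\mathbb{N}=\{0,1,2,\dots\}$. Fix $L>0$, $D>0$ and a real-valued $c\in L^\infty(0,L)$. $\langle f,g\rangle=\int_0^L f(x)g(x)\,dx$ on $L^2(0,L)$; $\Vert f\Vert_{H_0^1(0,L)}=\Vert f'\Vert_{L^2(0,L)}$. Spectral data. $\mathcal{A}f=f''+cf$ on $D(\mathcal{A})=H^2(0,L)\cap H_0^1(0,L)$, a self-adjoint operator with compact resolvent in $L^2(0,L)$. $(e_j)_{j\geq1}$ is a Hilbert basis of $L^2(0,L)$ of real eigenfunctions, $\mathcal{A}e_j=\lambda_je_j$, with $\lambda_1>\lambda_2>\cdots\to-\infty$. $n\in\mathbb{N}$ is the integer with $\lambda_j\geq0$ for $1\leq j\leq n$ and $\lambda_j\leq\lambda_{n+1}<0$ for $j\geq n+1$ ($n=0$ allowed). Put $a(x)=\frac{x}{L}c(x)$, $b(x)=-\frac{x}{L}$, $a_j=\langle a,e_j\rangle$, $b_j=\langle b,e_j\rangle$, $\alpha=\frac1L-\sum_{j\geq n+1}\frac{e_j'(0)}{\lambda_j}a_j$, $\beta=-\sum_{j\geq n+1}\frac{e_j'(0)}{\lambda_j}b_j$. Matrices. $A_1\in\mathbb{R}^{(n+1)\times(n+1)}$ has zero first row, first column $(0,a_1,\dots,a_n)^\top$, and lower-right $n\times n$ block $\mathrm{diag}(\lambda_1,\dots,\lambda_n)$; $B_1=(1,b_1,\dots,b_n)^\top$; $L_1=(\alpha,e_1'(0),\dots,e_n'(0))$;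 $A=\begin{pmatrix}A_1&0\\L_1&0\end{pmatrix}\in\mathbb{R}^{(n+2)\times(n+2)}$, $B=\begin{pmatrix}B_1\\\beta\end{pmatrix}\in\mathbb{R}^{n+2}$. A gain $K\in\mathbb{R}^{1\times(n+2)}$ is fixed such that $A_K=A+e^{-DA}BK$ is Hurwitz. Closed-loop system. Data: $r:\mathbb{R}_+\to\mathbb{R}$ continuous, $d:\mathbb{R}_+\to L^2(0,L)$ continuously differentiable, $y_0\in H^2(0,L)\cap H_0^1(0,L)$, $z_0\in\mathbb{R}$. The system is $y_t=y_{xx}+c(x)y+d(t,x)$, $\dot z(t)=y_x(t,0)-r(t)$, $y(t,0)=0$, $y(t,L)=u_D(t):=u(t-D)$, $y(0,\cdot)=y_0$, $z(0)=z_0$, where $u(t)=0$ for $t<0$ and $u(t)=\int_0^tv(\tau)\,d\tau$ for $t\geq0$. Write $v_D(t)=v(t-D)$, $w(t,x)=y(t,x)-\frac{x}{L}u_D(t)$, $w_j(t)=\langle w(t,\cdot),e_j\rangle$, $\zeta(t)=z(t)-\sum_{j\geq n+1}\frac{e_j'(0)}{\lambda_j}w_j(t)$, $X=(u_D,w_1,\dots,w_n,\zeta)^\top\in\mathbb{R}^{n+2}$. The control is $v(t)=0$ for $t<0$ and $v(t)=KZ(t)$ for $t\geq0$, with $Z(t)=X(t)+\int_{t-D}^te^{A(t-D-\tau)}Bv(\tau)\,d\tau$. Thus $w_t=\mathcal{A}w+a\,u_D+b\,v_D+d$ with $w(t,\cdot)\in D(\mathcal{A})$, $w(0)=y_0$,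 and $\dot z(t)=w_x(t,0)+\frac1Lu_D(t)-r(t)$. Equilibrium and deviations. For $r_e\in\mathbb{R}$, $d_e\in L^2(0,L)$, let $d_{e,j}=\langle d_e,e_j\rangle$, $\Gamma_e=\big(0,d_{e,1},\dots,d_{e,n},-r_e-\sum_{j\geq n+1}\frac{e_j'(0)}{\lambda_j}d_{e,j}\big)^\top$, $Z_e=X_e=-A_K^{-1}\Gamma_e=:(u_e,w_{1,e},\dots,w_{n,e},\zeta_e)^\top$, $w_{j,e}=-\frac{a_j}{\lambda_j}u_e-\frac{d_{e,j}}{\lambda_j}$ for $j\geq n+1$, $w_e=\sum_{j\geq1}w_{j,e}e_j\in D(\mathcal{A})$, $y_e(x)=w_e(x)+\frac{x}{L}u_e$. Deviations: $\Delta u_D=u_D-u_e$, $\Delta\zeta=\zeta-\zeta_e$, $\Delta w=w-w_e$. *)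

(* Defs.v *)
From HB Require Import structures.
From mathcomp Require Import all_boot all_order all_algebra.
From mathcomp Require Import all_classical all_reals all_analysis.
From mathcomp Require Import complex.

Set Implicit Arguments.
Unset Strict Implicit.
Unset Printing Implicit Defensive.

Import Order.TTheory GRing.Theory Num.Theory.
Import numFieldNormedType.Exports.

Local Open Scope classical_set_scope.
Local Open Scope ring_scope.

(* A function on (0,L) is a total map R -> R, of which only the values on     *)
(* [0,L] are ever used: f \_ `]0, L[ is its extension by 0, so that the L^p   *)
(* spaces and norms over R yield those over (0,L). The norms take their       *)
(* values in \bar R: convergence in norm entails eventual finiteness.         *)

Section FunctionSpaces.
Context {R : realType}.
Implicit Types (L x t : R) (f g : R -> R) (F : R -> R -> R).

Local Notation mu := (@lebesgue_measure R).

Definition inL2 L f := (f \_ `]0, L[) \in Lfun mu 2%:E.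

Definition inLinfty L f := (f \_ `]0, L[) \in Lfun mu +oo%E.

Definition L2norm L f : \bar R := Lnorm mu 2%:E (EFin \o (f \_ `]0, L[)).

Definition Linftynorm L f : \bar R := Lnorm mu +oo%E (EFin \o (f \_ `]0, L[)).

Definition inner L f g : R := \int[mu]_(x in `]0%R, L[) (f x * g x).

Definition hilbert_basis L (e : nat -> R -> R) :=
  [/\ forall j, inL2 L (e j),
      forall i j, inner L (e i) (e j) = (i == j)%:R &
      forall f, inL2 L f -> forall eps : R, 0 < eps ->
        exists N (k : nat -> R),
          (L2norm L (fun x => f x - \sum_(0 <= j < N) k j * e j x)%R
             < eps%:E)%E].

(* f is the continuous representative of an element of H^1(0,L) whose weak    *)
(* derivative is g.                                                           *)
Definition wderiv L f g :=
  inL2 L g /\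
  forall x, 0 <= x <= L -> f x = f 0 + \int[mu]_(s in `[0%R, x]) g s.

Definition wderiv2 L f g := exists2 f1, wderiv L f f1 & wderiv L f1 g.

Definition inH2 L f := exists g, wderiv2 L f g.

(* The domain H^2(0,L) /\ H^1_0(0,L) of the operator.                         *)
Definition inDA L f := [/\ inH2 L f, f 0 = 0 & f L = 0].

(* The graph of A f = f'' + c f; g is only determined almost everywhere.      *)
Definition opA L (c : R -> R) f g :=
  inDA L f /\
  exists2 f2, wderiv2 L f f2 &
    {ae mu, forall x, x \in `]0, L[ -> g x = f2 x + c x * f x}.

(* The H^1_0 norm, for functions that are differentiable on ]0,L[ (this is    *)
(* the case of those in H^2(0,L)).                                            *)
Definition H10norm L f : \bar R := L2norm L f^`()%classic.

(* f'(0): the right derivative, since f is only meaningful on [0,L].          *)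
Definition deriv_at0 f : R := lim ((f h - f 0) / h @[h --> 0^'+]).

Definition Rplus : set R := [set t | 0 <= t].

Definition L2_continuous L F :=
  forall t, 0 <= t ->
    L2norm L (F s \- F t) @[s --> within Rplus (nbhs t)] --> 0%E.

(* At t = 0 the derivative is one-sided.                                      *)
Definition L2_is_derive L F t g :=
  L2norm L (fun x => (F s x - F t x) / (s - t) - g x)
    @[s --> within Rplus t^'] --> 0%E.

Definition L2_C1 L F :=
  exists2 F' : R -> R -> R,
    (forall t, 0 <= t -> [/\ inL2 L (F t), inL2 L (F' t) &
                             L2_is_derive L F t (F' t)])
    & L2_continuous L F'.

End FunctionSpaces.

Section Matrices.
Context {R : realType}.

Definition expmx m (M : 'M[R]_m) : 'M[R]_m :=
  \matrix_(i, j) \big[+%R/0]_(0 <= k <oo) ((M ^+ k) i j / k`!%:R).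

Definition Hurwitz m (M : 'M[R]_m) :=
  forall l : R[i], eigenvalue (map_mx (real_complex R) M) l ->
    complex.Re l < 0.

End Matrices.

(* The eigenpairs are numbered from 0: e j and lam j are the (j+1)-st         *)
(* eigenfunction and eigenvalue, and those with j < n are the ones with       *)
(* nonnegative eigenvalue.                                                    *)
Section Plant.
Context {R : realType}.
Variables (L D : R) (c : R -> R) (e : nat -> R -> R) (lam : nat -> R) (n : nat).

Local Notation mu := (@lebesgue_measure R).

Definition a_coef j : R := inner L (fun x => x / L * c x) (e j).

Definition b_coef j : R := inner L (fun x => - (x / L)) (e j).

Definition stable_sum (f : nat -> R) : R :=
  \big[+%R/0]_(n <= j <oo) (deriv_at0 (e j) / lam j * f j).

Definition alpha : R := L^-1 - stable_sum a_coef.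

Definition beta : R := - stable_sum b_coef.

Definition matA1 : 'M[R]_(1 + n) :=
  block_mx 0                         0
           (\col_(j < n) a_coef j)   (diag_mx (\row_(j < n) lam j)).

Definition matB1 : 'cV[R]_(1 + n) := col_mx 1%:M (\col_(j < n) b_coef j).

Definition matL1 : 'rV[R]_(1 + n) :=
  row_mx alpha%:M (\row_(j < n) deriv_at0 (e j)).

Definition matA : 'M[R]_(1 + n + 1) := block_mx matA1 0 matL1 0.

Definition matB : 'cV[R]_(1 + n + 1) := col_mx matB1 beta%:M.

Definition matAK (K : 'rV[R]_(1 + n + 1)) : 'M[R]_(1 + n + 1) :=
  matA + expmx ((- D) *: matA) *m matB *m K.

Section Trajectory.
Variables (y : R -> R -> R) (z v : R -> R).

Definition u_of (t : R) : R :=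
  if t < 0 then 0 else \int[mu]_(s in `[0%R, t]) v s.

Definition uD_of (t : R) : R := u_of (t - D).

Definition w_of (t x : R) : R := y t x - x / L * uD_of t.

Definition zeta_of (t : R) : R :=
  z t - stable_sum (fun j => inner L (w_of t) (e j)).

Definition X_of (t : R) : 'cV[R]_(1 + n + 1) :=
  col_mx (col_mx (uD_of t)%:M (\col_(j < n) inner L (w_of t) (e j)))
         (zeta_of t)%:M.

Definition Z_of (t : R) : 'cV[R]_(1 + n + 1) :=
  X_of t + \col_i \int[mu]_(s in `[(t - D)%R, t])
                    ((expmx ((t - D - s) *: matA) *m matB) i 0 * v s).

End Trajectory.

(* Classical solutions. The heat equation holds in L^2(0,L) at every t > 0    *)
(* except t = D, where v_D = d(u_D)/dt jumps from 0 to K Z(0) unless          *)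
(* K Z(0) = 0.                                                                *)
Definition closed_loop (K : 'rV[R]_(1 + n + 1)) (r : R -> R) (d : R -> R -> R)
    (y0 : R -> R) (z0 : R) (y : R -> R -> R) (z v : R -> R) :=
  (forall t, 0 <= t -> [/\ inH2 L (y t), y t 0 = 0 & y t L = uD_of v t]) /\
  L2_continuous L y /\
  (forall t, 0 < t -> t != D ->
    exists2 yxx, wderiv2 L (y t) yxx &
      L2_is_derive L y t (fun x => yxx x + c x * y t x + d t x)) /\
  (forall x, 0 <= x <= L -> y 0 x = y0 x) /\
  {within Rplus, continuous z} /\
  (forall t : R, 0 < t -> is_derive t 1 z (deriv_at0 (y t) - r t)) /\
  z 0 = z0 /\
  (forall T, 0 <= T -> mu.-integrable `[0, T] (EFin \o v)) /\
  (forall t, v t = if t < 0 then 0 else (K *m Z_of y z v t) 0 0).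

Section Equilibrium.
Variables (K : 'rV[R]_(1 + n + 1)) (re : R) (de : R -> R).

Definition Gamma_e : 'cV[R]_(1 + n + 1) :=
  col_mx (col_mx 0 (\col_(j < n) inner L de (e j)))
         (- re - stable_sum (fun j => inner L de (e j)))%:M.

Definition X_e : 'cV[R]_(1 + n + 1) := - (invmx (matAK K) *m Gamma_e).

Definition u_e : R := usubmx (usubmx X_e) 0 0.

Definition zeta_e : R := dsubmx X_e 0 0.

Definition w_e_coef (j : nat) : R :=
  if insub j is Some i then dsubmx (usubmx X_e) i 0
  else - (a_coef j / lam j) * u_e - inner L de (e j) / lam j.

(* we is the sum in L^2(0,L) of the series of the w_e_coef j * e j; membership*)
(* in the domain selects its continuous representative.                       *)
Definition is_w_e (we : R -> R) :=
  inDA L we /\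
  L2norm L (fun x => we x - \sum_(0 <= j < N) w_e_coef j * e j x)
    @[N --> \oo] --> 0%E.

Definition y_e (we : R -> R) (x : R) : R := we x + x / L * u_e.

End Equilibrium.

End Plant.

(* Main.v *)
Require Import Defs.
From HB Require Import structures.
From mathcomp Require Import all_boot all_order all_algebra.
From mathcomp Require Import all_classical all_reals all_analysis.
From mathcomp Require Import complex measurable_realfun ess_sup_inf ring lra.
Set Implicit Arguments.
Unset Strict Implicit.
Unset Printing Implicit Defensive.
Import Order.TTheory GRing.Theory Num.Theory.
Import numFieldNormedType.Exports.
Local Open Scope classical_set_scope.
Local Open Scope ring_scope.

(** Up to the predictor (Artstein) transform the modal coordinates satisfy
    Z' = A_K Z + Gamma, and K X_e = 0, so that the deviation of Z is driven only
    by the deviations of r and d. A Schur triangularization of A_K yields a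
    quadratic Lyapunov function, and v = K Z, X = Z - (integral over the delay),
    are then controlled by the deviation of Z. The remaining modes satisfy
    scalar equations of rate lam_j <= lam_n < 0; the Gronwall lemma applied to
    the sum over n <= j < N of - lam_j (w_j - w_(e,j))^2 bounds the H^1_0 norm of
    w - w_e uniformly in N, because <A f, f> = - |f'|^2 + <c f, f>. In all these
    estimates the squares are compared with one weight
    g(t) = I^2 exp(- theta t) + p(t), where I is the initial deviation and p is
    a majorant, decreasing to 0 but at most at rate theta, of the squared
    deviations of r and d. *)

(** * Lyapunov functions of Hurwitz matrices *)

Section EuclideanNorm.
Context {R : realType}.

(** The output y_x(t,0) is not a bounded functional of w in L^2, whereas the heat equation is only
    available in L^2. Green's formula against an affine function shows that e_j'(0) / lam_j is
    square summable, so that the series subtracted from z in zeta is a bounded functional. Its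
    derivative along the flow cancels the share of the trace carried by the stable modes, which
    leaves a finite-dimensional equation for zeta. For the same reason the H^1_0 energy itself is
    never differentiated in time, only finite sums of modes are. The constants must not depend on
    the data, nor [rho] on the initial state, although each estimate feeds the next one through a
    convolution in time or a delay. A weight that loses at most a factor exp(theta D) over one
    delay, with theta below every decay rate, passes each of these operations at the cost of a
    constant factor. Since squares are compared throughout, the final rate is theta / 2. *)

Definition dotc m (x y : 'cV[R]_m) : R := \sum_i x i 0 * y i 0.

Definition sqn m (x : 'cV[R]_m) : R := dotc x x.

Lemma sqn_ge0 m (x : 'cV[R]_m) : 0 <= sqn x.
Proof. by apply: sumr_ge0 => i _; rewrite -expr2 sqr_ge0. Qed.

Lemma sqr_le_sqn m (x : 'cV[R]_m) i : x i 0 ^+ 2 <= sqn x.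
Proof.
rewrite /sqn /dotc (bigD1 i)//= -expr2 lerDl.
by apply: sumr_ge0 => j _; rewrite -expr2 sqr_ge0.
Qed.

(** Cauchy-Schwarz: expand both sides as double sums and symmetrize the right one; the terms of
    index i, j then differ by half the square of [f i * g j - f j * g i]. *)
Lemma sqr_sum_le k (f g : 'I_k -> R) :
  (\sum_i f i * g i) ^+ 2 <= (\sum_i f i ^+ 2) * (\sum_i g i ^+ 2).
Proof.
have -> : (\sum_i f i * g i) ^+ 2 =
    \sum_i \sum_j (f i * g i) * (f j * g j).
  by rewrite expr2 mulr_suml; apply: eq_bigr => i _; rewrite mulr_sumr.
have -> : (\sum_i f i ^+ 2) * (\sum_i g i ^+ 2) =
    \sum_i \sum_j ((f i * g j) ^+ 2 + (f j * g i) ^+ 2) / 2.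
  rewrite -[LHS](@mulfK _ 2) // [X in X / _ = _]mulrC mulr_natl mulr2n.
  rewrite [X in X + _]mulr_suml [X in _ + X]mulrC [X in _ + X]mulr_suml.
  rewrite -big_split/= mulr_suml; apply: eq_bigr => i _.
  rewrite !mulr_sumr -big_split/= mulr_suml; apply: eq_bigr => j _.
  by congr (_ / _); ring.
apply: ler_sum => i _; apply: ler_sum => j _.
rewrite ler_pdivlMr//.
have := sqr_ge0 (f i * g j - f j * g i); lra.
Qed.

Lemma sqn_mulmx m p (N : 'M[R]_(m, p)) :
  exists2 C : R, 0 < C & forall x : 'cV_p, sqn (N *m x) <= C * sqn x.
Proof.
(* One plus the squared Frobenius norm of [N]; the one keeps the constant positive when [N]
   vanishes. *)
exists (1 + \sum_i \sum_j N i j ^+ 2) => [|x].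
  rewrite ltr_pwDl//; apply: sumr_ge0 => i _; apply: sumr_ge0 => j _.
  exact: sqr_ge0.
have sqnE : sqn x = \sum_j x j 0 ^+ 2.
  by apply: eq_bigr => j _; rewrite expr2.
rewrite mulrDl mul1r -[leLHS]add0r lerD ?sqn_ge0// mulr_suml.
apply: ler_sum => i _; rewrite -expr2 mxE.
by rewrite sqnE; exact: sqr_sum_le.
Qed.

Lemma dotcDr m (x y z : 'cV[R]_m) : dotc x (y + z) = dotc x y + dotc x z.
Proof. by rewrite -big_split; apply: eq_bigr => i _; rewrite mxE mulrDr. Qed.

Lemma dotc_young m (x y : 'cV[R]_m) (k : R) : 0 < k ->
  2 * dotc x y <= k * sqn x + k^-1 * sqn y.
Proof.
move=> k0; rewrite /dotc /sqn /dotc !mulr_sumr -big_split/=.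
apply: ler_sum => i _; rewrite -subr_ge0.
set a := x i 0; set b := y i 0.
have -> : k * (a * a) + k^-1 * (b * b) - 2 * (a * b) = k * (a - b / k) ^+ 2.
  by field; rewrite gt_eqF.
by rewrite mulr_ge0 ?sqr_ge0// ltW.
Qed.

End EuclideanNorm.

Section Lyapunov.
Context {R : realType}.
Local Notation ReM := (map_mx (@complex.Re R)).
Local Notation ImM := (map_mx (@complex.Im R)).

Let ReM_mul m p q (A : 'M[R[i]]_(m, p)) (B : 'M[R[i]]_(p, q)) :
  ReM (A *m B) = ReM A *m ReM B - ImM A *m ImM B.
Proof.
apply/matrixP => i j; rewrite !mxE (raddf_sum (@complex.Re R : Rcomplex R -> R)).
rewrite -sumrB; apply: eq_bigr => k _; rewrite !mxE.
by case: (A i k) (B k j) => [a b] [c d].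
Qed.

Let ImM_mul m p q (A : 'M[R[i]]_(m, p)) (B : 'M[R[i]]_(p, q)) :
  ImM (A *m B) = ReM A *m ImM B + ImM A *m ReM B.
Proof.
apply/matrixP => i j; rewrite !mxE (raddf_sum (@complex.Im R : Rcomplex R -> R)).
rewrite -big_split; apply: eq_bigr => k _; rewrite !mxE.
by case: (A i k) (B k j) => [a b] [c d].
Qed.

(* The off-diagonal part of a triangular matrix becomes negligible in the     *)
(* coordinates scaled by the powers of a small eps.                           *)
Lemma trig_dissipative m (T : 'M[R[i]]_m) : is_trig_mx T ->
  (forall i, complex.Re (T i i) < 0) ->
  exists eps sigma : R, [/\ 0 < eps, 0 < sigma &
  forall x y : 'cV[R]_m,
  \sum_(i < m) eps ^+ i ^+ 2 * (x i 0 * (ReM T *m x - ImM T *m y) i 0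
                        + y i 0 * (ReM T *m y + ImM T *m x) i 0)
  <= - sigma * \sum_(i < m) eps ^+ i ^+ 2 * (x i 0 ^+ 2 + y i 0 ^+ 2)].
Proof.
move=> /is_trig_mxP Ttrig Tneg.
(* [s] is half the distance from the diagonal to the imaginary axis, capped by the default 1 of the
   minimum, which also covers the empty matrix. *)
have [s s0 sT] : exists2 s : R, 0 < s & forall i, complex.Re (T i i) <= - (2 * s).
  exists (\big[Num.min/1]_i (- complex.Re (T i i)) / 2) => [|i].
    by rewrite divr_gt0// lt_bigmin// => i _; rewrite oppr_gt0.
  by rewrite mulrC divfK// lerNr; exact: bigmin_le_cond.
pose tau : R := 1 + \sum_i \sum_j (`|complex.Re (T i j)| + `|complex.Im (T i j)|).
have tau_ge i j : `|complex.Re (T i j)| + `|complex.Im (T i j)| <= tau.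
  rewrite /tau (bigD1 i)//= (bigD1 j)//=.
  rewrite -[leLHS]add0r lerD// -[leLHS]addr0 lerD//; last first.
    by rewrite sumr_ge0// => k _; rewrite sumr_ge0// => l _; rewrite addr_ge0.
  by rewrite lerDl sumr_ge0// => l _; rewrite addr_ge0.
have tau1 : 1 <= tau by rewrite lerDl sumr_ge0// => i _; rewrite sumr_ge0// => j _; rewrite addr_ge0.
have tau0 : 0 < tau by exact: lt_le_trans tau1.
(* Each pair i, j will contribute at most [eps * tau * (E i + E j)], in total
   [2 * (eps * tau * m%:R)] times the sum of the [E i]; with this [eps] it consumes at most [s] of
   the diagonal rate [2 * s]. *)
pose eps := Num.min 1 (s / (2 * tau * m.+1%:R)).
have eps0 : 0 < eps by rewrite lt_min ltr01/= divr_gt0// !mulr_gt0.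
have eps1 : eps <= 1 by rewrite ge_min lexx.
have eps_le : 2 * (eps * tau * m%:R) <= s.
  have : eps <= s / (2 * tau * m.+1%:R) by rewrite ge_min lexx orbT.
  rewrite ler_pdivlMr ?mulr_gt0// => H; apply: le_trans H.
  rewrite -natr1; set k := m%:R.
  have := mulr_gt0 eps0 tau0; lra.
exists eps, s; split=> // x y.
pose E (i : 'I_m) : R := eps ^+ i ^+ 2 * (x i 0 ^+ 2 + y i 0 ^+ 2).
have E0 i : 0 <= E i by rewrite mulr_ge0 ?sqr_ge0// addr_ge0// sqr_ge0.
pose t (i j : 'I_m) : R := eps ^+ i ^+ 2 *
   (x i 0 * (complex.Re (T i j) * x j 0 - complex.Im (T i j) * y j 0)
  + y i 0 * (complex.Re (T i j) * y j 0 + complex.Im (T i j) * x j 0)).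
have tE (i : 'I_m) : eps ^+ i ^+ 2 * (x i 0 * (ReM T *m x - ImM T *m y) i 0
      + y i 0 * (ReM T *m y + ImM T *m x) i 0) = \sum_j t i j.
  rewrite -mulr_sumr; congr (_ * _); rewrite big_split/= -!mulr_sumr.
  rewrite sumrB big_split/= !mxE.
  by congr (_ * (_ - _) + _ * (_ + _)); apply: eq_bigr => j _; rewrite !mxE.
under eq_bigr do rewrite tE.
have tle (i j : 'I_m) : t i j <= (if i == j then - (2 * s) * E i else 0) + eps * tau * (E i + E j).
  have EE : 0 <= eps * tau * (E i + E j).
    by rewrite mulr_ge0// ?addr_ge0// mulr_ge0// ltW.
  have [<-|ij] := eqVneq i j.
    rewrite -[t i i]addr0 lerD//; last first.
      by rewrite mulr_ge0// ?addr_ge0// mulr_ge0// ltW.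
    have -> : t i i = complex.Re (T i i) * E i by rewrite /t /E; ring.
    by rewrite ler_wpM2r.
  (* [T] is lower triangular, so only the entries with j < i remain. There eps^(2i) = eps^(i-j)
     eps^i eps^j, and the spare factor eps^(i-j) is at most eps. *)
  rewrite add0r; have [ltij|leji] := ltnP i j.
    rewrite /t Ttrig//=; apply: le_trans EE.
    by rewrite !(mul0r, mulr0, addr0, subrr).
  have ltji : (j < i)%N by rewrite ltn_neqAle leji andbT eq_sym.
  have -> : t i j = eps ^+ (i - j) *
      (complex.Re (T i j) * ((eps ^+ i * x i 0) * (eps ^+ j * x j 0)
                           + (eps ^+ i * y i 0) * (eps ^+ j * y j 0))
     + complex.Im (T i j) * ((eps ^+ i * y i 0) * (eps ^+ j * x j 0)
                           - (eps ^+ i * x i 0) * (eps ^+ j * y j 0))).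
    rewrite /t; have : eps ^+ i = eps ^+ (i - j) * eps ^+ j.
      by rewrite -exprD subnK.
    by move=> H; rewrite {1}expr2 {2}H; ring.
  have -> : E i = (eps ^+ i * x i 0) ^+ 2 + (eps ^+ i * y i 0) ^+ 2.
    by rewrite /E; ring.
  have -> : E j = (eps ^+ j * x j 0) ^+ 2 + (eps ^+ j * y j 0) ^+ 2.
    by rewrite /E; ring.
  move: (eps ^+ i * x i 0) (eps ^+ i * y i 0) (eps ^+ j * x j 0)
        (eps ^+ j * y j 0) => a b c d.
  have epsij : eps ^+ (i - j) <= eps.
    have : (0 < i - j)%N by rewrite subn_gt0.
    case: (i - j)%N => // k _; rewrite exprS.
    by rewrite ler_piMr ?exprn_ile1 ?(ltW eps0).
  set q := a ^+ 2 + b ^+ 2 + (c ^+ 2 + d ^+ 2).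
  have q0 : 0 <= q by rewrite !addr_ge0// sqr_ge0.
  have H1 : `|a * c + b * d| <= q.
    rewrite ler_norml /q; apply/andP; split;
      have := sqr_ge0 (a - c); have := sqr_ge0 (a + c);
      have := sqr_ge0 (b - d); have := sqr_ge0 (b + d); nra.
  have H2 : `|b * c - a * d| <= q.
    rewrite ler_norml /q; apply/andP; split;
      have := sqr_ge0 (b - c); have := sqr_ge0 (b + c);
      have := sqr_ge0 (a - d); have := sqr_ge0 (a + d); nra.
  rewrite -mulrA; apply: (@le_trans _ _ (eps ^+ (i - j) * (tau * q))).
    rewrite ler_wpM2l ?exprn_ge0 ?(ltW eps0)//.
    apply: (le_trans (ler_norm _)); apply: (le_trans (ler_normD _ _)).
    rewrite !normrM; apply: le_trans (_ : (`|complex.Re (T i j)| +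
        `|complex.Im (T i j)|) * q <= _); last by rewrite ler_wpM2r.
    by rewrite mulrDl lerD// ler_wpM2l.
  by rewrite ler_wpM2r// mulr_ge0// ltW.
apply: (@le_trans _ _ (\sum_i \sum_j ((if i == j then - (2 * s) * E i else 0)
    + eps * tau * (E i + E j)))).
  by apply: ler_sum => i _; apply: ler_sum.
rewrite -[\sum_(i < m) eps ^+ i ^+ 2 * (_ ^+ 2 + _)]/(\sum_i E i).
set S := \sum_i E i.
have -> : \sum_i \sum_j ((if i == j then - (2 * s) * E i else 0)
    + eps * tau * (E i + E j)) = - (2 * s) * S + 2 * (eps * tau * m%:R) * S.
  have Ei (i : 'I_m) : \sum_j ((if i == j then - (2 * s) * E i else 0)
      + eps * tau * (E i + E j))
      = - (2 * s) * E i + eps * tau * (m%:R * E i + S).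
    rewrite big_split/=; congr (_ + _).
      rewrite (bigD1 i)//= eqxx big1 ?addr0// => j /negPf ji.
      by rewrite eq_sym ji.
    have sumE : \sum_(j < m) E i = m%:R * E i.
      by rewrite sumr_const card_ord mulr_natl.
    by rewrite -mulr_sumr big_split/= sumE.
  under eq_bigr => i _ do rewrite Ei.
  rewrite big_split/= -!mulr_sumr big_split/= -mulr_sumr sumr_const card_ord.
  by rewrite -/S -[S *+ m]mulr_natl; ring.
have S0 : 0 <= S by apply: sumr_ge0 => i _; exact: E0.
have := ler_wpM2r S0 eps_le; rewrite -/S; lra.
Qed.

Lemma Hurwitz_unitmx m (M : 'M[R]_m) : Hurwitz M -> M \in unitmx.
Proof.
move=> HM; rewrite -(map_unitmx (real_complex R)) -row_free_unit.
rewrite -kermx_eq0; apply/negPn/negP => k0.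
have /HM/= : eigenvalue (map_mx (real_complex R) M) 0.
  by rewrite /eigenvalue /eigenspace raddf0 subr0.
by rewrite ltxx.
Qed.

(** The quadratic form is the squared norm of [S *m x], where [S] stacks the real and imaginary
    parts of the scaled Schur coordinates of x. This keeps the form real, and the left inverse [N]
    makes it coercive. *)
Lemma Hurwitz_lyapunov m (M : 'M[R]_m) : (0 < m)%N -> Hurwitz M ->
  exists (S : 'M[R]_(m + m, m)) (N : 'M[R]_(m, m + m)) (sigma : R),
  [/\ 0 < sigma, N *m S = 1%:M &
      forall x, 2 * dotc (S *m x) (S *m (M *m x)) <= - sigma * sqn (S *m x)].
Proof.
move=> m0 HM; pose MC := map_mx (real_complex R) M.
have [P /unitarymx_unit Pu Ptrig] := Schur MC m0.
have Ttrig : is_trig_mx (P *m MC *m invmx P) by rewrite -conjumx.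
pose T := P *m MC *m invmx P.
have PMC : P *m MC = T *m P by rewrite /T mulmxKV.
(* The diagonal entries of a triangular matrix are roots of its characteristic polynomial, and a row
   eigenvector v of T yields the row eigenvector v P of M. *)
have Tneg i : complex.Re (T i i) < 0.
  have /eigenvalueP[v vT v0] : eigenvalue T (T i i); last first.
    apply: HM; apply/eigenvalueP; exists (v *m P).
      by rewrite -mulmxA PMC mulmxA vT scalemxAl.
    by apply: contra_neq v0 => vP0; rewrite -[v](mulmxK Pu) vP0 mul0mx.
  rewrite eigenvalue_root_char (char_poly_trig Ttrig) /root horner_prod (bigD1 i)//=.
  by rewrite !hornerE subrr mul0r.
have [eps [sigma [eps0 sigma0 dissip]]] := trig_dissipative Ttrig Tneg.
pose E : 'M[R]_m := diag_mx (\row_i eps ^+ i).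
pose E' : 'M[R]_m := diag_mx (\row_i eps ^- i).
have EE' : E' *m E = 1%:M.
  apply/matrixP => i j; rewrite mul_diag_mx !mxE mulrnAr mulVf//.
  by rewrite expf_neq0// gt_eqF.
have ReMC : ReM MC = M by apply/matrixP => i j; rewrite !mxE.
have ImMC : ImM MC = 0 by apply/matrixP => i j; rewrite !mxE.
exists (col_mx (E *m ReM P) (E *m ImM P)).
(* [N] takes the real part of P^-1 E^-1 applied to the complex vector whose real and imaginary parts
   are stacked by [S]. *)
exists (row_mx (ReM (invmx P) *m E') (- ImM (invmx P) *m E')), (2 * sigma).
split.
- by rewrite mulr_gt0.
- rewrite mul_row_col -!mulmxA ![E' *m (E *m _)]mulmxA EE' !mul1mx mulNmx.
  rewrite -ReM_mul mulVmx//; apply/matrixP => i j; rewrite !mxE.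
  by case: (i == j).
- move=> x.
  have dotE (a b c d : 'cV[R]_m) : dotc (col_mx a b) (col_mx c d) =
      dotc a c + dotc b d.
    rewrite /dotc big_split_ord/=.
    by congr (_ + _); apply: eq_bigr => i _; rewrite ?col_mxEu ?col_mxEd.
  rewrite /sqn !mul_col_mx !dotE.
  have := dissip (ReM P *m x) (ImM P *m x); rewrite -/T.
  have -> : ReM T *m (ReM P *m x) - ImM T *m (ImM P *m x) = ReM P *m (M *m x).
    by rewrite !mulmxA -mulmxBl -ReM_mul -PMC ReM_mul ReMC ImMC mulmx0 subr0.
  have -> : ReM T *m (ImM P *m x) + ImM T *m (ReM P *m x) = ImM P *m (M *m x).
    by rewrite !mulmxA -mulmxDl -ImM_mul -PMC ImM_mul ReMC ImMC mulmx0 add0r.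
  have Edot (a b : 'cV[R]_m) : dotc (E *m a) (E *m b) =
      \sum_(i < m) eps ^+ i ^+ 2 * (a i 0 * b i 0).
    by apply: eq_bigr => i _; rewrite !mul_diag_mx !mxE; ring.
  rewrite -!mulmxA !Edot => H.
  have -> : \sum_(i < m) eps ^+ i ^+ 2 * ((ReM P *m x) i 0 * (ReM P *m (M *m x)) i 0)
     + \sum_(i < m) eps ^+ i ^+ 2 * ((ImM P *m x) i 0 * (ImM P *m (M *m x)) i 0) =
    \sum_(i < m) eps ^+ i ^+ 2 * ((ReM P *m x) i 0 * (ReM P *m (M *m x)) i 0 +
      (ImM P *m x) i 0 * (ImM P *m (M *m x)) i 0).
    by rewrite -big_split; apply: eq_bigr => i _; rewrite mulrDr.
  have -> : \sum_(i < m) eps ^+ i ^+ 2 * ((ReM P *m x) i 0 * (ReM P *m x) i 0)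
     + \sum_(i < m) eps ^+ i ^+ 2 * ((ImM P *m x) i 0 * (ImM P *m x) i 0) =
    \sum_(i < m) eps ^+ i ^+ 2 * ((ReM P *m x) i 0 ^+ 2 + (ImM P *m x) i 0 ^+ 2).
    by rewrite -big_split; apply: eq_bigr => i _; rewrite /= mulrDr !expr2.
  lra.
Qed.

End Lyapunov.

(** * Matrix exponential *)

Section Calculus.
Context {R : realType}.

Lemma is_derive_sumr k (f : 'I_k -> R -> R) (df : 'I_k -> R) (t : R) :
  (forall l, is_derive t 1 (f l) (df l)) ->
  is_derive t 1 (fun s => \sum_l f l s) (\sum_l df l).
Proof.
move=> fdf; have := is_derive_sum fdf.
by congr is_derive; apply/funext => s; rewrite fct_sumE.
Qed.

Lemma near_cvg_eq (T : Type) (F : set_system T) {FF : Filter F} (f g : T -> R) (l : R) :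
  (\forall x \near F, f x = g x) -> f x @[x --> F] --> l -> g x @[x --> F] --> l.
Proof.
by move=> fg; apply: cvg_trans; apply: near_eq_cvg; apply: filterS fg => x ->.
Qed.

Lemma within_continuousM (T : topologicalType) (A : set T) (f g : T -> R) :
  {within A, continuous f} -> {within A, continuous g} ->
  {within A, continuous (fun x => f x * g x)}.
Proof. by move=> cf cg x; exact: (@continuousM R (subspace A) f g x (cf x) (cg x)). Qed.

Lemma cvg_sumr (T : Type) (F : set_system T) {FF : Filter F} (I : Type)
    (r : seq I) (f : I -> T -> R) (l : I -> R) :
  (forall k, f k x @[x --> F] --> l k) ->
  \sum_(k <- r) f k x @[x --> F] --> \sum_(k <- r) l k.
Proof.
move=> fl; elim: r => [|k r IH].
  by rewrite big_nil; under eq_cvg do rewrite big_nil; exact: cvg_cst.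
rewrite big_cons; under eq_cvg do rewrite big_cons.
exact: cvgD.
Qed.

End Calculus.

Section MatrixExponential.
Context {R : realType} (m : nat).
Implicit Types (A B : 'M[R]_m) (t : R) (i j : 'I_m).

Lemma entry_exp_bound A : exists2 M : R, 0 <= M & forall k i j, `|(A ^+ k) i j| <= M ^+ k.
Proof.
pose M := \sum_i \sum_j `|A i j|; have M0 : 0 <= M.
  by apply: sumr_ge0 => i _; apply: sumr_ge0.
exists M => //; elim=> [|k IH] i j.
  by rewrite !expr0 mxE; case: (i == j); rewrite ?normr1 ?normr0.
rewrite !exprS mxE; apply: (le_trans (ler_norm_sum _ _ _)).
apply: (@le_trans _ _ (\sum_l `|A i l| * M ^+ k)).
  by apply: ler_sum => l _; rewrite normrM ler_wpM2l.
rewrite -mulr_suml ler_wpM2r ?exprn_ge0// /M [leRHS](bigD1 i)//= lerDl.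
by apply: sumr_ge0 => k' _; apply: sumr_ge0.
Qed.

(** Compared with M^p exp(M |t|). The shift [p] covers the series obtained by differentiating p
    times termwise. *)
Lemma cvg_exp_pseries A p i j t :
  cvgn (pseries (fun k => (A ^+ (k + p)) i j / k`!%:R) t).
Proof.
have [M M0 HM] := entry_exp_bound A.
apply: normed_cvg.
apply: (@series_le_cvg _ _ (M ^+ p *: exp_coeff (M * `|t|))) => [k|k|k|].
- exact: normr_ge0.
- by rewrite mulr_ge0 ?exprn_ge0// divr_ge0// ?exprn_ge0// mulr_ge0.
- rewrite /= !normrM normrX normfV [`|k`!%:R|]ger0_norm//.
  rewrite -[leRHS]/(M ^+ p * ((M * `|t|) ^+ k / k`!%:R)) exprMn.
  rewrite [leRHS](_ : _ = M ^+ (k + p) / k`!%:R * `|t| ^+ k).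
    by rewrite ler_wpM2r// ?exprn_ge0// ler_wpM2r.
  by rewrite exprD; ring.
- exact/is_cvg_seriesZ/is_cvg_series_exp_coeff.
Qed.

Lemma exprZmx A t k : (t *: A) ^+ k = t ^+ k *: A ^+ k.
Proof.
elim: k => [|k IH]; first by rewrite !expr0 scale1r.
rewrite !exprS IH; transitivity ((t *: A) *m (t ^+ k *: A ^+ k)) => //.
by rewrite -scalemxAl -scalemxAr scalerA.
Qed.

Lemma expmxE A t i j :
  expmx (t *: A) i j = limn (pseries (fun k => (A ^+ k) i j / k`!%:R) t).
Proof.
rewrite mxE; congr (limn _); apply/funext => N; apply: eq_bigr => k _.
by rewrite exprZmx mxE [_ * (A ^+ k) i j]mulrC mulrAC.
Qed.

Lemma cvg_expmx A t i j :
  pseries (fun k => (A ^+ k) i j / k`!%:R) t @ \oo --> expmx (t *: A) i j.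
Proof.
rewrite expmxE; have := @cvg_exp_pseries A 0 i j t.
by under [X in pseries X]eq_fun do rewrite addn0.
Qed.

Lemma limn_pseries_mul A t i j :
  limn (pseries (fun k => (A ^+ k.+1) i j / k`!%:R) t) =
  (A *m expmx (t *: A)) i j.
Proof.
apply/cvg_lim => //; rewrite mxE.
rewrite (_ : pseries _ _ = fun N => \sum_l A i l *
    pseries (fun k => (A ^+ k) l j / k`!%:R) t N).
  by apply: cvg_sumr => l; apply: cvgM (cvg_cst _) _; exact: cvg_expmx.
apply/funext => N; rewrite /pseries /series /=.
under [RHS]eq_bigr do rewrite mulr_sumr.
rewrite exchange_big/=; apply: eq_bigr => k _.
rewrite exprS mxE !mulr_suml; apply: eq_bigr => l _; ring.
Qed.

Lemma expmx_comm A t : A *m expmx (t *: A) = expmx (t *: A) *m A.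
Proof.
apply/matrixP => i j; rewrite -limn_pseries_mul; apply/cvg_lim => //.
rewrite mxE (_ : pseries _ _ = fun N => \sum_l
    pseries (fun k => (A ^+ k) i l / k`!%:R) t N * A l j).
  by apply: cvg_sumr => l; apply: cvgM _ (cvg_cst _); exact: cvg_expmx.
apply/funext => N; rewrite /pseries /series /=.
under [RHS]eq_bigr do rewrite mulr_suml.
rewrite exchange_big/=; apply: eq_bigr => k _.
rewrite exprSr mxE !mulr_suml; apply: eq_bigr => l _; ring.
Qed.

Lemma is_derive_expmx A t i j :
  is_derive t 1 (fun s => expmx (s *: A) i j) ((A *m expmx (t *: A)) i j).
Proof.
have diffs p : pseries_diffs (fun k => (A ^+ (k + p)) i j / k`!%:R) =
    fun k => (A ^+ (k + p.+1)) i j / k`!%:R.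
  apply/funext => k; rewrite /pseries_diffs addSnnS factS natrM invfM.
  by rewrite mulrCA mulVKf// pnatr_eq0.
(* Termwise differentiation at t asks for convergence of the series and of its first two derived
   series at a point farther from 0, here |t| + 1. *)
have := @pseries_snd_diffs _ (fun k => (A ^+ (k + 0)) i j / k`!%:R) (`|t| + 1) t.
rewrite !diffs => /(_ (@cvg_exp_pseries _ _ _ _ _) (@cvg_exp_pseries _ _ _ _ _)
  (@cvg_exp_pseries _ _ _ _ _)).
rewrite [`|_ + 1|]ger0_norm ?addr_ge0// ltrDl ltr01 => /(_ isT).
under [X in pseries X t]eq_fun do rewrite addn1.
rewrite limn_pseries_mul; congr is_derive; apply/funext => s.
by rewrite expmxE; congr (limn (pseries _ _)); apply/funext => k; rewrite addn0.
Qed.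

Lemma expmx0 A : expmx (0 *: A) = 1%:M.
Proof.
apply/matrixP => i j; rewrite expmxE; apply/cvg_lim => //.
rewrite -(cvg_shiftn 1%N); apply: cvg_near_cst; near=> N.
rewrite /pseries /series /= addn1 big_nat_recl//= big1 ?addr0 => [|k _].
  by rewrite expr0 mulr1 divr1 mxE.
by rewrite expr0n mulr0.
Unshelve. all: by end_near. Qed.

(** For fixed s the product exp((s + t)A) exp(-tA) has zero derivative in t, hence equals exp(sA);
    the case s = 0 identifies the inverse of exp(tA). *)
Lemma expmx_addl A s t : expmx ((s + t) *: A) = expmx (s *: A) *m expmx (t *: A).
Proof.
pose F s t := expmx ((s + t) *: A) *m expmx ((- t) *: A).
have F_cst s' t' : F s' t' = expmx (s' *: A).
  have -> : F s' t' = F s' 0; last first.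
    by rewrite /F oppr0 addr0 expmx0 mulmx1.
  apply/matrixP => i j.
  apply: (@is_derive_0_is_cst _ (fun t => F s' t i j)) => u.
  have d1 l : is_derive u 1 (fun t => expmx ((s' + t) *: A) i l)
      ((A *m expmx ((s' + u) *: A)) i l).
    have d : is_derive u 1 (fun t => s' + t) (1 : R).
      exact: is_derive_eq (is_deriveD (is_derive_cst s' u (1 : R)) (is_derive_id u (1 : R))) (add0r _).
    have := @is_derive1_comp _ _ _ _ _ _ (is_derive_expmx A (s' + u) i l) d.
    by rewrite mulr1.
  have d2 l : is_derive u 1 (fun t => expmx ((- t) *: A) l j)
      (- (A *m expmx ((- u) *: A)) l j).
    have := @is_derive1_comp _ _ _ _ _ _ (is_derive_expmx A (- u) l j)
      (is_deriveNid _ _).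
    by rewrite mulrN1.
  have := is_derive_sumr (fun l => is_deriveM (d1 l) (d2 l)).
  rewrite (_ : (fun t => _) = fun t => F s' t i j); last first.
    by apply/funext => t0; rewrite /F mxE.
  move/is_derive_eq; apply.
  rewrite big_split/= -[RHS](subrr ((expmx ((s' + u) *: A) *m
    (A *m expmx ((- u) *: A))) i j)) addrC mxE; congr (_ + _); last first.
    by rewrite -sumrN; apply: eq_bigr => l _; rewrite scalerN.
  transitivity ((A *m expmx ((s' + u) *: A) *m expmx ((- u) *: A)) i j).
    by rewrite mxE; apply: eq_bigr => l _; rewrite /GRing.scale/= mulrC.
  by rewrite expmx_comm -mulmxA mxE.
have H0 : expmx (t *: A) *m expmx ((- t) *: A) = 1%:M.
  by have := F_cst 0 t; rewrite /F add0r expmx0.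
have := congr1 (mulmx^~ (expmx (t *: A))) (F_cst s t).
by rewrite /F -mulmxA (mulmx1C H0) mulmx1.
Qed.

(** Row i of A exp(tA) vanishes with that of A, so row i of the exponential is constant. The case in
    view is the first row of [matA], that of d(u_D)/dt = v_D. *)
Lemma expmx_row A i : (forall j, A i j = 0) ->
  forall t j, expmx (t *: A) i j = (i == j)%:R.
Proof.
move=> Ai0 t j.
have d (s : R) : is_derive s 1 (fun s => expmx (s *: A) i j) 0.
  apply: is_derive_eq (is_derive_expmx A s i j) _.
  by rewrite mxE big1// => k _; rewrite Ai0 mul0r.
by rewrite (is_derive_0_is_cst t 0 d) expmx0 mxE.
Qed.

Lemma continuous_expmx A i j : continuous (fun t => expmx (t *: A) i j).
Proof.
move=> t; apply/differentiable_continuous/derivable1_diffP.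
by have [] := is_derive_expmx A t i j.
Qed.

End MatrixExponential.

(** * Square-integrable functions on (0,L) *)

Section L2.
Context {R : realType} (L : R).
Local Notation mu := (@lebesgue_measure R).
Local Notation I := (`]0, L[%classic : set R).
Implicit Types (f g h : R -> R) (a : R).

Let mI : measurable (I : set (measurableTypeR R)). Proof. exact: measurable_itv. Qed.

Let restrict_sqr f : (fun x => ((f \_ I) x ^+ 2)) = ((fun x => f x ^+ 2) \_ I).
Proof.
by apply/funext => x; rewrite !patchE; case: ifP => // _; rewrite expr0n.
Qed.

Let powR_sqr f x :
  (`|(EFin \o (f \_ I)) x| `^ 2)%E = ((EFin \o (fun x => f x ^+ 2)) \_ I) x.
Proof.
rewrite restrict_EFin -restrict_sqr [LHS](poweR_EFin `|(f \_ I) x|).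
by rewrite powR_mulrn// real_normK ?num_real.
Qed.

Lemma inL2P f : inL2 L f <->
  measurable_fun I f /\ mu.-integrable I (EFin \o (fun x => f x ^+ 2)).
Proof.
split=> [Lf|[mf intf]].
- have := Lfun2_integrable_sqr Lf; rewrite restrict_sqr => intf; split.
    by move: Lf => /andP[]; rewrite inE/= => /(measurable_restrictT _ mI).2.
  by apply/(@integrable_mkcond _ _ _ mu I _ mI); rewrite restrict_EFin.
- apply/andP; split; rewrite inE/=; first exact: (measurable_restrictT _ mI).1.
  rewrite /finite_norm unlock poweR_lty//.
  under eq_integral => x _ do rewrite powR_sqr.
  by rewrite -integral_mkcond; exact: integrable_lty.
Qed.

Lemma inL2_measurable f : inL2 L f -> measurable_fun I f.
Proof. by move/inL2P => []. Qed.

Lemma integrable_inL2M f g : inL2 L f -> inL2 L g ->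
  mu.-integrable I (EFin \o (fun x => f x * g x)).
Proof.
move=> Lf Lg; have := Lfun2_mul_Lfun1 Lf Lg; rewrite Lfun1_integrable => H.
apply/(@integrable_mkcond _ _ _ mu I _ mI); rewrite restrict_EFin.
apply: eq_integrable H => // x _ /=; rewrite !patchE.
by case: ifP; rewrite // mul0r.
Qed.

Lemma inL2D f g : inL2 L f -> inL2 L g -> inL2 L (fun x => f x + g x).
Proof.
move=> Lf Lg; apply/inL2P; split.
  by apply: measurable_funD; exact: inL2_measurable.
have [_ If] := (inL2P f).1 Lf; have [_ Ig] := (inL2P g).1 Lg.
have := integrableD mI (integrableD mI If Ig) (integrableZl mI 2 (integrable_inL2M Lf Lg)).
apply: eq_integrable => // x _ /=.
by rewrite -EFinM -!EFinD; congr EFin; ring.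
Qed.

Lemma inL2Z a f : inL2 L f -> inL2 L (fun x => a * f x).
Proof.
move=> /inL2P[mf If]; apply/inL2P; split; first exact: measurable_funM.
apply: eq_integrable (integrableZl mI (a ^+ 2) If) => // x _ /=.
by rewrite -EFinM exprMn.
Qed.

Lemma inL2N f : inL2 L f -> inL2 L (fun x => - f x).
Proof. by move/(inL2Z (-1)); under eq_fun do rewrite mulN1r. Qed.

Lemma inL2B f g : inL2 L f -> inL2 L g -> inL2 L (fun x => f x - g x).
Proof. by move=> Lf Lg; apply: inL2D => //; exact: inL2N. Qed.

Lemma inL2_eq f g : {in `]0, L[, f =1 g} -> inL2 L f -> inL2 L g.
Proof.
move=> fg; rewrite /inL2 (_ : f \_ I = g \_ I)//; apply/funext => x.
by rewrite !patchE; case: ifP => // /set_mem/fg.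
Qed.

Lemma inL2_0 : inL2 L (fun _ => 0).
Proof.
apply/inL2P; split; first exact: measurable_cst.
apply: (eq_integrable mI (cst 0%E)); last exact: integrable0.
by move=> x _ /=; rewrite expr0n.
Qed.

Lemma inL2_sum (N : nat) (F : nat -> R -> R) : (forall i, inL2 L (F i)) ->
  inL2 L (fun x => \sum_(0 <= i < N) F i x).
Proof.
move=> LF; elim: N => [|N IH].
  by under eq_fun do rewrite big_nil; exact: inL2_0.
by under eq_fun do rewrite big_nat_recr//=; exact: inL2D.
Qed.

Lemma innerC f g : inner L f g = inner L g f.
Proof. by apply: eq_Rintegral => x _; rewrite mulrC. Qed.

Lemma eq_inner f g h : {in `]0, L[, f =1 g} -> inner L f h = inner L g h.
Proof. by move=> fg; apply: eq_Rintegral => x /set_mem xI; rewrite fg. Qed.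

Lemma ae_eq_inner f g h : inL2 L f -> inL2 L g -> inL2 L h ->
  {ae mu, forall x, x \in `]0, L[ -> f x = g x} -> inner L f h = inner L g h.
Proof.
move=> Lf Lg Lh fg; congr fine; apply: ae_eq_integral => //.
- by case/integrableP: (integrable_inL2M Lf Lh).
- by case/integrableP: (integrable_inL2M Lg Lh).
- by apply: (@filterS _ _ (ae_filter_ringOfSetsType mu)) fg => x fg xI; rewrite /= fg.
Qed.

Lemma innerDl f g h : inL2 L f -> inL2 L g -> inL2 L h ->
  inner L (fun x => f x + g x) h = inner L f h + inner L g h.
Proof.
move=> Lf Lg Lh; rewrite /inner -RintegralD//; try exact: integrable_inL2M.
by apply: eq_Rintegral => x _; rewrite mulrDl.
Qed.

Lemma innerZl a f h : inL2 L f -> inL2 L h ->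
  inner L (fun x => a * f x) h = a * inner L f h.
Proof.
move=> Lf Lh; rewrite /inner -RintegralZl//; last exact: integrable_inL2M.
by apply: eq_Rintegral => x _; rewrite mulrA.
Qed.

Lemma innerNl f h : inL2 L f -> inL2 L h ->
  inner L (fun x => - f x) h = - inner L f h.
Proof.
move=> Lf Lh; rewrite -[RHS]mulN1r -innerZl//.
by apply: eq_inner => x _; rewrite mulN1r.
Qed.

Lemma innerBl f g h : inL2 L f -> inL2 L g -> inL2 L h ->
  inner L (fun x => f x - g x) h = inner L f h - inner L g h.
Proof. by move=> Lf Lg Lh; rewrite innerDl ?innerNl//; exact: inL2N. Qed.

Lemma innerDr f g h : inL2 L f -> inL2 L g -> inL2 L h ->
  inner L h (fun x => f x + g x) = inner L h f + inner L h g.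
Proof. by move=> Lf Lg Lh; rewrite !(innerC h) innerDl. Qed.

Lemma innerZr a f h : inL2 L f -> inL2 L h ->
  inner L h (fun x => a * f x) = a * inner L h f.
Proof. by move=> Lf Lh; rewrite !(innerC h) innerZl. Qed.

Lemma innerBr f g h : inL2 L f -> inL2 L g -> inL2 L h ->
  inner L h (fun x => f x - g x) = inner L h f - inner L h g.
Proof. by move=> Lf Lg Lh; rewrite !(innerC h) innerBl. Qed.

Lemma inner0l h : inner L (fun _ => 0) h = 0.
Proof.
rewrite /inner (_ : (fun _ => _) = cst 0) ?Rintegral_cst ?mul0r//.
by apply/funext => x; rewrite mul0r.
Qed.

Lemma inner_suml (N : nat) (F : nat -> R -> R) h :
  (forall i, inL2 L (F i)) -> inL2 L h ->
  inner L (fun x => \sum_(0 <= i < N) F i x) h = \sum_(0 <= i < N) inner L (F i) h.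
Proof.
move=> LF Lh; elim: N => [|N IH].
  by under eq_fun do rewrite big_nil; rewrite big_nil inner0l.
under eq_fun do rewrite big_nat_recr//=.
by rewrite innerDl ?IH ?big_nat_recr//; exact: inL2_sum.
Qed.

Lemma inner_ge0 f : 0 <= inner L f f.
Proof. by apply: Rintegral_ge0 => x _; rewrite -expr2 sqr_ge0. Qed.

Lemma innerD_le f h : inL2 L f -> inL2 L h ->
  inner L (fun x => f x + h x) (fun x => f x + h x) <= 2 * (inner L f f + inner L h h).
Proof.
move=> Lf Lh; have Lfh := inL2D Lf Lh; have Lfmh := inL2B Lf Lh.
have := inner_ge0 (fun x => f x - h x).
rewrite innerBl// !innerBr// innerDl// !innerDr// (innerC h f); lra.
Qed.

Lemma L2normE f : inL2 L f -> L2norm L f = (Num.sqrt (inner L f f))%:E.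
Proof.
move=> Lf; rewrite /L2norm unlock.
under eq_integral => x _ do rewrite powR_sqr.
rewrite -integral_mkcond.
have [_ If] := (inL2P f).1 Lf.
have -> : (\int[mu]_(x in I) (f x ^+ 2)%:E)%E = (inner L f f)%:E.
  rewrite /inner /Rintegral fineK; last exact/integrable_fin_num/integrable_inL2M.
  by apply: eq_integral => x _; rewrite /= expr2.
by rewrite poweR_EFin powR12_sqrt// inner_ge0.
Qed.

Lemma CauchySchwarz f g : inL2 L f -> inL2 L g ->
  inner L f g ^+ 2 <= inner L f f * inner L g g.
Proof.
move=> Lf Lg; have key (a b : R) :
    0 <= a ^+ 2 * inner L f f - 2 * a * b * inner L f g + b ^+ 2 * inner L g g.
  have -> : a ^+ 2 * inner L f f - 2 * a * b * inner L f g + b ^+ 2 * inner L g g =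
      inner L (fun x => a * f x - b * g x) (fun x => a * f x - b * g x).
    have La := inL2Z a Lf; have Lb := inL2Z b Lg; have Lab := inL2B La Lb.
    by rewrite innerBl// !innerBr// !innerZl// !innerZr// (innerC g f); ring.
  exact: inner_ge0.
(* With F, G the squared norms and p the inner product, the choices (G, p) and (p, F) give G and F
   times the Gram determinant; the degenerate case F = G = 0 is settled by (1, p). *)
have := key (inner L g g) (inner L f g); have := key (inner L f g) (inner L f f).
have := inner_ge0 f; have := inner_ge0 g.
set F := inner L f f; set G := inner L g g; set p := inner L f g => G0 F0 k1 k2.
have {}k1 : 0 <= F * (F * G - p ^+ 2) by lra.
have {}k2 : 0 <= G * (F * G - p ^+ 2) by lra.
rewrite -subr_ge0; have [F00|F_gt0] := eqVneq F 0; last first.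
  by rewrite -(pmulr_rge0 _ (_ : 0 < F))// lt_neqAle eq_sym F_gt0.
have [G00|G_gt0] := eqVneq G 0; last first.
  by rewrite -(pmulr_rge0 _ (_ : 0 < G))// lt_neqAle eq_sym G_gt0.
have := key 1 p; have := key 1 (- p).
rewrite -/F -/G -/p F00 G00 => k3 k4; nra.
Qed.

Section Basis.
Variable e : nat -> R -> R.
Hypothesis e_basis : hilbert_basis L e.
Local Notation coef f j := (inner L f (e j)).

Let Le j : inL2 L (e j). Proof. by case: e_basis. Qed.

Let ortho i j : inner L (e i) (e j) = (i == j)%:R.
Proof. by case: e_basis. Qed.

Let comb_inL2 N (k : nat -> R) : inL2 L (fun x => \sum_(0 <= j < N) k j * e j x).
Proof. by apply: inL2_sum => j; exact: inL2Z. Qed.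

Lemma inner_comb f N (k : nat -> R) : inL2 L f ->
  inner L (fun x => \sum_(0 <= j < N) k j * e j x) f =
  \sum_(0 <= j < N) k j * coef f j.
Proof.
move=> Lf; rewrite inner_suml//; last by move=> j; exact: inL2Z.
by apply: eq_bigr => j _; rewrite innerZl// innerC.
Qed.

(** Completing the square in the coefficients: the error is the residual of the orthogonal
    projection plus the distance of [k] to the Fourier coefficients. Bessel's inequality and the
    optimality of Fourier sums both follow. *)
Lemma inner_sub_comb f N (k : nat -> R) : inL2 L f ->
  inner L (fun x => f x - \sum_(0 <= j < N) k j * e j x)
          (fun x => f x - \sum_(0 <= j < N) k j * e j x) =
  inner L f f - \sum_(0 <= j < N) coef f j ^+ 2
  + \sum_(0 <= j < N) (coef f j - k j) ^+ 2.
Proof.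
move=> Lf; have Lk := comb_inL2 N k; have Lfk := inL2B Lf Lk.
rewrite innerBl// !innerBr// (innerC f) !inner_comb//.
have -> : \sum_(0 <= j < N) k j *
    coef (fun x => \sum_(0 <= j0 < N) k j0 * e j0 x) j =
    \sum_(0 <= j < N) k j ^+ 2.
  rewrite !big_mkord; apply: eq_bigr => j _.
  rewrite inner_comb// big_mkord (bigD1 j)//= ortho eqxx mulr1 big1 ?addr0//.
  by move=> i; rewrite ortho -val_eqE eq_sym => /negPf /= ->; rewrite mulr0.
have -> : \sum_(0 <= j < N) (coef f j - k j) ^+ 2 =
    \sum_(0 <= j < N) coef f j ^+ 2 - 2 * (\sum_(0 <= j < N) k j * coef f j)
    + \sum_(0 <= j < N) k j ^+ 2.
  rewrite mulr_sumr -sumrB -big_split/=; apply: eq_bigr => j _; ring.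
by ring.
Qed.

Lemma bessel f N : inL2 L f -> \sum_(0 <= j < N) coef f j ^+ 2 <= inner L f f.
Proof.
move=> Lf; have := inner_sub_comb N (fun j => coef f j) Lf.
rewrite [X in _ + X]big1 ?addr0 => [H|j _]; last by rewrite subrr expr0n.
by rewrite -subr_ge0 -H; exact: inner_ge0.
Qed.

(** Density provides one combination with small error; the Fourier sum of the same length does at
    least as well, and its residual can only decrease as N grows. *)
Lemma parseval_remainder f : inL2 L f ->
  inner L (fun x => f x - \sum_(0 <= j < N) coef f j * e j x)
          (fun x => f x - \sum_(0 <= j < N) coef f j * e j x) @[N --> \oo] --> 0.
Proof.
move=> Lf.
have remE N := inner_sub_comb N (fun j => coef f j) Lf.
have {}remE N : inner L (fun x => f x - \sum_(0 <= j < N) coef f j * e j x)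
          (fun x => f x - \sum_(0 <= j < N) coef f j * e j x) =
   inner L f f - \sum_(0 <= j < N) coef f j ^+ 2.
  by rewrite remE [X in _ + X]big1 ?addr0// => j _; rewrite subrr expr0n.
apply/cvgrPdist_lt => eps eps0.
have [_ _ /(_ f Lf (Num.sqrt eps))] := e_basis.
rewrite sqrtr_gt0 => /(_ eps0)[N [k]].
have Lk := comb_inL2 N k; have Lfk := inL2B Lf Lk.
rewrite L2normE// lte_fin ltr_sqrt// inner_sub_comb// => H.
exists N => // M /= NM; rewrite sub0r normrN ger0_norm ?inner_ge0// remE.
apply: le_lt_trans H.
have : \sum_(0 <= j < N) coef f j ^+ 2 <= \sum_(0 <= j < M) coef f j ^+ 2.
  rewrite [leRHS](@big_cat_nat _ _ _ N)//= lerDl; apply: sumr_ge0 => j _; exact: sqr_ge0.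
have : 0 <= \sum_(0 <= j < N) (coef f j - k j) ^+ 2.
  by apply: sumr_ge0 => j _; exact: sqr_ge0.
lra.
Qed.

Lemma parseval f g : inL2 L f -> inL2 L g ->
  \sum_(0 <= j < N) coef f j * coef g j @[N --> \oo] --> inner L f g.
Proof.
move=> Lf Lg; rewrite -[X in _ --> X]subr0.
pose r N : R -> R := fun x => f x - \sum_(0 <= j < N) coef f j * e j x.
have Lr N : inL2 L (r N) by exact: inL2B Lf (comb_inL2 _ _).
have E N : \sum_(0 <= j < N) coef f j * coef g j = inner L f g - inner L (r N) g.
  by rewrite /r innerBl ?inner_comb//; ring.
under eq_cvg do rewrite E.
apply: cvgB; first exact: cvg_cst.
apply/cvgrPdist_lt => eps eps0; have G0 := inner_ge0 g.
have e0 : 0 < eps ^+ 2 / (inner L g g + 1) by rewrite divr_gt0 ?exprn_gt0// ltr_wpDl.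
have /cvgrPdist_lt/(_ _ e0) := parseval_remainder Lf; apply: filterS => N.
rewrite !sub0r !normrN ger0_norm ?inner_ge0// ltr_pdivlMr ?ltr_wpDl//.
rewrite -/(r N) => H.
rewrite -(@ltr_pXn2r _ 2) ?nnegrE// ?(ltW eps0)// real_normK ?num_real//.
apply: le_lt_trans H; apply: (le_trans (CauchySchwarz (Lr N) Lg)).
by rewrite ler_wpM2l ?inner_ge0// lerDl.
Qed.

Section TailFunctional.
Variables (n : nat) (phi : nat -> R) (Phi : R).
Hypothesis phi_le : forall N, \sum_(0 <= j < N) phi j ^+ 2 <= Phi.

(** For [phi j = deriv_at0 (e j) / lam j] this is the functional subtracted from z in zeta; square
    summability of [phi] is all that its boundedness on L^2 takes. *)
Definition tail_form f : R := \big[+%R/0]_(n <= j <oo) (phi j * coef f j).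

(** Absolute convergence: |phi_j f_j| <= phi_j^2 + f_j^2, and Bessel bounds the sum of the f_j^2. *)
Lemma cvg_tail_form f : inL2 L f ->
  \sum_(n <= j < N) phi j * coef f j @[N --> \oo] --> tail_form f.
Proof.
move=> Lf.
pose u j := if (n <= j)%N then phi j * coef f j else 0.
have E : (fun N => \sum_(n <= j < N) phi j * coef f j) = series u.
  apply/funext => N; rewrite /series /= /u -big_mkcond/= big_geq_mkord.
  by rewrite big_mkord.
rewrite /tail_form E; apply: normed_cvg.
apply: nondecreasing_is_cvgn.
  by apply/nondecreasing_seqP => N /=; rewrite /series [leRHS]big_nat_recr//= lerDl.
exists (Phi + inner L f f) => _ [N _ <-] /=.
apply: (@le_trans _ _ (\sum_(0 <= j < N) (phi j ^+ 2 + coef f j ^+ 2))).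
  apply: ler_sum => j _; rewrite /u; case: ifP => _.
    rewrite ler_norml; have := sqr_ge0 (phi j - coef f j).
    have := sqr_ge0 (phi j + coef f j); have := sqr_ge0 (phi j).
    have := sqr_ge0 (coef f j) => a b c d; apply/andP; split; lra.
  by rewrite normr0 addr_ge0// sqr_ge0.
by rewrite big_split/= lerD// bessel.
Qed.

Lemma tail_formD f g : inL2 L f -> inL2 L g ->
  tail_form (fun x => f x + g x) = tail_form f + tail_form g.
Proof.
move=> Lf Lg; rewrite {1}/tail_form.
have -> : (fun N => \sum_(n <= j < N) phi j * coef (fun x => f x + g x) j) =
  (fun N => \sum_(n <= j < N) phi j * coef f j) \+
  (fun N => \sum_(n <= j < N) phi j * coef g j).
  apply/funext => N; rewrite /= -big_split/=; apply: eq_bigr => j _.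
  by rewrite innerDl// mulrDr.
exact/(cvg_lim _ (cvgD (cvg_tail_form Lf) (cvg_tail_form Lg))).
Qed.

Lemma tail_formZ a f : inL2 L f ->
  tail_form (fun x => a * f x) = a * tail_form f.
Proof.
move=> Lf; rewrite {1}/tail_form.
have -> : (fun N => \sum_(n <= j < N) phi j * coef (fun x => a * f x) j) =
  (fun N => cst a N * \sum_(n <= j < N) phi j * coef f j).
  apply/funext => N; rewrite /= mulr_sumr; apply: eq_bigr => j _.
  by rewrite innerZl// mulrCA.
exact/(cvg_lim _ (cvgM (cvg_cst a) (cvg_tail_form Lf))).
Qed.

Lemma tail_form_bound f : inL2 L f -> tail_form f ^+ 2 <= Phi * inner L f f.
Proof.
move=> Lf; have H := cvg_tail_form Lf.
have {}H : (\sum_(n <= j < N) phi j * coef f j) ^+ 2 @[N --> \oo] --> tail_form f ^+ 2.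
  by rewrite expr2; under eq_cvg do rewrite expr2; exact: cvgM.
apply: cvgr_to_le H _; near=> N.
have -> : \sum_(n <= j < N) phi j * coef f j =
    \sum_(j < N) (if (n <= j)%N then phi j else 0) * coef f j.
  rewrite big_geq_mkord big_mkcond; apply: eq_bigr => j _ /=.
  by case: ifP; rewrite // mul0r.
apply: le_trans (sqr_sum_le _ _) _; apply: ler_pM.
- by apply: sumr_ge0 => j _; exact: sqr_ge0.
- by apply: sumr_ge0 => j _; exact: sqr_ge0.
- apply: le_trans (phi_le N); rewrite big_mkord; apply: ler_sum => j _.
  by case: ifP; rewrite // expr0n sqr_ge0.
- by have := bessel N Lf; rewrite big_mkord.
Unshelve. all: by end_near. Qed.

End TailFunctional.

End Basis.

End L2.

(** * Bounded linear functionals on L^2(0,L) *)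

Section BoundedForms.
Context {R : realType} (L : R).
Implicit Types (f g h : R -> R) (F : R -> R -> R) (Lam : (R -> R) -> R).

(** Common interface of the mode coefficients and of the tail functional: the heat equation, which
    holds in L^2 only, is tested against both kinds by the same lemmas. *)
Definition bounded_form Lam :=
  [/\ forall f g, inL2 L f -> inL2 L g ->
        Lam (fun x => f x + g x) = Lam f + Lam g,
      forall a f, inL2 L f -> Lam (fun x => a * f x) = a * Lam f &
      exists C, forall f, inL2 L f -> Lam f ^+ 2 <= C * inner L f f].

Lemma bounded_form_inner h : inL2 L h -> bounded_form (fun f => inner L f h).
Proof.
move=> Lh; split=> [f g Lf Lg|a f Lf|].
- exact: innerDl.
- exact: innerZl.
- by exists (inner L h h) => f Lf; rewrite mulrC; exact: CauchySchwarz.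
Qed.

Lemma bounded_form_tail e n phi Phi : hilbert_basis L e ->
  (forall N, \sum_(0 <= j < N) phi j ^+ 2 <= Phi) ->
  bounded_form (tail_form L e n phi).
Proof.
move=> eb phi_le; split=> [f g Lf Lg|a f Lf|].
- exact: (tail_formD eb n phi_le).
- exact: (tail_formZ eb n phi_le).
- by exists Phi => f Lf; exact: tail_form_bound.
Qed.

Lemma L2norm_cvg0_inner (T : Type) (G : set_system T) {GF : Filter G} (f : T -> R -> R) :
  (\forall s \near G, inL2 L (f s)) ->
  L2norm L (f s) @[s --> G] --> 0%E -> inner L (f s) (f s) @[s --> G] --> 0.
Proof.
move=> Lf /fine_cvgP[_ f0]; have := cvgM f0 f0; rewrite mulr0 => /(_ GF).
apply: near_cvg_eq; apply: filterS Lf => s Lfs /=.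
by rewrite L2normE//= -expr2 sqr_sqrtr// inner_ge0.
Qed.

Lemma L2norm_cvg0_form (T : Type) (G : set_system T) {GF : Filter G}
    (f : T -> R -> R) Lam : bounded_form Lam ->
  (\forall s \near G, inL2 L (f s)) ->
  L2norm L (f s) @[s --> G] --> 0%E -> Lam (f s) @[s --> G] --> 0.
Proof.
move=> [_ _ [C HC]] Lf fL2.
have f0 : inner L (f s) (f s) @[s --> G] --> 0 by exact: (L2norm_cvg0_inner Lf fL2).
apply/cvgrPdist_lt => eps eps0.
have C0 : 0 < `|C| + 1 by rewrite ltr_wpDl.
have e0 : 0 < eps ^+ 2 / (`|C| + 1) by rewrite divr_gt0// exprn_gt0.
have /cvgrPdist_lt/(_ _ e0) H := f0; apply: filterS2 Lf H => s Lfs.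
rewrite !sub0r !normrN ger0_norm ?inner_ge0// ltr_pdivlMr// => H.
rewrite -(@ltr_pXn2r _ 2) ?nnegrE// ?(ltW eps0)// real_normK ?num_real//.
apply: le_lt_trans H; apply: (le_trans (HC _ Lfs)).
rewrite mulrC ler_wpM2l ?inner_ge0//.
by rewrite (le_trans (ler_norm _))// lerDl.
Qed.

Lemma form_continuous F Lam : bounded_form Lam ->
  (forall t, 0 <= t -> inL2 L (F t)) -> L2_continuous L F ->
  {within Rplus, continuous (fun t => Lam (F t))}.
Proof.
move=> BL LF cF; apply/subspace_continuousP => t t0.
have [LD LZ _] := BL.
apply/subr_cvg0.
have FF : \forall s \near within Rplus (nbhs t), inL2 L (F s \- F t).
  by rewrite near_withinE; near=> s => s0; apply: inL2B; exact: LF.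
refine (near_cvg_eq _ (L2norm_cvg0_form BL FF (cF t t0))); rewrite near_withinE; near=> s => s0.
have LFs : inL2 L (F s) by exact: LF.
have LFt : inL2 L (F t) by exact: LF.
have := LZ (-1) _ LFt; rewrite mulN1r => <-; rewrite -LD//; last exact: inL2Z.
by congr Lam; apply/funext => x; rewrite mulN1r.
Unshelve. all: by end_near. Qed.

Lemma form_derive F g t Lam : bounded_form Lam -> 0 < t ->
  (forall t, 0 <= t -> inL2 L (F t)) -> inL2 L g ->
  L2_is_derive L F t g -> is_derive t 1 (fun t => Lam (F t)) (Lam g).
Proof.
move=> BL t0 LF Lg dF; have [LD LZ _] := BL.
have LFt : inL2 L (F t) by exact/LF/ltW.
have FF : \forall s \near within Rplus t^',
    inL2 L (fun x => (F s x - F t x) / (s - t) - g x).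
  rewrite near_withinE; near=> s => s0; apply: inL2B => //.
  under eq_fun do rewrite mulrC; apply: inL2Z; apply: inL2B => //; exact: LF.
have H : Lam (fun x => (F s x - F t x) / (s - t) - g x)
    @[s --> within Rplus t^'] --> 0 by exact: (L2norm_cvg0_form BL FF dF).
have Lq s : 0 <= s -> Lam (fun x => (F s x - F t x) / (s - t) - g x) =
    (Lam (F s) - Lam (F t)) / (s - t) - Lam g.
  move=> s0; have LFs : inL2 L (F s) by exact: LF.
  rewrite -[- Lam g]mulN1r -LZ// mulrC -[- Lam (F t)]mulN1r -LZ//.
  rewrite -LD//; last exact: inL2Z.
  rewrite -LZ; last by apply: inL2D => //; exact: inL2Z.
  rewrite -LD; last exact: inL2Z.
    by congr Lam; apply/funext => x; rewrite !mulN1r mulrC.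
  by apply: inL2Z; apply: inL2D => //; exact: inL2Z.
suff dq : h^-1 *: ((fun s => Lam (F s)) (h *: (1 : R) + t) - Lam (F t))
    @[h --> 0^'] --> Lam g.
  by apply: DeriveDef; [apply/cvg_ex; exists (Lam g)|apply: cvg_lim].
apply/cvgrPdist_lt => eps eps0.
have /cvgrPdist_lt/(_ _ eps0) := H.
rewrite near_withinE /dnbhs near_withinE.
move=> /nbhs_ballP[d /= d0 Hd].
(* The radius is at most t, so that h + t stays in [Rplus], where the one-sided filter of
   [L2_is_derive] gives information. *)
apply/nbhs_ballP; exists (Num.min d t) => /=; first by rewrite lt_min d0.
move=> h; rewrite /ball/= sub0r normrN lt_min => /andP[hd ht] h0.
have hs0 : 0 <= h + t.
  by rewrite -lerBlDr sub0r; move: ht; rewrite ltr_norml => /andP[/ltW].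
have /(_ (h + t)) := Hd.
rewrite /ball/= opprD addrCA subrr addr0 normrN => /(_ hd).
have hne : h + t != t by rewrite -subr_eq0 addrK.
move=> /(_ hne hs0) /=.
rewrite Lq// addrK sub0r normrN distrC.
by rewrite /GRing.scale/= mulr1 [h^-1 * _]mulrC.
Unshelve. all: by end_near. Qed.

End BoundedForms.

(** * Weak derivatives *)

Section Swap.
Context {R : realType}.
Local Notation mu := (@lebesgue_measure R).

(** Fubini on the triangle s < x for the integrand F(x) H(s), which is dominated by the integrable
    product |F(x)| |H(s)|. *)
Lemma Rintegral_triangle_swap (F H : R -> R) :
  mu.-integrable setT (EFin \o F) -> mu.-integrable setT (EFin \o H) ->
  \int[mu]_x (F x * \int[mu]_s (if s < x then H s else 0)) =
  \int[mu]_s (H s * \int[mu]_x (if s < x then F x else 0)).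
Proof.
move=> iF iH.
have mF : measurable_fun setT F by apply/measurable_EFinP; case/integrableP: iF.
have mH : measurable_fun setT H by apply/measurable_EFinP; case/integrableP: iH.
pose G (z : R * R) : \bar R := (if z.2 < z.1 then F z.1 * H z.2 else 0)%:E.
have mG : measurable_fun setT G.
  apply/measurable_EFinP; apply: measurable_fun_ifT.
  - by apply: measurable_fun_ltr; [exact: measurable_snd|exact: measurable_fst].
  - by apply: measurable_funM; apply: measurableT_comp => //.
  - exact: measurable_cst.
have iH' x : mu.-integrable setT (EFin \o (fun s => if s < x then H s else 0)).
  apply: le_integrable iH => //.
    apply/measurable_EFinP; apply: measurable_fun_ifT => //.
    by apply: measurable_fun_ltr.
  by move=> s _ /=; case: ifP => // _; rewrite lee_fin normr0.
have iF' s : mu.-integrable setT (EFin \o (fun x => if s < x then F x else 0)).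
  apply: le_integrable iF => //.
    apply/measurable_EFinP; apply: measurable_fun_ifT => //.
    by apply: measurable_fun_ltr.
  by move=> x _ /=; case: ifP => // _; rewrite lee_fin normr0.
have iG : (mu \x mu)%E.-integrable setT G.
  apply/(integrable12ltyP mu mu mG).
  have [MH MHE] : exists M : R, (\int[mu]_s `|(H s)%:E|)%E = M%:E.
    exists (fine (\int[mu]_s `|(H s)%:E|)%E); rewrite fineK//.
    by case/integrableP: iH => _ H1; rewrite ge0_fin_numE//; exact: integral_ge0.
  apply: (@le_lt_trans _ _ (\int[mu]_x (MH%:E * `|(F x)%:E|))%E).
    apply: ge0_le_integral => //.
    - by move=> x _; exact: integral_ge0.
    - have mabsG : measurable_fun setT (abse \o G) by exact: measurableT_comp.
      by apply: (@measurable_fun_fubini_tonelli_F _ _ _ _ _ mu (abse \o G) mabsG) => z; exact: abse_ge0.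
    - by apply: emeasurable_funM => //; apply: measurableT_comp => //; exact/measurable_EFinP.
    - move=> x _; rewrite -MHE muleC -ge0_integralZl//; last first.
        by apply: measurableT_comp => //; exact/measurable_EFinP.
      apply: ge0_le_integral => //.
      + by apply: measurableT_comp => //; apply: measurableT_comp mG _.
      + by apply: measurable_funeM; apply: measurableT_comp => //; exact/measurable_EFinP.
      + move=> s _; rewrite /G/=; case: ifP => _; last by rewrite normr0 -EFinM lee_fin mulr_ge0.
        by rewrite normrM EFinM.
  rewrite ge0_integralZl//; last 2 first.
  - by apply: measurableT_comp => //; exact/measurable_EFinP.
  - by rewrite -MHE; exact: integral_ge0.
  by case/integrableP: iF => _ iF2; apply: lte_mul_pinfty => //; rewrite -MHE; exact: integral_ge0.
have := Fubini iG.
rewrite /Rintegral => E; congr fine; transitivity (\int[mu]_x \int[mu]_y G (x, y))%E; last first.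
  rewrite E; apply: eq_integral => s _; rewrite EFinM fineK; last exact: (integrable_fin_num measurableT (iF' s)).
  rewrite -integralZl//; last exact: iF'.
  apply: eq_integral => x _; rewrite /G/=.
  by case: ifP => _; rewrite ?mulr0 ?mule0// EFinM muleC.
apply: eq_integral => x _; rewrite EFinM fineK; last exact: (integrable_fin_num measurableT (iH' x)).
rewrite -integralZl//; last exact: iH'.
apply: eq_integral => s _; rewrite /G/=.
by case: ifP => _; rewrite ?mulr0 ?mule0// EFinM.
Qed.

End Swap.

Section Sobolev.
Context {R : realType} (L : R).
Hypothesis L_gt0 : 0 < L.
Local Notation mu := (@lebesgue_measure R).
Local Notation I := (`]0, L[%classic : set R).
Implicit Types (f g h : R -> R).

Let mI : measurable (I : set (measurableTypeR R)). Proof. exact: measurable_itv. Qed.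

Lemma inL2_within_continuous f : {within `[0, L], continuous f} -> inL2 L f.
Proof.
move=> cf; apply/inL2P; split.
  apply: (@measurable_funS _ _ _ _ `[0, L]) => //.
    exact: subset_itv_oo_cc.
  exact: subspace_continuous_measurable_fun.
apply: (@integrableS _ _ _ mu `[0, L]) => //; first exact: subset_itv_oo_cc.
apply: continuous_compact_integrable; first exact: segment_compact.
move=> x; rewrite (_ : (fun x => f x ^+ 2) = f * f); last exact/funext.
exact: (@continuousM _ (subspace `[0, L]) f f x (cf x) (cf x)).
Qed.

Lemma inL2_cst a : inL2 L (fun _ => a).
Proof. by apply: inL2_within_continuous; move=> x; exact: cvg_cst. Qed.

Lemma inL2_integrable f : inL2 L f -> mu.-integrable I (EFin \o f).
Proof.
move=> Lf; have := integrable_inL2M Lf (inL2_cst 1).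
by apply: eq_integrable => // x _; rewrite /= mulr1.
Qed.

Lemma integrable_restrict_inL2 f : inL2 L f ->
  mu.-integrable setT (EFin \o (f \_ I)).
Proof.
move=> /inL2_integrable/(@integrable_mkcond _ _ _ mu I _ mI).
by rewrite restrict_EFin.
Qed.

Lemma Rintegral_lt_restrict g x : inL2 L g -> 0 <= x <= L ->
  \int[mu]_(s in `[0, x]) g s = \int[mu]_s (if s < x then (g \_ I) s else 0).
Proof.
move=> /inL2_integrable ig /andP[x0 xL].
have ig' : mu.-integrable `]0, x[ (EFin \o g).
  apply: integrableS ig => //; apply: subset_itvl; by rewrite bnd_simp.
have mg : measurable_fun `]0, x[ (EFin \o g) by case/integrableP: ig'.
have -> : \int[mu]_(s in `[0, x]) g s = \int[mu]_(s in `]0, x[) g s.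
  rewrite /Rintegral integral_itv_obnd_cbnd// integral_itv_bndo_bndc//.
  exact/emeasurable_fun_itv_obnd_cbndP.
rewrite Rintegral_mkcond; apply: eq_Rintegral => s _.
rewrite !patchE !mem_setE !in_itv/=.
case: ifPn => [/andP[s0 sx]|].
  by rewrite sx s0 (lt_le_trans sx xL).
rewrite negb_and -!leNgt => /orP[s0|xs].
  by rewrite !ltNge s0/=; case: ifP.
by rewrite ltNge xs.
Qed.

(** The variant with a large inequality serves the complement x <= s of the triangle s < x in the
    integration by parts. *)
Lemma Rintegral_le_restrict g x : inL2 L g -> 0 <= x < L ->
  \int[mu]_(s in `[0, x]) g s = \int[mu]_s (if s <= x then (g \_ I) s else 0).
Proof.
move=> /inL2_integrable ig /andP[x0 xL].
have ig' : mu.-integrable `]0, x] (EFin \o g).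
  by apply: integrableS ig => //; apply: subset_itvl; rewrite bnd_simp.
have mg : measurable_fun `]0, x] (EFin \o g) by case/integrableP: ig'.
have -> : \int[mu]_(s in `[0, x]) g s = \int[mu]_(s in `]0, x]) g s.
  by rewrite /Rintegral integral_itv_obnd_cbnd.
rewrite Rintegral_mkcond; apply: eq_Rintegral => s _.
rewrite !patchE !mem_setE !in_itv/=.
case: ifPn => [/andP[s0 sx]|].
  by rewrite sx s0 (le_lt_trans sx xL).
rewrite negb_and -!ltNge -leNgt => /orP[s0|xs].
  by rewrite !ltNge s0/=; case: ifP.
by rewrite leNgt xs.
Qed.

Lemma restrictK g : (g \_ I) \_ I = g \_ I.
Proof. by apply/funext => x; rewrite !patchE; case: ifP => // ->. Qed.

Lemma inL2_restrict g : inL2 L g -> inL2 L (g \_ I).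
Proof. by rewrite /inL2 restrictK. Qed.

Lemma wderiv_continuous f g : wderiv L f g -> {within `[0, L], continuous f}.
Proof.
move=> [Lg fE]; have Lg' := inL2_restrict Lg.
have ig : mu.-integrable `[0, L] (EFin \o (g \_ I)).
  exact: integrableS (integrable_restrict_inL2 Lg).
pose F x := f 0 + parameterized_integral mu 0 x (g \_ I).
apply: (@subspace_eq_continuous _ _ _ F).
  move=> x /set_mem/=; rewrite in_itv/= => x0L.
  rewrite /from_subspace /F [RHS]fE// /parameterized_integral.
  by rewrite (Rintegral_lt_restrict Lg x0L) (Rintegral_lt_restrict Lg' x0L) restrictK.
move=> x; apply: cvgD; first exact: cvg_cst.
exact: parameterized_integral_continuous (ltW L_gt0) ig x.
Qed.

Lemma wderiv_inL2 f g : wderiv L f g -> inL2 L f.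
Proof. by move/wderiv_continuous/inL2_within_continuous. Qed.

Lemma wderiv_sum f g : wderiv L f g ->
  forall x, 0 <= x <= L -> f x = f 0 + \int[mu]_s (if s < x then (g \_ I) s else 0).
Proof. by move=> [Lg fE] x xL; rewrite fE// Rintegral_lt_restrict. Qed.

Lemma wderiv_total f g : wderiv L f g -> \int[mu]_s (g \_ I) s = f L - f 0.
Proof.
move=> fg; rewrite (wderiv_sum fg) ?lexx ?ltW// [RHS]addrC addKr.
apply: eq_Rintegral => s _; case: ifPn => // /negP Ls; rewrite patchE.
by case: ifP => // /set_mem/=; rewrite in_itv/= => /andP[].
Qed.

(* Both primitives are written as integrals over triangles, which Fubini's    *)
(* theorem identifies.                                                        *)
Lemma integration_by_parts_wderiv f f1 h h1 : wderiv L f f1 -> wderiv L h h1 ->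
  inner L f1 h = f L * h L - f 0 * h 0 - inner L f h1.
Proof.
move=> ff hh; have [Lf1 fE] := ff; have [Lh1 _] := hh.
have Lf := wderiv_inL2 ff; have Lh := wderiv_inL2 hh.
have patchM (p q : R -> R) : ((fun x => p x * q x) \_ I) = fun x => (p \_ I) x * q x.
  by apply/funext => x; rewrite !patchE; case: ifP; rewrite ?mul0r.
have restrictM (p q : R -> R) : inL2 L p -> inL2 L q ->
    mu.-integrable setT (EFin \o (fun x => (p \_ I) x * q x)).
  move=> Lp Lq; rewrite -patchM; have := integrable_inL2M Lp Lq.
  by move/(@integrable_mkcond _ _ _ mu I _ mI); rewrite restrict_EFin.
have ifh := restrictM _ _ Lf1 Lh; have ihf := restrictM _ _ Lh1 Lf.
have iF := integrable_restrict_inL2 Lf1; have iH := integrable_restrict_inL2 Lh1.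
have F_out x : x \notin `]0, L[ -> (f1 \_ I) x = 0.
  by move=> xI; rewrite patchE mem_setE (negbTE xI).
have H_out x : x \notin `]0, L[ -> (h1 \_ I) x = 0.
  by move=> xI; rewrite patchE mem_setE (negbTE xI).
have innerE1 : inner L f1 h = \int[mu]_x ((f1 \_ I) x * h x).
  by rewrite /inner Rintegral_mkcond patchM.
have innerE2 : inner L f h1 = \int[mu]_x ((h1 \_ I) x * f x).
  by rewrite innerC /inner Rintegral_mkcond patchM.
rewrite innerE1 innerE2 {innerE1 innerE2 restrictM patchM}.
have fE' s : 0 <= s < L -> f s = f 0 + \int[mu]_x (if x <= s then (f1 \_ I) x else 0).
  by move=> sL; rewrite fE ?Rintegral_le_restrict//; case/andP: sL => -> /ltW.
have hE := wderiv_sum hh; have Fint := wderiv_total ff; have Hint := wderiv_total hh.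
move: (f1 \_ I) (h1 \_ I) ifh ihf iF iH F_out H_out fE' hE Fint Hint.
move=> F H ifh ihf iF iH F_out H_out fE' hE Fint Hint.
have swap := Rintegral_triangle_swap iF iH.
have inI s : s \in `]0, L[ -> (0 <= s <= L) /\ (0 <= s < L).
  by rewrite in_itv/= => /andP[/ltW -> sL]; rewrite sL (ltW sL).
have E1 : \int[mu]_x (F x * \int[mu]_s (if s < x then H s else 0)) =
    \int[mu]_x (F x * h x) - h 0 * \int[mu]_x F x.
  have iZ : mu.-integrable setT (EFin \o (fun x => h 0 * F x)) by exact: integrableZl iF.
  rewrite -(RintegralZl _ measurableT iF) -(RintegralB measurableT ifh iZ).
  apply: eq_Rintegral => x _; have [/inI[xI _]|xI] := boolP (x \in `]0, L[).
    by rewrite (hE _ xI); ring.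
  by rewrite (F_out _ xI) !mul0r mulr0 subrr.
have E2 : \int[mu]_s (H s * \int[mu]_x (if s < x then F x else 0)) =
    f L * \int[mu]_s H s - \int[mu]_s (H s * f s).
  have iZ : mu.-integrable setT (EFin \o (fun x => f L * H x)) by exact: integrableZl iH.
  rewrite -(RintegralZl _ measurableT iH) -(RintegralB measurableT iZ ihf).
  apply: eq_Rintegral => s _; have [/inI[_ sI]|sI] := boolP (s \in `]0, L[); last first.
    by rewrite (H_out _ sI) !mul0r mulr0 subrr.
  suff -> : \int[mu]_x (if s < x then F x else 0) = f L - f s by ring.
  have iFs : mu.-integrable setT (EFin \o (fun x => if x <= s then F x else 0)).
    apply: (le_integrable measurableT _ _ iF); last first.
      by move=> x _ /=; case: ifP => // _; rewrite lee_fin normr0.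
    apply/measurable_EFinP; apply: measurable_fun_ifT => //.
      exact: measurable_fun_ler.
    by apply/measurable_EFinP; case/integrableP: iF.
  rewrite (fE' _ sI) opprD addrA -Fint -(RintegralB measurableT iF iFs).
  by apply: eq_Rintegral => x _; case: ltP => sx; rewrite ?subr0 ?subrr.
move: E1; rewrite swap E2 Fint Hint => /esym/(canRL (subrK _)) ->; ring.
Qed.

End Sobolev.

Section Sobolev2.
Context {R : realType} (L : R).
Hypothesis L_gt0 : 0 < L.
Local Notation mu := (@lebesgue_measure R).
Local Notation I := (`]0, L[%classic : set R).
Implicit Types (f g h : R -> R).

Let mI : measurable (I : set (measurableTypeR R)). Proof. exact: measurable_itv. Qed.

Lemma wderivD f f1 g g1 : wderiv L f f1 -> wderiv L g g1 ->
  wderiv L (fun x => f x + g x) (fun x => f1 x + g1 x).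
Proof.
move=> ff gg; have [Lf1 _] := ff; have [Lg1 _] := gg.
have Lfg := inL2D Lf1 Lg1; split=> // x xL.
rewrite (wderiv_sum ff xL) (wderiv_sum gg xL) (Rintegral_lt_restrict Lfg xL).
have iif p : inL2 L p -> mu.-integrable setT (EFin \o (fun s => if s < x then (p \_ I) s else 0)).
  move=> Lp; have ip := integrable_restrict_inL2 Lp.
  apply: (le_integrable measurableT _ _ ip); last first.
    by move=> s _ /=; case: ifP => // _; rewrite lee_fin normr0.
  apply/measurable_EFinP; apply: measurable_fun_ifT => //.
    exact: measurable_fun_ltr.
  by apply/measurable_EFinP; case/integrableP: ip.
rewrite addrACA -(RintegralD measurableT (iif _ Lf1) (iif _ Lg1)).
congr (_ + _); apply: eq_Rintegral => s _; rewrite !patchE.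
by case: ifP => _; rewrite ?addr0//; case: ifP => _; rewrite ?addr0.
Qed.

Lemma wderivZ a f f1 : wderiv L f f1 ->
  wderiv L (fun x => a * f x) (fun x => a * f1 x).
Proof.
move=> ff; have [Lf1 _] := ff; split=> [|x xL]; first exact: inL2Z.
rewrite (wderiv_sum ff xL) (Rintegral_lt_restrict (inL2Z a Lf1) xL) mulrDr.
congr (_ + _).
have ip := integrable_restrict_inL2 Lf1.
have ip' : mu.-integrable setT (EFin \o (fun s => if s < x then (f1 \_ I) s else 0)).
  apply: (le_integrable measurableT _ _ ip); last first.
    by move=> s _ /=; case: ifP => // _; rewrite lee_fin normr0.
  apply/measurable_EFinP; apply: measurable_fun_ifT => //.
    exact: measurable_fun_ltr.
  by apply/measurable_EFinP; case/integrableP: ip.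
rewrite -(RintegralZl _ measurableT ip'); apply: eq_Rintegral => s _.
by rewrite !patchE; case: ifP => _; rewrite ?mulr0//; case: ifP => _; rewrite ?mulr0.
Qed.

Lemma wderivB f f1 g g1 : wderiv L f f1 -> wderiv L g g1 ->
  wderiv L (fun x => f x - g x) (fun x => f1 x - g1 x).
Proof.
move=> ff /(wderivZ (-1)) gg; have := wderivD ff gg.
by congr wderiv; apply/funext => x; rewrite mulN1r.
Qed.

Lemma wderiv_cst a : wderiv L (fun _ => a) (fun _ => 0).
Proof.
split=> [|x _]; first exact: inL2_cst.
by rewrite Rintegral_cst ?mul0r ?addr0//.
Qed.

Lemma wderiv_affine a b : wderiv L (fun x => a + b * x) (fun _ => b).
Proof.
split=> [|x /andP[x0 _]]; first exact: inL2_cst.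
rewrite mulr0 addr0 Rintegral_cst//= lebesgue_measure_itv/= lte_fin.
congr (_ + _ * _); case: ltP => [_|x_le0] /=; first by rewrite oppr0 addr0.
by apply/eqP; rewrite eq_le x0 x_le0.
Qed.

Lemma wderiv_is_derive f f1 x : wderiv L f f1 ->
  {within `[0, L], continuous f1} -> 0 < x < L -> is_derive x 1 f (f1 x).
Proof.
move=> [_ fE] cf1 /andP[x0 xL].
have if1 : mu.-integrable `[0, L] (EFin \o f1).
  exact: continuous_compact_integrable (@segment_compact _ _ _) _.
have [cx _ _] := (continuous_within_itvP _ L_gt0).1 cf1.
have xI : x \in `]0, L[ by rewrite in_itv/= x0.
have [dF F'] := continuous_FTC1_closed xL if1 x0 (cx _ xI).
have dd : is_derive x 1 (fun t => \int[mu]_(s in `[0, t]) f1 s) (f1 x).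
  by apply: DeriveDef dF _; rewrite -derive1E.
have := is_deriveD (is_derive_cst (f 0) x (1 : R)) dd; rewrite add0r.
apply: near_eq_is_derive.
have : \forall t \near x, t \in `]0, L[ by exact: near_in_itvoo.
apply: filterS => t; rewrite in_itv/= => /andP[t0 tL].
by rewrite [RHS]fE ?(ltW t0) ?(ltW tL).
Qed.

(** By the mean value theorem the difference quotient at 0 is a value of [f1] at a point between 0
    and h. *)
Lemma deriv_at0_wderiv f f1 : wderiv L f f1 ->
  {within `[0, L], continuous f1} -> deriv_at0 f = f1 0.
Proof.
move=> ff cf1; have cf := wderiv_continuous L_gt0 ff.
have [_ cf10 _] := (continuous_within_itvP _ L_gt0).1 cf1.
suff : ((f h - f 0) / h @[h --> 0^'+]) --> f1 0 by exact: cvg_lim.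
apply/cvgrPdist_lt => eps eps0.
have /cvgrPdist_lt/(_ _ eps0)/nbhs_ballP[d /= d0 Hd] := cf10.
apply/nbhs_ballP; exists (Num.min d L) => /=; first by rewrite lt_min d0.
move=> h; rewrite /ball/= sub0r normrN lt_min => /andP[+ +] h0.
rewrite gtr0_norm// => hd hL.
have [x||k kh ->] := @MVT _ f f1 0 h h0.
- rewrite in_itv/= => /andP[x0 xh]; apply: wderiv_is_derive => //.
  by rewrite x0 (lt_trans xh).
- apply: continuous_subspaceW cf; apply: subset_itvl.
  by rewrite bnd_simp ltW.
rewrite subr0 mulfK ?gt_eqF//; apply: Hd => //=.
  move: kh; rewrite in_itv/= /ball/= sub0r normrN => /andP[k0 kh].
  by rewrite gtr0_norm// (lt_trans kh).
by move: kh; rewrite in_itv/= => /andP[].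
Qed.

End Sobolev2.

(** * The Dirichlet operator *)

Section Dirichlet.
Context {R : realType} (L : R).
Hypothesis L_gt0 : 0 < L.
Local Notation mu := (@lebesgue_measure R).
Local Notation I := (`]0, L[%classic : set R).
Implicit Types (f g h : R -> R).

Let mI : measurable (I : set (measurableTypeR R)). Proof. exact: measurable_itv. Qed.

Lemma eq_L2norm f g : {in `]0, L[, f =1 g} -> L2norm L f = L2norm L g.
Proof.
move=> fg; rewrite /L2norm; congr Lnorm; apply/funext => x /=.
by rewrite !patchE; case: ifP => // /set_mem/fg ->.
Qed.

(** The norm is defined with the classical derivative; it agrees with [f1] on the open interval
    because [f1], having a weak derivative, is continuous. *)
Lemma H10normE f f1 f2 : wderiv L f f1 -> wderiv L f1 f2 ->
  H10norm L f = (Num.sqrt (inner L f1 f1))%:E.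
Proof.
move=> ff f12; rewrite -L2normE; last by case: ff.
apply: eq_L2norm => x; rewrite in_itv/= => x0L; rewrite derive1E.
by have [_ ->] := wderiv_is_derive L_gt0 ff (wderiv_continuous L_gt0 f12) x0L.
Qed.

Lemma green_formula f f1 f2 h h1 h2 :
  wderiv L f f1 -> wderiv L f1 f2 -> f 0 = 0 -> f L = 0 ->
  wderiv L h h1 -> wderiv L h1 h2 -> h 0 = 0 -> h L = 0 ->
  inner L f2 h = inner L f h2.
Proof.
move=> ff f12 f0 fL hh h12 h0 hL.
rewrite (integration_by_parts_wderiv L_gt0 f12 hh) h0 hL !mulr0 subr0 sub0r.
rewrite [RHS]innerC (integration_by_parts_wderiv L_gt0 h12 ff) f0 fL.
by rewrite !mulr0 subr0 sub0r innerC.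
Qed.

Lemma dirichlet_form f f1 f2 :
  wderiv L f f1 -> wderiv L f1 f2 -> f 0 = 0 -> f L = 0 ->
  inner L f2 f = - inner L f1 f1.
Proof.
move=> ff f12 f0 fL.
by rewrite (integration_by_parts_wderiv L_gt0 f12 ff) f0 fL !mulr0 subr0 sub0r.
Qed.

(* Green's formula against this function turns f'(0) into an L^2 functional   *)
(* of f''.                                                                    *)
Definition hat x := 1 - x / L.

Lemma wderiv_hat : wderiv L hat (fun _ => - L^-1).
Proof.
have := wderiv_affine L 1 (- L^-1); congr wderiv.
by apply/funext => x; rewrite /hat mulNr mulrC.
Qed.

Lemma deriv_at0_hat f f1 f2 :
  wderiv L f f1 -> wderiv L f1 f2 -> f 0 = 0 -> f L = 0 ->
  deriv_at0 f = - inner L f2 hat.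
Proof.
move=> ff f12 f0 fL.
rewrite (integration_by_parts_wderiv L_gt0 f12 wderiv_hat).
rewrite (deriv_at0_wderiv L_gt0 ff (wderiv_continuous L_gt0 f12)).
have := integration_by_parts_wderiv L_gt0 ff (wderiv_cst L (- L^-1)).
rewrite f0 fL !mul0r [inner L f (fun _ => 0)]innerC inner0l !subr0 => ->.
have -> : hat L = 0 by rewrite /hat divff ?gt_eqF// subrr.
have -> : hat 0 = 1 by rewrite /hat mul0r subr0.
by rewrite mulr0 mulr1 sub0r subr0 opprK.
Qed.

(** Since f(0) = 0, f(x) is the inner product of f' with the indicator of s < x, whose squared norm
    is at most L. *)
Lemma sqr_le_dirichlet f f1 x : wderiv L f f1 -> f 0 = 0 -> 0 <= x <= L ->
  f x ^+ 2 <= L * inner L f1 f1.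
Proof.
move=> ff f0 xL; have [Lf1 _] := ff.
pose k s : R := if s < x then 1 else 0.
have k2 s : k s ^+ 2 = k s by rewrite /k; case: ifP; rewrite ?expr1n ?expr0n.
have mk : measurable_fun I k.
  by apply: measurable_funTS; apply: measurable_fun_ifT => //; exact: measurable_fun_ltr.
have Lk : inL2 L k.
  apply/inL2P; split => //; rewrite (_ : (fun x => k x ^+ 2) = k); last exact/funext.
  apply: (le_integrable mI _ _ (inL2_integrable (inL2_cst L 1))).
    exact/measurable_EFinP.
  by move=> s _ /=; rewrite lee_fin /k; case: ifP; rewrite ?normr1 ?normr0.
have -> : f x = inner L f1 k.
  rewrite (wderiv_sum ff xL) f0 add0r /inner [RHS]Rintegral_mkcond.
  apply: eq_Rintegral => s _; rewrite /k !patchE.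
  by case: ifP; case: ifP; rewrite ?mulr0 ?mulr1.
apply: (le_trans (CauchySchwarz Lf1 Lk)); rewrite mulrC ler_wpM2r ?inner_ge0//.
apply: (@le_trans _ _ (inner L (fun _ => 1) (fun _ => 1))).
  apply: le_Rintegral => //.
  - exact: integrable_inL2M.
  - by apply: integrable_inL2M; exact: inL2_cst.
  - by move=> s _; rewrite -expr2 k2 mulr1 /k; case: ifP.
rewrite /inner; under eq_Rintegral do rewrite mulr1.
by rewrite Rintegral_cst//= lebesgue_measure_itv/= lte_fin L_gt0 /= subr0 mul1r.
Qed.

Lemma poincare f f1 : wderiv L f f1 -> f 0 = 0 ->
  inner L f f <= L ^+ 2 * inner L f1 f1.
Proof.
move=> ff f0; have Lf := wderiv_inL2 L_gt0 ff.
apply: (@le_trans _ _ (\int[mu]_(x in I) (L * inner L f1 f1))).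
  apply: le_Rintegral => //.
  - exact: integrable_inL2M.
  - exact: (inL2_integrable (inL2_cst L _)).
  - move=> x; rewrite /= in_itv/= => /andP[x0 xL]; rewrite -expr2.
    by apply: sqr_le_dirichlet => //; rewrite !ltW.
rewrite Rintegral_cst//= lebesgue_measure_itv/= lte_fin L_gt0 /= subr0.
by rewrite mulrAC -expr2.
Qed.

Section Multiplication.
Variable c : R -> R.
Hypothesis c_Linfty : inLinfty L c.

Lemma inLinfty_bound : exists M : R,
  [/\ 0 <= M, measurable_fun I c & {ae mu, forall x, x \in `]0, L[ -> `|c x| <= M}].
Proof.
have /andP[] := c_Linfty; rewrite !inE/= => mc; rewrite /finite_norm unlock.
(* The norm of exponent +oo unfolds to the essential supremum only when the whole space has positive
   measure. *)
have -> : (0 < mu [set: measurableTypeR R])%E.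
  apply: (@lt_le_trans _ _ (mu `[0, 1])); last by apply: le_measure; rewrite ?inE.
  by rewrite lebesgue_measure_itv/= lte_fin ltr01 oppr0 adde0 lte_fin.
move=> /ess_supr_bounded[M HM]; exists `|M|; split=> //.
  exact: (measurable_restrictT _ mI).2.
apply: (@filterS _ _ (ae_filter_ringOfSetsType mu)) HM => x xM xI.
apply: le_trans (ler_norm M); move: xM.
by rewrite /= patchE mem_setE xI.
Qed.

(** Truncating c at its essential bound changes it only on a null set and makes it bounded
    everywhere, so that domination can be checked pointwise. *)
Definition clip (M x : R) := Num.max (- M) (Num.min x M).

Lemma inL2_bounded_mul : exists2 M : R, 0 <= M &
  forall f, inL2 L f -> inL2 L (fun x => c x * f x) /\
    inner L (fun x => c x * f x) f <= M * inner L f f /\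
    - (M * inner L f f) <= inner L (fun x => c x * f x) f.
Proof.
have [M [M0 mc cM]] := inLinfty_bound; exists M => // f Lf.
pose k x := clip M (c x).
have mk : measurable_fun I k.
  by apply: measurable_maxr => //; exact: measurable_minr.
have kM x : `|k x| <= M.
  rewrite ler_norml /k /clip le_max lexx/= ge_max ge_min lexx orbT andbT.
  by rewrite (le_trans _ M0)// oppr_le0.
have mf := inL2_measurable Lf; have [_ if2] := (inL2P L f).1 Lf.
have Lkf : inL2 L (fun x => k x * f x).
  apply/inL2P; split; first exact: measurable_funM.
  apply: (le_integrable mI _ _ (integrableZl mI (M ^+ 2) if2)).
    by apply/measurable_EFinP; apply: measurable_funX; exact: measurable_funM.
  move=> x _; rewrite /= lee_fin -exprMn !normrX ler_pXn2r ?nnegrE//.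
  by rewrite !normrM (ger0_norm M0) ler_wpM2r.
have ckE : {ae mu, forall x, x \in `]0, L[ -> k x = c x}.
  apply: (@filterS _ _ (ae_filter_ringOfSetsType mu)) cM => x xM xI.
  have := xM xI; rewrite ler_norml => /andP[h1 h2].
  by rewrite /k /clip min_l// max_r.
have mcf : measurable_fun I (fun x => c x * f x) by exact: measurable_funM.
have Lcf : inL2 L (fun x => c x * f x).
  apply/inL2P; split => //; apply/integrableP; split.
    by apply/measurable_EFinP; exact: measurable_funX.
  have [_ /integrableP[_]] := (inL2P L _).1 Lkf; apply: le_lt_trans.
  rewrite (_ : \int[mu]_(x in I) `|((c x * f x) ^+ 2)%:E| =
    \int[mu]_(x in I) `|((k x * f x) ^+ 2)%:E|)%E//.
  apply: ae_eq_integral => //.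
  - by apply: measurableT_comp => //; apply/measurable_EFinP; exact: measurable_funX.
  - apply: measurableT_comp => //; apply/measurable_EFinP; apply: measurable_funX.
    exact: measurable_funM.
  - by apply: (@filterS _ _ (ae_filter_ringOfSetsType mu)) ckE => x xk xI; rewrite /= xk.
have innerE : inner L (fun x => c x * f x) f = inner L (fun x => k x * f x) f.
  apply: ae_eq_inner => //.
  by apply: (@filterS _ _ (ae_filter_ringOfSetsType mu)) ckE => x xk xI; rewrite xk.
split=> //; rewrite innerE.
have iM : mu.-integrable I (EFin \o (fun x => M * (f x * f x))).
  exact: integrableZl (integrable_inL2M Lf Lf).
have key x : `|k x * f x * f x| <= M * (f x * f x).
  by rewrite -mulrA normrM [`|f x * f x|]ger0_norm -?expr2 ?sqr_ge0// ler_wpM2r ?sqr_ge0.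
rewrite /inner -(RintegralZl _ mI (integrable_inL2M Lf Lf)); split.
  apply: le_Rintegral => //; first exact: integrable_inL2M.
  by move=> x _; exact: le_trans (ler_norm _) (key x).
rewrite -mulN1r -(RintegralZl _ mI iM).
apply: le_Rintegral => //; last 2 first.
- exact: integrable_inL2M.
- by move=> x _; rewrite mulN1r; have := key x; rewrite ler_norml => /andP[].
exact: (integrableZl mI (-1) iM).
Qed.

End Multiplication.
End Dirichlet.

(** * Eigenfunction expansions, the trace f'(0) and the energy *)

Section Spectral.
Context {R : realType} (L : R) (c : R -> R) (e : nat -> R -> R)
  (lam : nat -> R) (n : nat).
Hypotheses (L_gt0 : 0 < L) (c_Linfty : inLinfty L c)
  (e_eigen : forall j, opA L c (e j) (fun x => lam j * e j x))
  (e_basis : hilbert_basis L e)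
  (lam_decr : forall i j, (i < j)%N -> lam j < lam i)
  (lam_ge0 : forall j, (j < n)%N -> 0 <= lam j)
  (lam_lt0 : forall j, (n <= j)%N -> lam j < 0).
Local Notation coef f j := (inner L f (e j)).
Local Notation mu := (@lebesgue_measure R).

(** The derivatives are parameters, so that f'' + c f is an explicit function to which the
    functionals can be applied. *)
Definition dirichlet_data f f1 f2 :=
  [/\ wderiv L f f1, wderiv L f1 f2, f 0 = 0 & f L = 0].

Lemma inDA_data f : inDA L f -> exists f1 f2, dirichlet_data f f1 f2.
Proof. by move=> [[f2 [f1 ff1 f12]] f0 fL]; exists f1, f2. Qed.

Lemma dirichlet_dataB f f1 f2 h h1 h2 :
  dirichlet_data f f1 f2 -> dirichlet_data h h1 h2 ->
  dirichlet_data (fun x => f x - h x) (fun x => f1 x - h1 x) (fun x => f2 x - h2 x).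
Proof.
move=> [ff f12 f0 fL] [hh h12 h0 hL].
by split; [exact: wderivB|exact: wderivB|rewrite f0 h0 subrr|rewrite fL hL subrr].
Qed.

Let Le j : inL2 L (e j). Proof. by case: e_basis. Qed.

Lemma inL2_mulc f : inL2 L f -> inL2 L (fun x => c x * f x).
Proof. by have [M _ cM] := inL2_bounded_mul c_Linfty; case/cM. Qed.

Lemma inner_mulc f h : inner L (fun x => c x * f x) h = inner L f (fun x => c x * h x).
Proof. by apply: eq_Rintegral => x _; ring. Qed.

Lemma dirichlet_data_inL2 f f1 f2 : dirichlet_data f f1 f2 ->
  inL2 L f /\ inL2 L f2.
Proof. by move=> [ff [Lf2 _] _ _]; split=> //; exact: wderiv_inL2 ff. Qed.

Lemma inL2_op f f1 f2 : dirichlet_data f f1 f2 ->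
  inL2 L (fun x => f2 x + c x * f x).
Proof.
by move/dirichlet_data_inL2 => [Lf Lf2]; apply: inL2D => //; exact: inL2_mulc.
Qed.

(** The eigenvalue equation holds almost everywhere only, hence it is recorded in tested form. *)
Lemma eigen_data j : exists e1 e2, dirichlet_data (e j) e1 e2 /\
  forall h, inL2 L h ->
    inner L (fun x => e2 x + c x * e j x) h = lam j * inner L (e j) h.
Proof.
have [[_ ej0 ejL] [e2 [e1 ee e12] Ae]] := e_eigen j.
have dd : dirichlet_data (e j) e1 e2 by split.
exists e1, e2; split=> // h Lh.
rewrite -innerZl//; apply: ae_eq_inner => //.
- exact: inL2_op dd.
- exact: inL2Z.
- apply: (@filterS _ _ (ae_filter_ringOfSetsType mu)) Ae => x Ae xI.
  by rewrite Ae.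
Qed.

(** The operator is symmetric by Green's formula, so it can be moved onto the eigenfunction. *)
Lemma op_coef f f1 f2 j : dirichlet_data f f1 f2 ->
  coef (fun x => f2 x + c x * f x) j = lam j * coef f j.
Proof.
move=> dd; have [e1 [e2 [de He]]] := eigen_data j.
have [Lf Lf2] := dirichlet_data_inL2 dd; have [_ Le2] := dirichlet_data_inL2 de.
rewrite innerDl//; last exact: inL2_mulc.
case: dd de => ff f12 f0 fL [ee e12 e0 eL].
rewrite (green_formula L_gt0 ff f12 f0 fL ee e12 e0 eL) inner_mulc -innerDr//; last exact: inL2_mulc.
by rewrite innerC He// innerC.
Qed.

Let Lhat : inL2 L (hat L).
Proof. exact: (wderiv_inL2 L_gt0 (wderiv_hat L)). Qed.

Lemma deriv_at0_op f f1 f2 : dirichlet_data f f1 f2 ->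
  deriv_at0 f = - inner L (fun x => f2 x + c x * f x) (hat L)
                + inner L f (fun x => c x * hat L x).
Proof.
move=> dd; have [Lf Lf2] := dirichlet_data_inL2 dd.
rewrite innerDl//; last exact: inL2_mulc.
case: dd => ff f12 f0 fL; rewrite (deriv_at0_hat L_gt0 ff f12 f0 fL).
by rewrite (inner_mulc f) opprD subrK.
Qed.

Lemma deriv_at0_eigen j : deriv_at0 (e j) =
  - lam j * coef (hat L) j + coef (fun x => c x * hat L x) j.
Proof.
have [e1 [e2 [de He]]] := eigen_data j.
by rewrite (deriv_at0_op de) He// !(innerC L (e j)) mulNr.
Qed.

Let lam_gap j : (n <= j)%N -> - lam n <= - lam j.
Proof.
rewrite leq_eqVlt => /predU1P[->//|nj]; rewrite lerN2 ltW//; exact: lam_decr.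
Qed.

(* For j >= n, e_j'(0) / lam_j = - <hat, e_j> + <c hat, e_j> / lam_j.         *)
Lemma sqr_sum_phi : exists Phi, forall N,
  \sum_(0 <= j < N) (deriv_at0 (e j) / lam j) ^+ 2 <= Phi.
Proof.
pose phi j := deriv_at0 (e j) / lam j.
pose mun := (- lam n)^-1.
have mu0 : 0 < - lam n by rewrite oppr_gt0; exact: lam_lt0.
have Lch := inL2_mulc Lhat.
(* The first n terms enter as they are, since lam_j may vanish there. The others are bounded by
   Bessel's inequality for hat and for c hat, using |1 / lam_j| <= mun. *)
exists (\sum_(0 <= j < n) phi j ^+ 2 + 2 * (inner L (hat L) (hat L) +
  mun ^+ 2 * inner L (fun x => c x * hat L x) (fun x => c x * hat L x))) => N.
have le_phi j : phi j ^+ 2 <= (if (j < n)%N then phi j ^+ 2 else 0) +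
    2 * (coef (hat L) j ^+ 2 + mun ^+ 2 * coef (fun x => c x * hat L x) j ^+ 2).
  have ge0 : 0 <= 2 * (coef (hat L) j ^+ 2 + mun ^+ 2 * coef (fun x => c x * hat L x) j ^+ 2).
    by apply: mulr_ge0 => //; apply: addr_ge0; [exact: sqr_ge0|apply: mulr_ge0; exact: sqr_ge0].
  case: ltnP => [_|nj]; first by rewrite lerDl.
  have lj0 := lam_lt0 nj.
  have -> : phi j = - coef (hat L) j + (lam j)^-1 * coef (fun x => c x * hat L x) j.
    by rewrite /phi deriv_at0_eigen; field; rewrite lt_eqF.
  have lj : (lam j)^-1 ^+ 2 <= mun ^+ 2.
    have lj1 : 0 < - lam j by rewrite oppr_gt0.
    rewrite -sqrrN -invrN ler_pXn2r ?nnegrE ?invr_ge0 ?(ltW lj1) ?(ltW mu0)//.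
    by rewrite /mun lef_pV2 ?posrE// lam_gap.
  rewrite add0r; set a := coef _ _; set b := coef _ _.
  apply: (@le_trans _ _ (2 * (a ^+ 2 + (lam j)^-1 ^+ 2 * b ^+ 2))).
    have := sqr_ge0 (a + (lam j)^-1 * b); nra.
  by rewrite ler_wpM2l// lerD// ler_wpM2r ?sqr_ge0.
apply: (@le_trans _ _ (\sum_(0 <= j < N) ((if (j < n)%N then phi j ^+ 2 else 0) +
    2 * (coef (hat L) j ^+ 2 + mun ^+ 2 * coef (fun x => c x * hat L x) j ^+ 2)))).
  by apply: ler_sum => j _; exact: le_phi.
rewrite big_split/= -mulr_sumr big_split/= -mulr_sumr; apply: lerD.
  apply: (@le_trans _ _ (\sum_(0 <= j < maxn N n) (if (j < n)%N then phi j ^+ 2 else 0))).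
    rewrite [leRHS](@big_cat_nat _ _ _ N) ?leq_maxl//= lerDl; apply: sumr_ge0 => j _.
    by case: ifP; rewrite ?sqr_ge0.
  rewrite (@big_cat_nat _ _ _ n) ?leq_maxr//= [X in _ + X]big_nat_cond [X in _ + X]big1 => [|j].
    rewrite addr0 big_nat_cond [leRHS]big_nat_cond; apply: ler_sum => j.
    by rewrite andbT => /andP[_ ->].
  by move=> /andP[/andP[nj _] _]; rewrite ltnNge nj.
rewrite ler_wpM2l// lerD ?bessel// ler_wpM2l ?sqr_ge0// bessel//.
Qed.

Definition stable_form f := stable_sum e lam n (fun j => coef f j).

Lemma bounded_form_stable : bounded_form L stable_form.
Proof. by have [Phi HPhi] := sqr_sum_phi; exact: bounded_form_tail HPhi. Qed.

Lemma cvg_stable f : inL2 L f ->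
  \sum_(n <= j < N) deriv_at0 (e j) / lam j * coef f j @[N --> \oo] --> stable_form f.
Proof. by move=> Lf; have [Phi HPhi] := sqr_sum_phi; exact: cvg_tail_form HPhi _ _. Qed.

(** Parseval gives f'(0) as the sum of the e_j'(0) <f, e_j>, and <f, e_j> = <A f, e_j> / lam_j from
    index n on. Applied to w, the second term is exactly what the derivative of the series in zeta
    produces, so that the unbounded trace cancels. *)
Lemma deriv_at0_stable f f1 f2 : dirichlet_data f f1 f2 ->
  deriv_at0 f = \sum_(j < n) deriv_at0 (e j) * coef f j
    + stable_form (fun x => f2 x + c x * f x).
Proof.
move=> dd; have [Lf _] := dirichlet_data_inL2 dd; have LA := inL2_op dd.
have Lch := inL2_mulc Lhat.
have H : \sum_(0 <= j < N) deriv_at0 (e j) * coef f j @[N --> \oo] --> deriv_at0 f.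
  rewrite (deriv_at0_op dd).
  refine (near_cvg_eq _ (cvgD (cvgN (parseval e_basis LA Lhat)) (parseval e_basis Lf Lch))).
  near=> N => /=.
  rewrite ?fctE -sumrN -big_split/=; apply: eq_bigr => j _.
  by rewrite deriv_at0_eigen (op_coef _ dd); ring.
have H2 := cvg_stable LA.
have H3 : \sum_(j < n) deriv_at0 (e j) * coef f j +
   \sum_(n <= j < N) deriv_at0 (e j) / lam j * coef (fun x => f2 x + c x * f x) j
   @[N --> \oo] --> \sum_(j < n) deriv_at0 (e j) * coef f j
    + stable_form (fun x => f2 x + c x * f x).
  by apply: cvgD => //; exact: cvg_cst.
rewrite -(cvg_lim (@Rhausdorff R) H).
refine (cvg_lim (@Rhausdorff R) (near_cvg_eq _ H3)); near=> N.
rewrite -(big_mkord xpredT (fun j => deriv_at0 (e j) * coef f j)).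
rewrite [RHS](@big_cat_nat _ _ _ n)//=; last by near: N; exact: nbhs_infty_ge.
congr (_ + _); rewrite big_nat_cond [RHS]big_nat_cond; apply: eq_bigr => j.
rewrite andbT => /andP[nj _]; rewrite (op_coef _ dd) mulrA divfK//.
by rewrite lt_eqF// lam_lt0.
Unshelve. all: by end_near. Qed.

(** For the initial value of the modal energy. Over all modes, - lam_j <f, e_j>^2 sums to - <A f, f>
    = |f'|^2 - <c f, f>; discarding the nonnegative eigenvalues and the term in c costs a multiple
    of |f|^2, which Poincare's inequality absorbs. *)
Lemma energy_lower : exists2 C, 0 < C & forall f f1 f2 N, dirichlet_data f f1 f2 ->
  \sum_(n <= j < N) (- lam j * coef f j ^+ 2) <= C * inner L f1 f1.
Proof.
have [M M0 cM] := inL2_bounded_mul c_Linfty.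
(* Each of the first n squared coefficients is at most |f|^2, so these modes weigh at most [Lam]
   |f|^2. *)
pose Lam := \sum_(0 <= j < n) lam j.
have Lam0 : 0 <= Lam by rewrite /Lam big_nat_cond sumr_ge0// => j; rewrite andbT => /lam_ge0.
exists (1 + (M + Lam) * L ^+ 2) => [|f f1 f2 N dd].
  by rewrite ltr_pwDl// mulr_ge0 ?sqr_ge0// addr_ge0.
have [Lf _] := dirichlet_data_inL2 dd; have LA := inL2_op dd.
have H : - (inner L (fun x => f2 x + c x * f x) f) + Lam * inner L f f <=
    (1 + (M + Lam) * L ^+ 2) * inner L f1 f1.
  rewrite innerDl//; [|by case: (dirichlet_data_inL2 dd)|exact: inL2_mulc].
  case: dd => ff f12 f0 fL; rewrite (dirichlet_form L_gt0 ff f12 f0 fL).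
  have [_ [_ cf]] := cM f Lf.
  have := ler_wpM2l (addr_ge0 M0 Lam0) (poincare L_gt0 ff f0); nra.
apply: le_trans H.
refine (cvgr_to_ge (cvgD (cvgN (parseval e_basis LA Lf)) (cvg_cst (Lam * inner L f f))) _).
near=> M'.
rewrite ?fctE.
have M'n : (maxn n N <= M')%N by near: M'; exact: nbhs_infty_ge.
apply: (@le_trans _ _ (\sum_(n <= j < M') - lam j * coef f j ^+ 2)).
  have [nN|Nn] := leqP n N; last first.
    rewrite big_geq; last exact: ltnW.
    rewrite big_nat_cond sumr_ge0// => j; rewrite andbT => /andP[nj _].
    by rewrite mulr_ge0 ?sqr_ge0// oppr_ge0 ltW// lam_lt0.
  rewrite [leRHS](@big_cat_nat _ _ _ N)//=; last first.
    by apply: leq_trans M'n; exact: leq_maxr.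
  rewrite lerDl big_nat_cond sumr_ge0// => j; rewrite andbT => /andP[Nj _].
  by rewrite mulr_ge0 ?sqr_ge0// oppr_ge0 ltW// lam_lt0// (leq_trans nN).
rewrite [X in - X](@big_cat_nat _ _ _ n)//=; last first.
  by apply: leq_trans M'n; exact: leq_maxl.
have -> : \sum_(n <= j < M') coef (fun x => f2 x + c x * f x) j * coef f j =
    - (\sum_(n <= j < M') - lam j * coef f j ^+ 2).
  by rewrite -sumrN; apply: eq_bigr => j _; rewrite (op_coef _ dd); ring.
have : \sum_(0 <= j < n) coef (fun x => f2 x + c x * f x) j * coef f j <=
    Lam * inner L f f.
  rewrite /Lam mulr_suml big_nat_cond [leRHS]big_nat_cond; apply: ler_sum => j.
  rewrite andbT => /lam_ge0 lj; rewrite (op_coef _ dd) -mulrA -expr2 ler_wpM2l//.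
  apply: le_trans (bessel e_basis j.+1 Lf).
  by rewrite big_nat_recr//= lerDr sumr_ge0// => k _; exact: sqr_ge0.
lra.
Unshelve. all: by end_near. Qed.

(** Recovers the H^1_0 norm from the modes. In |f'|^2 = - <A f, f> + <c f, f> the nonnegative
    eigenvalues only lower the first term, which is at most S; the second is at most M |f|^2, and
    |f|^2 is at most the first n squares plus S / (- lam_n). *)
Lemma energy_upper : exists2 C, 0 < C & forall f f1 f2 S, dirichlet_data f f1 f2 ->
  (forall N, \sum_(n <= j < N) (- lam j * coef f j ^+ 2) <= S) ->
  inner L f1 f1 <= C * (\sum_(j < n) coef f j ^+ 2 + S).
Proof.
have [M M0 cM] := inL2_bounded_mul c_Linfty.
have mu0 : 0 < - lam n by rewrite oppr_gt0; exact: lam_lt0.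
exists (1 + M + M / - lam n) => [|f f1 f2 S dd HS].
  by rewrite -addrA ltr_pwDl// addr_ge0// divr_ge0// ltW.
have [Lf _] := dirichlet_data_inL2 dd; have LA := inL2_op dd.
have S0 : 0 <= S by have := HS 0; rewrite big_geq.
pose s := \sum_(j < n) coef f j ^+ 2.
have s0 : 0 <= s by apply: sumr_ge0 => j _; exact: sqr_ge0.
have sE : s = \sum_(0 <= j < n) coef f j ^+ 2 by rewrite big_mkord.
have H1 : - inner L (fun x => f2 x + c x * f x) f <= S.
  refine (cvgr_to_le (cvgN (parseval e_basis LA Lf)) _); near=> N.
  rewrite ?fctE (@big_cat_nat _ _ _ n)//=; last by near: N; exact: nbhs_infty_ge.
  have -> : \sum_(n <= j < N) coef (fun x => f2 x + c x * f x) j * coef f j =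
      - (\sum_(n <= j < N) - lam j * coef f j ^+ 2).
    by rewrite -sumrN; apply: eq_bigr => j _; rewrite (op_coef _ dd); ring.
  have : 0 <= \sum_(0 <= j < n) coef (fun x => f2 x + c x * f x) j * coef f j.
    rewrite big_nat_cond sumr_ge0// => j; rewrite andbT => /lam_ge0 lj.
    by rewrite (op_coef _ dd) -mulrA -expr2 mulr_ge0// sqr_ge0.
  have := HS N; lra.
have H2 : inner L f f <= s + S / - lam n.
  refine (cvgr_to_le (parseval e_basis Lf Lf) _); near=> N.
  rewrite (@big_cat_nat _ _ _ n)//=; last by near: N; exact: nbhs_infty_ge.
  rewrite sE; apply: lerD; first by apply: ler_sum => j _; rewrite expr2.
  rewrite ler_pdivlMr// mulrC mulr_sumr; apply: le_trans (HS N).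
  rewrite big_nat_cond [leRHS]big_nat_cond; apply: ler_sum => j.
  rewrite andbT => /andP[nj _]; rewrite -expr2 ler_wpM2r ?sqr_ge0//.
  exact: lam_gap.
have [_ [cf _]] := cM f Lf.
have := dd => -[ff f12 f0 fL].
have E : inner L f1 f1 = - inner L (fun x => f2 x + c x * f x) f + inner L (fun x => c x * f x) f.
  rewrite innerDl//; [|by case: (dirichlet_data_inL2 dd)|exact: inL2_mulc].
  by rewrite (dirichlet_form L_gt0 ff f12 f0 fL); ring.
rewrite E; apply: (le_trans (lerD H1 cf)).
apply: (@le_trans _ _ (S + M * (s + S / - lam n))).
  by rewrite lerD2l ler_wpM2l.
rewrite -/s -subr_ge0.
have -> : (1 + M + M / - lam n) * (s + S) - (S + M * (s + S / - lam n)) =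
  s + M * S + (M / - lam n) * s by ring.
by rewrite !addr_ge0// !mulr_ge0// invr_ge0 ltW.
Unshelve. all: by end_near. Qed.

End Spectral.

(** * Gronwall estimates with a weight *)

Section Gronwall.
Context {R : realType}.
Implicit Types (V dV g p : R -> R) (s t T a b : R).

(* The exceptional time D is that of the jump of v_D.                         *)
Lemma nincr_except (W dW : R -> R) T D : 0 <= T ->
  {within `[0, T], continuous W} ->
  (forall t, 0 < t < T -> t != D -> is_derive t 1 W (dW t)) ->
  (forall t, 0 < t < T -> t != D -> dW t <= 0) -> W T <= W 0.
Proof.
move=> T0 cW dW_ dW0.
have H a b : 0 <= a -> a <= b -> b <= T -> (D <= a) || (b <= D) -> W b <= W a.
  move=> a0 ab bT Dab.
  have inD t : t \in `]a, b[ -> 0 < t < T /\ t != D.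
    rewrite in_itv/= => /andP[at_ tb]; split.
      by rewrite (le_lt_trans a0 at_) (lt_le_trans tb bT).
    case/orP: Dab => [Da|bD]; first by rewrite gt_eqF// (le_lt_trans Da).
    by rewrite lt_eqF// (lt_le_trans tb).
  apply: (@ler0_derive1_nincr _ W a b) => //.
  - by move=> t /inD[tT tD]; have [] := dW_ t tT tD.
  - by move=> t /inD[tT tD]; rewrite derive1E; have [_ ->] := dW_ t tT tD; exact: dW0.
  - by apply: continuous_subspaceW cW; apply: subset_itv; rewrite bnd_simp.
have [D0|D0] := leP D 0; first by apply: H; rewrite ?D0.
have [TD|DT] := leP T D; first by apply: H; rewrite ?TD ?orbT.
apply: (@le_trans _ _ (W D)); apply: H; rewrite ?lexx ?orbT// ltW//.
Qed.

(** With k = K / (sigma - theta), k exp(- theta t) is a particular solution of the equality case, so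
    exp(sigma t) (V - k exp(- theta t)) does not increase. *)
Lemma gronwall_exp V dV (sigma theta K : R) T D : 0 <= T -> theta < sigma ->
  {within `[0, T], continuous V} ->
  (forall t, 0 < t < T -> t != D -> is_derive t 1 V (dV t)) ->
  (forall t, 0 < t < T -> t != D -> dV t <= - sigma * V t + K * expR (- theta * t)) ->
  0 <= K ->
  V T <= expR (- sigma * T) * V 0 + K / (sigma - theta) * expR (- theta * T).
Proof.
move=> T0 ts cV dV_ dVle K0; have st : 0 < sigma - theta by rewrite subr_gt0.
pose k := K / (sigma - theta).
have k0 : 0 <= k by rewrite divr_ge0// ltW.
pose W t := expR (sigma * t) * (V t - k * expR (- theta * t)).
have dexp (a t : R) : is_derive t 1 (fun t => expR (a * t)) (a * expR (a * t)).
  have := @is_derive1_comp _ expR (fun t => a * t) t _ a (is_derive_expR _).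
  rewrite mulrC; apply; have := is_deriveZ a (is_derive_id t (1 : R)).
  by rewrite /GRing.scale/= mulr1.
have cexp (a : R) : {within `[0, T], continuous (fun t => expR (a * t))}.
  apply: continuous_subspaceT => x; have [dx _] := dexp a x.
  exact/differentiable_continuous/derivable1_diffP.
have cW : {within `[0, T], continuous W}.
  have c1 : {within `[0, T], continuous (fun t => V t - k * expR (- theta * t))}.
    apply: within_continuousB => //; apply: within_continuousM; last exact: cexp.
    by move=> t; exact: cvg_cst.
  by apply: within_continuousM => //; exact: cexp.
have : W T <= W 0.
  apply: (@nincr_except W (fun t => expR (sigma * t) * (dV t + k * theta * expR (- theta * t)) +
      sigma * expR (sigma * t) * (V t - k * expR (- theta * t))) T D T0 cW).
  - move=> t tT tD.
    have d2 : is_derive t 1 (fun t => V t - k * expR (- theta * t))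
        (dV t - k * (- theta * expR (- theta * t))).
      exact: is_deriveB (dV_ t tT tD) (is_deriveZ k (dexp (- theta) t)).
    have d3 : is_derive t 1 W (expR (sigma * t) * (dV t - k * (- theta * expR (- theta * t)))
        + (V t - k * expR (- theta * t)) * (sigma * expR (sigma * t))).
      exact: is_deriveM (dexp sigma t) d2.
    by apply: is_derive_eq d3 _; ring.
  - move=> t tT tD; have := dVle t tT tD.
    have -> : K = k * (sigma - theta) by rewrite divfK// gt_eqF.
    rewrite -subr_ge0 => H.
    have -> : expR (sigma * t) * (dV t + k * theta * expR (- theta * t)) +
      sigma * expR (sigma * t) * (V t - k * expR (- theta * t)) =
      - (expR (sigma * t) * (- sigma * V t + k * (sigma - theta) * expR (- theta * t) - dV t)) by ring.
    by rewrite oppr_le0 mulr_ge0// expR_ge0.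
rewrite /W !mulr0 expR0 mul1r mulr1 => H.
have E : expR (- sigma * T) * expR (sigma * T) = 1.
  by rewrite -expRD mulNr addNr expR0.
have := ler_wpM2l (expR_ge0 (- sigma * T)) H; rewrite mulrA E mul1r -/k.
have := mulr_ge0 (expR_ge0 (- sigma * T)) k0; lra.
Qed.

(* Over the past of t such a weight is at most expR (theta * (t - s)) * g t,  *)
(* so that a decay rate larger than theta bounds a solution at time t by the  *)
(* present value g t, rather than by the supremum of its past values.         *)
Definition slowly_decreasing (theta : R) g :=
  (forall t, 0 <= t -> 0 <= g t) /\
  (forall s t, 0 <= s -> s <= t -> g s <= expR (theta * (t - s)) * g t).

Lemma gronwall_weight V dV (sigma theta C : R) g D : 0 <= C -> theta < sigma ->
  slowly_decreasing theta g ->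
  {within Rplus, continuous V} ->
  (forall t, 0 < t -> t != D -> is_derive t 1 V (dV t)) ->
  (forall t, 0 < t -> t != D -> dV t <= - sigma * V t + C * g t) ->
  forall T, 0 <= T -> V T <= expR (- sigma * T) * V 0 + C / (sigma - theta) * g T.
Proof.
move=> C0 ts [g0 gs] cV dV_ dVle T T0.
(* The horizon T is frozen: on [0, T] slow decrease gives g t <= exp(theta (T - t)) g T, an
   exponential forcing whose amplitude is a multiple of g T. *)
have := @gronwall_exp V dV sigma theta (C * (expR (theta * T) * g T)) T D T0 ts.
have -> : C * (expR (theta * T) * g T) / (sigma - theta) * expR (- theta * T) =
    C / (sigma - theta) * g T * (expR (theta * T) * expR (- theta * T)) by ring.
have -> : expR (theta * T) * expR (- theta * T) = 1.
  by rewrite -expRD mulNr subrr expR0.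
rewrite mulr1; apply.
- by apply: continuous_subspaceW cV => t /=; rewrite in_itv/= => /andP[].
- by move=> t /andP[t0 _]; exact: dV_.
- move=> t /andP[t0 tT] tD; apply: (le_trans (dVle _ t0 tD)); rewrite lerD2l.
  rewrite -mulrA ler_wpM2l// mulrAC -expRD.
  have -> : theta * T + - theta * t = theta * (T - t) by ring.
  by apply: gs; exact: ltW.
- by rewrite mulr_ge0// mulr_ge0 ?expR_ge0// g0.
Qed.

(* The weight is sup_(s >= 0) eta s * min 1 (expR (- theta * (t - s))).       *)
Lemma weight_exists (eta : R -> R) (theta B : R) : 0 < theta ->
  (forall t, 0 <= t -> 0 <= eta t <= B) -> eta t @[t --> +oo] --> 0 ->
  exists p : R -> R, [/\ p t @[t --> +oo] --> 0,
    forall t, 0 <= t -> eta t <= p t,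
    slowly_decreasing theta p &
    forall s t, s <= t -> p t <= p s].
Proof.
move=> th0 etaB eta0.
have B0 : 0 <= B by have /andP[] := etaB 0 (lexx 0); exact: le_trans.
pose w s t := eta s * Num.min 1 (expR (- theta * (t - s))).
have min0 s t : 0 <= Num.min 1 (expR (- theta * (t - s))) by rewrite le_min ler01 expR_ge0.
pose A t := [set w s t | s in Rplus].
have Aw s t : 0 <= s -> A t (w s t) by move=> s0; exists s.
have w0 s t : 0 <= s -> 0 <= w s t.
  by move=> s0; have /andP[e0 _] := etaB s s0; exact: mulr_ge0.
have hsA t : has_sup (A t).
  split; first by exists (w 0 t); exact: Aw.
  exists B => _ [s s0 <-]; have /andP[e0 eB] := etaB s s0.
  by apply: le_trans eB; rewrite /w -[leRHS]mulr1 ler_wpM2l// ge_min lexx.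
have w_le s t : 0 <= s -> w s t <= sup (A t).
  by move=> s0; apply: ub_le_sup; [exact: (hsA t).2|exact: Aw].
have sup_le t b : (forall s, 0 <= s -> w s t <= b) -> sup (A t) <= b.
  by move=> H; apply: ge_sup; [exact: (hsA t).1|move=> _ [s s0 <-]; exact: H].
exists (fun t => sup (A t)); split.
- apply/cvgrPdist_le => eps eps0.
  have /cvgrPdist_le/(_ _ eps0)[T [_ HT]] := eta0.
  (* [T'] splits the supremum: a later s contributes at most eps through [eta], an earlier one at
     most B times an exponential that decays in t. *)
  pose T' := Num.max T 0 + 1.
  have tail : \forall t \near +oo, B * expR (- theta * (t - T')) <= eps.
    near=> t.
    have tT : T' + B / (eps * theta) <= t by near: t; apply: nbhs_pinfty_ge; exact: num_real.
    rewrite mulNr expRN ler_pdivrMr ?expR_gt0//.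
    apply: (@le_trans _ _ (eps * (1 + theta * (t - T')))).
      rewrite mulrDr mulr1 mulrA -[leLHS]add0r lerD ?(ltW eps0)//.
      by rewrite -ler_pdivrMl ?mulr_gt0// mulrC lerBrDl.
    by rewrite ler_wpM2l ?(ltW eps0)// expR_ge1Dx.
  apply: filterS tail => t Ht.
  rewrite sub0r normrN ger0_norm; last by apply: le_trans (w_le 0 t _) => //; exact: w0.
  apply: sup_le => s s0; have /andP[e0 eB] := etaB s s0.
  have [sT|Ts] := leP s T'; last first.
    apply: (@le_trans _ _ (eta s)).
      by rewrite /w -[leRHS]mulr1 ler_wpM2l// ge_min lexx.
    have /HT : T < s by apply: le_lt_trans Ts; rewrite /T' (le_trans _ (_ : Num.max T 0 <= _))// ?le_max ?lexx// lerDl.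
    by rewrite sub0r normrN; exact: le_trans (ler_norm _).
  apply: le_trans Ht; apply: ler_pM => //.
  rewrite ge_min; apply/orP; right; rewrite ler_expR; nra.
- move=> t t0; apply: le_trans (w_le t t t0).
  by rewrite /w subrr mulr0 expR0 minxx mulr1.
(* Each kernel min 1 (exp(- theta (t - s))) decreases in t at rate at most theta, and the supremum
   inherits this. *)
- split=> [t _|s t s0 st].
    by apply: le_trans (w_le 0 t _) => //; exact: w0.
  apply: sup_le => k k0; apply: (@le_trans _ _ (expR (theta * (t - s)) * w k t)); last first.
    by rewrite ler_wpM2l ?expR_ge0// w_le.
  rewrite /w mulrCA; have /andP[e0 _] := etaB k k0; rewrite ler_wpM2l//.
  rewrite minr_pMr ?expR_ge0// mulr1 -expRD le_min; apply/andP; split.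
    rewrite (@le_trans _ _ 1)// ?ge_min ?lexx//.
    by rewrite -expR0 ler_expR mulr_ge0 ?(ltW th0) ?subr_ge0.
  rewrite ge_min; apply/orP; right; rewrite ler_expR; nra.
- move=> s t st; apply: sup_le => k k0; apply: le_trans (w_le k s k0).
  have /andP[e0 _] := etaB k k0; rewrite /w ler_wpM2l// le_min ge_min lexx/=.
  rewrite ge_min; apply/orP; right; rewrite ler_expR; nra.
Unshelve. all: by end_near. Qed.

End Gronwall.

(** * The delayed closed loop *)

Section Primitive.
Context {R : realType}.
Local Notation mu := (@lebesgue_measure R).
Variable h : R -> R.
Hypothesis h_int : forall T, 0 <= T -> mu.-integrable `[0, T] (EFin \o h).
Hypothesis h_neg : forall t, t < 0 -> h t = 0.

Definition prim t : R := \int[mu]_(s in `[0, t]) h s.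

Lemma integrable_zero_neg a b : mu.-integrable `[a, b] (EFin \o h).
Proof.
have m0 : measurable (`[0, `|b|]%classic : set (measurableTypeR R)) by exact: measurable_itv.
have H := h_int (normr_ge0 b).
have {}H : mu.-integrable setT (EFin \o (h \_ `[0, `|b|])).
  by move/(@integrable_mkcond _ _ _ mu _ _ m0): H; rewrite restrict_EFin.
have : mu.-integrable `[a, b] (EFin \o (h \_ `[0, `|b|])).
  exact: integrableS H.
apply: eq_integrable => // x /set_mem/=; rewrite in_itv/= => /andP[_ xb].
rewrite patchE mem_setE in_itv/=; case: ifPn => //.
rewrite negb_and -!ltNge => /orP[/h_neg -> //|bx].
by have := lt_le_trans bx (le_trans xb (ler_norm b)); rewrite ltxx.
Qed.

(** As h vanishes at negative times, any nonpositive lower end will do; continuity of the primitive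
    at 0 thus becomes continuity at an interior point. *)
Lemma prim_from a t : a <= 0 -> prim t = \int[mu]_(s in `[a, t]) h s.
Proof.
move=> a0; rewrite /prim Rintegral_mkcond [RHS]Rintegral_mkcond.
apply: eq_Rintegral => x _; rewrite !patchE !mem_setE !in_itv/=.
have [x0|x0] := leP 0 x; first by rewrite (le_trans a0 x0).
by rewrite /= h_neg//; case: ifP.
Qed.

Lemma prim_neg t : t < 0 -> prim t = 0.
Proof.
by move=> t0; rewrite /prim set_itv_ge ?Rintegral_set0// bnd_simp -ltNge.
Qed.

Lemma prim0 : prim 0 = 0.
Proof. by rewrite /prim set_itv1 Rintegral_set1. Qed.

Lemma continuous_prim : continuous prim.
Proof.
move=> t; pose a := - `|t| - 1; pose b := `|t| + 1.
have ab : a < b by rewrite /a /b; have := normr_ge0 t; lra.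
have a0 : a <= 0 by rewrite /a; have := normr_ge0 t; lra.
have := parameterized_integral_continuous (ltW ab) (integrable_zero_neg a b).
move/(continuous_within_itvP _ ab) => [+ _ _] => /(_ t).
rewrite (_ : (fun x => _) = prim); last first.
  by apply/funext => x; rewrite (prim_from _ a0).
apply; rewrite in_itv/= /a /b; have := ler_norm t; have := ler_norm (- t).
by rewrite normrN => h1 h2; apply/andP; split; lra.
Qed.

Lemma is_derive_prim (t : R) : 0 < t -> {for t, continuous h} ->
  is_derive t 1 prim (h t).
Proof.
move=> t0 ct; have tu : t < t + 1 by rewrite ltrDl.
have [|dF F'] := continuous_FTC1_closed tu (h_int _) t0 ct.
  by rewrite addr_ge0// ltW.
by apply: DeriveDef dF _; rewrite -derive1E.
Qed.

Lemma is_derive_prim_neg (t : R) : t < 0 -> is_derive t 1 prim 0.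
Proof.
move=> t0; apply: (near_eq_is_derive _ (is_derive_cst (0 : R) t 1)).
have : \forall s \near t, s < 0 by exact: lt_nbhsl.
by apply: filterS => s s0; rewrite prim_neg.
Qed.

Lemma Rintegral_window D t : 0 <= D -> 
  \int[mu]_(s in `[(t - D)%R, t]) h s = prim t - prim (t - D).
Proof.
move=> D0; pose a := Num.min 0 (t - D).
have a0 : a <= 0 by rewrite ge_min lexx.
have aD : a <= t - D by rewrite ge_min lexx orbT.
rewrite !(prim_from _ a0) Rintegral_itvB.
- rewrite Rintegral_itv_obnd_cbnd//.
  apply: integrableS (integrable_zero_neg (t - D) t) => //.
  by apply: subset_itvr; rewrite bnd_simp.
- exact: integrable_zero_neg.
- by rewrite bnd_simp.
- by rewrite bnd_simp lerBlDr lerDl.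
Qed.

End Primitive.

(** * The integral term of the predictor *)

Section Window.
Context {R : realType} (m : nat) (A : 'M[R]_m) (B : 'cV[R]_m) (D : R).
Hypothesis D_ge0 : 0 <= D.
Local Notation mu := (@lebesgue_measure R).

Definition window (v : R -> R) (t : R) : 'cV[R]_m :=
  \col_i \int[mu]_(s in `[(t - D)%R, t])
    ((expmx ((t - D - s) *: A) *m B) i 0 * v s).

Lemma continuous_expmxB (i : 'I_m) : continuous (fun t : R => (expmx (t *: A) *m B) i 0).
Proof.
move=> t; rewrite /continuous_at mxE; under eq_cvg do rewrite mxE.
apply: cvg_sumr => k; apply: cvgM; last exact: cvg_cst.
exact: continuous_expmx.
Qed.

Lemma continuous_expmxNB (i : 'I_m) : continuous (fun t : R => (expmx ((- t) *: A) *m B) i 0).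
Proof.
move=> t; apply: (@continuous_comp R R R (fun t : R => - t) (fun t : R => (expmx (t *: A) *m B) i 0)).
  exact: opp_continuous.
exact: continuous_expmxB.
Qed.

Lemma integrableM_continuous (g f : R -> R) a b : continuous g ->
  mu.-integrable `[a, b] (EFin \o f) ->
  mu.-integrable `[a, b] (EFin \o (fun s => g s * f s)).
Proof.
move=> cg intf.
have [ba|ab] := ltP b a.
  rewrite set_itv_ge ?bnd_simp -?ltNge//; exact: integrable_set0.
have cng : {within `[a, b], continuous (fun s : R => `|g s|)}.
  apply: continuous_subspaceT => x; apply: continuous_comp; first exact: cg.
  exact: norm_continuous.
have [x0 _ M_ge] := EVT_max ab cng.
have mf : measurable_fun `[a, b] f by apply/measurable_EFinP; case/integrableP: intf.
have mI : measurable (`[a, b]%classic : set (measurableTypeR R)) by exact: measurable_itv.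
apply: (le_integrable mI _ _ (integrableZl mI `|g x0| intf)).
  apply/measurable_EFinP; apply: measurable_funM => //.
  by apply: measurable_funTS; exact: continuous_measurable_fun.
move=> s /= sab; rewrite lee_fin !normrM normr_id ler_wpM2r//.
by apply: M_ge.
Qed.

(** The exponent t - D - s stays in [-D, 0], so the kernel is bounded by its maximum on a compact
    interval, uniformly in t. *)
Lemma window_bound : exists2 M : R, 0 < M & forall (v : R -> R) (t b : R),
  mu.-integrable `[(t - D)%R, t] (EFin \o v) ->
  (forall s, t - D <= s <= t -> `|v s| <= b) ->
  forall i, `|window v t i 0| <= M * b.
Proof.
have ND0 : - D <= 0 by rewrite oppr_le0.
have [f Hf] : {f : 'I_m -> R & forall i tau, - D <= tau <= 0 ->
    `|(expmx (tau *: A) *m B) i 0| <= f i}.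
  suff /choice[f Hf] : forall i : 'I_m, exists b : R, forall tau, - D <= tau <= 0 ->
    `|(expmx (tau *: A) *m B) i 0| <= b by exists f.
  move=> i.
  have cn : {within `[- D, 0], continuous (fun t : R => `|(expmx (t *: A) *m B) i 0|)}.
    apply: continuous_subspaceT => x; apply: continuous_comp; last exact: norm_continuous.
    exact: continuous_expmxB.
  have [x0 _ M_ge] := EVT_max ND0 cn.
  exists `|(expmx (x0 *: A) *m B) i 0| => tau tD; apply: M_ge.
  by rewrite in_itv.
pose M := 1 + D * \sum_i `|f i|.
exists M => [|v t b iv vb i].
  by rewrite /M ltr_pwDl// mulr_ge0// sumr_ge0.
have b0 : 0 <= b by apply: le_trans (vb t _); rewrite ?normr_ge0// lexx gerBl D_ge0.
have iw : mu.-integrable `[(t - D)%R, t]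
    (EFin \o (fun s => (expmx ((t - D - s) *: A) *m B) i 0 * v s)).
  apply: integrableM_continuous => // x.
  apply: (@continuous_comp R R R (fun x : R => t - D - x) (fun t : R => (expmx (t *: A) *m B) i 0)).
    by apply: cvgB; [exact: cvg_cst|exact: cvg_id].
  exact: continuous_expmxB.
rewrite mxE; apply: (le_trans (le_normr_Rintegral _ iw)) => //.
apply: (@le_trans _ _ (\int[mu]_(s in `[(t - D)%R, t]) (f i * b))).
  have mI : measurable (`[(t - D)%R, t]%classic : set (measurableTypeR R)) by exact: measurable_itv.
  apply: le_Rintegral => //.
  - exact: (integrable_abse iw).
  - apply: integrableM_continuous; first by move=> x; exact: cvg_cst.
    apply: continuous_compact_integrable; first exact: segment_compact.
    by move=> x; exact: cvg_cst.
  - move=> s; rewrite /= in_itv/= => sI; rewrite normrM ler_pM//; last exact: vb.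
    by apply: Hf; move: sI => /andP[s1 s2]; apply/andP; split; lra.
have muD : fine (mu `[(t - D)%R, t]) = D.
  rewrite lebesgue_measure_itv/= lte_fin; case: ltP => /= tD; first by ring.
  by apply/eqP; rewrite eq_le D_ge0 /=; lra.
rewrite Rintegral_cst// muD.
rewrite mulrAC ler_wpM2r// /M mulrC.
have : D * f i <= D * \sum_i `|f i|.
  rewrite ler_wpM2l// (bigD1 i)//= (le_trans (ler_norm _))// lerDl.
  by apply: sumr_ge0.
lra.
Qed.

Variable v : R -> R.
Hypothesis v_int : forall T, 0 <= T -> mu.-integrable `[0, T] (EFin \o v).
Hypothesis v_neg : forall t, t < 0 -> v t = 0.

Let h k s := (expmx ((- s) *: A) *m B) k 0 * v s.

Let h_int k T : 0 <= T -> mu.-integrable `[0, T] (EFin \o (h k)).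
Proof.
by move=> T0; apply: integrableM_continuous (v_int T0); exact: continuous_expmxNB.
Qed.

Let h_neg k t : t < 0 -> h k t = 0.
Proof. by move=> t0; rewrite /h v_neg// mulr0. Qed.

Let W t : 'cV[R]_m := \col_k (prim (h k) t - prim (h k) (t - D)).

(** The group law of the exponential takes t out of the integrand. What remains is a difference of
    two values of a primitive, so that the integral is differentiated by the product rule alone. *)
Lemma windowE t : window v t = expmx ((t - D) *: A) *m W t.
Proof.
apply/colP => i; rewrite !mxE.
under eq_Rintegral do rewrite expmx_addl -mulmxA mxE mulr_suml.
have mI : measurable (`[(t - D)%R, t]%classic : set (measurableTypeR R)) by exact: measurable_itv.
have H (s : seq 'I_m) : mu.-integrable `[(t - D)%R, t] (EFin \o (fun x =>
      \sum_(k <- s) expmx ((t - D) *: A) i k * h k x)) /\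
    \int[mu]_(x in `[(t - D)%R, t]) (\sum_(k <- s) expmx ((t - D) *: A) i k * h k x) =
    \sum_(k <- s) expmx ((t - D) *: A) i k * W t k 0.
  elim: s => [|k s [IHi IH]].
    under [X in EFin \o X]eq_fun do rewrite big_nil.
    under eq_Rintegral do rewrite big_nil.
    rewrite big_nil Rintegral_cst// mul0r; split => //; exact: integrable0.
  have ik := integrable_zero_neg (h_int k) (h_neg k) (t - D) t.
  have ik' : mu.-integrable `[(t - D)%R, t] (EFin \o (fun x => expmx ((t - D) *: A) i k * h k x)).
    exact: (integrableZl mI _ ik).
  under [X in EFin \o X]eq_fun do rewrite big_cons.
  under eq_Rintegral do rewrite big_cons.
  split; first exact: (integrableD mI ik' IHi).
  rewrite big_cons (RintegralD mI ik' IHi) IH (RintegralZl _ mI ik).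
  by rewrite (Rintegral_window (h_int k) (h_neg k) t D_ge0) [W t k 0]mxE.
rewrite -(H _).2; apply: eq_Rintegral => x _; apply: eq_bigr => k _.
by rewrite /h mulrA.
Qed.

(** Hence Z(0) = X(0): the initial value of Z does not involve the control. *)
Lemma window0 : 0 < D -> window v 0 = 0.
Proof.
move=> D0; rewrite windowE (_ : W 0 = 0) ?mulmx0//.
apply/colP => k; rewrite !mxE prim0 prim_neg ?subrr//.
by rewrite sub0r oppr_lt0.
Qed.

Lemma continuous_window (i : 'I_m) : continuous (fun t : R => window v t i 0).
Proof.
move=> t; rewrite /continuous_at windowE mxE.
under eq_cvg do rewrite windowE mxE.
apply: cvg_sumr => k; apply: cvgM.
  apply: (@continuous_comp R R R (fun t : R => t - D) (fun t : R => expmx (t *: A) i k)).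
    by apply: cvgB; [exact: cvg_id|exact: cvg_cst].
  exact: continuous_expmx.
rewrite mxE; under eq_cvg do rewrite mxE.
apply: cvgB; first exact: (continuous_prim (h_int k) (h_neg k)).
apply: (@continuous_comp R R R (fun t : R => t - D) (prim (h k))).
  by apply: cvgB; [exact: cvg_id|exact: cvg_cst].
exact: (continuous_prim (h_int k) (h_neg k)).
Qed.

Lemma is_derive_shift (f : R -> R) (df t : R) : is_derive (t - D) 1 f df ->
  is_derive t 1 (fun s : R => f (s - D)) df.
Proof.
move=> fd; have d : is_derive t 1 (fun s => s - D) (1 : R).
  exact: is_derive_eq (is_deriveB (is_derive_id t (1 : R)) (is_derive_cst D t (1 : R))) (subr0 _).
by have := @is_derive1_comp R f (fun s => s - D) t df 1 fd d; rewrite mulr1.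
Qed.

(** The two ends of the window contribute exp(-DA) B v(t) and - B v(t - D); the latter is there to
    cancel the delayed control in the equation of X. *)
Lemma is_derive_window (t : R) (i : 'I_m) : 0 < t -> t != D -> {for t, continuous v} ->
  (0 < t - D -> {for t - D, continuous v}) ->
  is_derive t 1 (fun s => window v s i 0)
    ((A *m window v t + v t *: (expmx ((- D) *: A) *m B) - v (t - D) *: B) i 0).
Proof.
move=> t0 tD ct ctD.
have dh k s : 0 < s -> {for s, continuous v} -> is_derive s 1 (prim (h k)) (h k s).
  move=> s0 cs; apply: (is_derive_prim (h_int k) s0).
  by apply: cvgM; [exact: continuous_expmxNB|exact: cs].
(* For t - D < 0 the primitive is locally constant and h vanishes; at t - D = 0 it has in general a
   corner, hence the exclusion of t = D. *)
have dhD k : is_derive (t - D) 1 (prim (h k)) (h k (t - D)).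
  have [tD0|Dt0|tD0] := ltrgtP (t - D) 0.
  - by rewrite h_neg//; exact: is_derive_prim_neg.
  - by apply: dh => //; exact: ctD.
  - by move/eqP: tD0; rewrite subr_eq0 (negbTE tD).
have dW k : is_derive t 1 (fun s => W s k 0) (h k t - h k (t - D)).
  have := is_deriveB (dh k t t0 ct) (is_derive_shift (dhD k)).
  by congr is_derive; apply/funext => s; rewrite mxE.
have dE k := is_derive_shift (is_derive_expmx A (t - D) i k).
have := is_derive_sumr (fun k => is_deriveM (dE k) (dW k)).
rewrite (_ : (fun s => _) = fun s => window v s i 0); last first.
  by apply/funext => s; rewrite windowE mxE.
move/is_derive_eq; apply.
rewrite big_split/=.
have -> : \sum_k expmx ((t - D) *: A) i k *: (h k t - h k (t - D)) =
   (v t *: (expmx ((- D) *: A) *m B) - v (t - D) *: B) i 0.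
  have E s : v s *: (expmx ((t - D - s) *: A) *m B) = expmx ((t - D) *: A) *m (\col_k h k s).
    rewrite expmx_addl -mulmxA scalemxAr; congr (_ *m _).
    by apply/colP => k; rewrite [LHS]mxE [RHS]mxE /h mulrC.
  have := E t; have -> : t - D - t = - D by ring.
  move=> ->; have := E (t - D); rewrite subrr expmx0 mul1mx => ->.
  rewrite -mulmxBr mxE; apply: eq_bigr => k _.
  by rewrite !mxE.
have -> : \sum_k W t k 0 *: (A *m expmx ((t - D) *: A)) i k = (A *m window v t) i 0.
  rewrite windowE mulmxA mxE; apply: eq_bigr => k _.
  by rewrite /GRing.scale/= mulrC.
by rewrite -addrA [RHS]mxE addrC.
Qed.

End Window.

(** * Differential equations of the modes, of X and of Z *)

Section ClosedLoop.
Context {R : realType} (L D : R) (c : R -> R) (e : nat -> R -> R)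
  (lam : nat -> R) (n : nat) (K : 'rV[R]_(1 + n + 1)).
Hypotheses (L_gt0 : 0 < L) (D_gt0 : 0 < D) (c_Linfty : inLinfty L c)
  (e_eigen : forall j, opA L c (e j) (fun x => lam j * e j x))
  (e_basis : hilbert_basis L e)
  (lam_decr : forall i j, (i < j)%N -> lam j < lam i)
  (lam_lt0 : forall j, (n <= j)%N -> lam j < 0).
Local Notation coef f j := (inner L f (e j)).
Local Notation mu := (@lebesgue_measure R).
Local Notation stable := (stable_form L e lam n).
Local Notation A := (matA L c e lam n).
Local Notation B := (matB L e lam n).
Local Notation a_fun := (fun x : R => x / L * c x).
Local Notation b_fun := (fun x : R => - (x / L)).

(** The forcing of the finite-dimensional system by arbitrary inputs; [Gamma_e] is its value at the
    limits of r and d. *)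
Definition Gam (rr : R) (dd : R -> R) : 'cV[R]_(1 + n + 1) :=
  col_mx (col_mx 0 (\col_(j < n) coef dd j)) (- rr - stable dd)%:M.

(** The three kinds of components of X: u_D, the modes of index below n, and zeta. *)
Lemma ord3_ind (P : 'I_(1 + n + 1) -> Prop) :
  P (lshift 1 (lshift n 0)) -> (forall j, P (lshift 1 (rshift 1 j))) ->
  P (rshift (1 + n) 0) -> forall i, P i.
Proof.
move=> P0 P1 P2 i; have [j ->|j ->] := split_ordP i; last by rewrite [j]ord1.
by have [k ->|k ->] := split_ordP j; rewrite ?[k]ord1.
Qed.

Lemma mul_matA (u s : R) (w : 'I_n -> R) :
  A *m col_mx (col_mx u%:M (\col_j w j)) s%:M =
  col_mx (col_mx 0 (\col_(j < n) (a_coef L c e j * u + lam j * w j)))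
    (alpha L c e lam n * u + \sum_(j < n) deriv_at0 (e j) * w j)%:M.
Proof.
rewrite /matA mul_block_col mul0mx mul0mx !addr0 /matA1 mul_block_col !mul0mx addr0.
congr (col_mx (col_mx _ _) _).
  apply/colP => j; rewrite mul_diag_mx !mxE big_ord1 !mxE eqxx mulr1n.
  by [].
apply/colP => j; rewrite [j]ord1 /matL1 mul_row_col -scalar_mxM !mxE !mulr1n.
by congr (_ + _); apply: eq_bigr => k _; rewrite !mxE.
Qed.

Lemma inL2_a_fun : inL2 L a_fun.
Proof.
have Lx : inL2 L (fun x => x / L).
  apply: (wderiv_inL2 L_gt0 (g := fun _ => L^-1)).
  by have := wderiv_affine L 0 (L^-1); congr wderiv; apply/funext => x; rewrite add0r mulrC.
have := inL2_mulc c_Linfty Lx; by under eq_fun do rewrite mulrC.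
Qed.

Lemma inL2_b_fun : inL2 L b_fun.
Proof.
apply: (wderiv_inL2 L_gt0 (g := fun _ => - L^-1)).
by have := wderiv_affine L 0 (- L^-1); congr wderiv; apply/funext => x; rewrite add0r mulrC mulrN.
Qed.

Variables (r : R -> R) (d : R -> R -> R) (y0 : R -> R) (z0 : R)
  (y : R -> R -> R) (z v : R -> R).
Hypothesis Ld : forall t, 0 <= t -> inL2 L (d t).
Hypothesis CL : closed_loop L D c e lam K r d y0 z0 y z v.
Local Notation uD := (uD_of D v).
Local Notation w := (w_of L D y v).
Local Notation zeta := (zeta_of L D e lam n y z v).
Local Notation X := (X_of L D e lam n y z v).
Local Notation Z := (Z_of L D c e lam n y z v).

Lemma v_neg t : t < 0 -> v t = 0.
Proof. by case: CL => _ [_ [_ [_ [_ [_ [_ [_ ->]]]]]]] ->. Qed.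

Lemma v_int T : 0 <= T -> mu.-integrable `[0, T] (EFin \o v).
Proof. by case: CL => _ [_ [_ [_ [_ [_ [_ [+ _]]]]]]]; exact. Qed.

Lemma v_feedback t : 0 <= t -> v t = (K *m Z t) 0 0.
Proof. by case: CL => _ [_ [_ [_ [_ [_ [_ [_ ->]]]]]]]; rewrite ltNge => ->. Qed.

Lemma uD_prim t : uD t = prim v (t - D).
Proof.
rewrite /uD_of /u_of; case: ltP => // tD; by rewrite prim_neg.
Qed.

Lemma continuous_uD : continuous uD.
Proof.
move=> t; rewrite (_ : uD = prim v \o (fun t => t - D)); last first.
  by apply/funext => s; rewrite uD_prim.
apply: continuous_comp; first by apply: cvgB; [exact: cvg_id|exact: cvg_cst].
exact: (continuous_prim v_int v_neg).
Qed.

Lemma is_derive_uD (t : R) : t != D -> (0 < t - D -> {for t - D, continuous v}) ->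
  is_derive t 1 uD (v (t - D)).
Proof.
move=> tD ctD; rewrite (_ : uD = fun s => prim v (s - D)); last first.
  by apply/funext => s; rewrite uD_prim.
apply: is_derive_shift; have [tD0|Dt0|tD0] := ltrgtP (t - D) 0.
- by rewrite v_neg//; exact: is_derive_prim_neg.
- by apply: (is_derive_prim v_int) => //; exact: ctD.
- by move/eqP: tD0; rewrite subr_eq0 (negbTE tD).
Qed.

Lemma inL2_y t : 0 <= t -> inL2 L (y t).
Proof.
case: CL => H _ /H[[y2 [y1 yy1 _]] _ _]; exact: (wderiv_inL2 L_gt0 yy1).
Qed.

Lemma w_data t y1 y2 : 0 <= t -> wderiv L (y t) y1 -> wderiv L y1 y2 ->
  dirichlet_data L (w t) (fun x => y1 x - uD t / L) y2.
Proof.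
move=> t0 yy1 yy2; case: CL => H _; have [_ yt0 ytL] := H t t0.
have wa : wderiv L (fun x => x / L * uD t) (fun _ => uD t / L).
  have := wderiv_affine L 0 (uD t / L); congr wderiv.
  by apply/funext => x; rewrite add0r; ring.
split.
- exact: wderivB.
- have := wderivB yy2 (wderiv_cst L (uD t / L)); congr wderiv.
  by apply/funext => x; rewrite subr0.
- by rewrite /w_of yt0 !mul0r subrr.
- by rewrite /w_of ytL divff ?gt_eqF// mul1r subrr.
Qed.

Lemma w_data_ex t : 0 <= t -> exists w1 w2, dirichlet_data L (w t) w1 w2.
Proof.
move=> t0; have [[y2 [y1 yy1 yy2]] _ _] := CL.1 t t0.
by exists (fun x => y1 x - uD t / L), y2; exact: w_data.
Qed.

Section Form.
Variable Lam : (R -> R) -> R.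
Hypothesis BL : bounded_form L Lam.

Lemma form_w t : 0 <= t -> Lam (w t) = Lam (y t) + uD t * Lam b_fun.
Proof.
move=> t0; have [LD LZ _] := BL; rewrite -LZ; last exact: inL2_b_fun.
rewrite -LD; [|exact: inL2_y|exact/inL2Z/inL2_b_fun].
by congr Lam; apply/funext => x; rewrite /w_of mulrN mulrC.
Qed.

Lemma continuous_form_w : {within Rplus, continuous (fun t => Lam (w t))}.
Proof.
have Hy := form_continuous BL inL2_y CL.2.1.
have Hu : {within Rplus, continuous (fun t => uD t * Lam b_fun)}.
  apply: within_continuousM; last by move=> t; exact: cvg_cst.
  exact/continuous_subspaceT/continuous_uD.
have := within_continuousD Hy Hu; apply: subspace_eq_continuous.
by move=> t /set_mem t0; rewrite /from_subspace form_w.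
Qed.

(** In terms of w, the term c y becomes c w + a u_D, and the lifting - (x / L) u_D contributes b v_D
    to the time derivative. *)
Lemma is_derive_form_w (t : R) y1 y2 : 0 < t -> t != D ->
  wderiv L (y t) y1 -> wderiv L y1 y2 ->
  L2_is_derive L y t (fun x => y2 x + c x * y t x + d t x) ->
  (0 < t - D -> {for t - D, continuous v}) ->
  is_derive t 1 (fun s => Lam (w s))
    (Lam (fun x => y2 x + c x * w t x) + uD t * Lam a_fun + v (t - D) * Lam b_fun
     + Lam (d t)).
Proof.
move=> t0 tD yy1 yy2 yd ctD; have [LD LZ _] := BL.
have dw := w_data (ltW t0) yy1 yy2; have LA := inL2_op L_gt0 c_Linfty dw.
have La := inL2_a_fun; have Lb := inL2_b_fun; have Ldt := Ld (ltW t0).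
have Lg : inL2 L (fun x => y2 x + c x * y t x + d t x).
  apply: inL2D => //; apply: inL2D; first by case: yy2.
  exact: (inL2_mulc c_Linfty (inL2_y (ltW t0))).
have dy := form_derive BL t0 inL2_y Lg yd.
have du := is_deriveM (is_derive_uD tD ctD) (is_derive_cst (Lam b_fun) t (1 : R)).
have := is_deriveD dy du.
have -> : Lam (fun x => y2 x + c x * y t x + d t x) =
    Lam (fun x => y2 x + c x * w t x) + uD t * Lam a_fun + Lam (d t).
  rewrite -LZ// -LD//; last exact: inL2Z.
  rewrite -LD//; last by apply: inL2D => //; exact: inL2Z.
  by congr Lam; apply/funext => x; rewrite /w_of; ring.
move=> H; have {}H := is_derive_eq H _.
apply: (near_eq_is_derive _ (H _ _)); last by rewrite /GRing.scale/=; ring.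
have : \forall s \near t, 0 < s by exact: lt_nbhsr.
by apply: filterS => s s0; rewrite form_w ?ltW.
Qed.

End Form.

Lemma X_uD t : X t (lshift 1 (lshift n 0)) 0 = uD t.
Proof. by rewrite /X_of !col_mxEu mxE mulr1n. Qed.

Lemma X_w t j : X t (lshift 1 (rshift 1 j)) 0 = coef (w t) j.
Proof. by rewrite /X_of col_mxEu col_mxEd mxE. Qed.

Lemma X_zeta t : X t (rshift (1 + n) 0) 0 = zeta t.
Proof. by rewrite /X_of col_mxEd mxE mulr1n. Qed.

Let Le j : inL2 L (e j). Proof. by case: e_basis. Qed.

Let bounded_stable : bounded_form L stable.
Proof.
exact: (bounded_form_stable L_gt0 c_Linfty e_eigen e_basis lam_decr lam_lt0).
Qed.

Lemma continuous_X i : {within Rplus, continuous (fun t => X t i 0)}.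
Proof.
elim/ord3_ind: i => [|j|].
- rewrite (_ : (fun t => _) = uD); last by apply/funext => t; exact: X_uD.
  exact/continuous_subspaceT/continuous_uD.
- rewrite (_ : (fun t => _) = fun t => coef (w t) j); last by apply/funext => t; exact: X_w.
  exact: continuous_form_w (bounded_form_inner (Le j)).
- rewrite (_ : (fun t => _) = fun t => z t - stable (w t)); last by apply/funext => t; exact: X_zeta.
  apply: within_continuousB; first by case: CL => _ [_ [_ [_ []]]].
  exact: continuous_form_w.
Qed.

Lemma Z_window t : Z t = X t + window A B D v t.
Proof. by []. Qed.

Lemma continuous_Z i : {within Rplus, continuous (fun t => Z t i 0)}.
Proof.
rewrite (_ : (fun t => _) = fun t => X t i 0 + window A B D v t i 0); last first.
  by apply/funext => t; rewrite Z_window mxE.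
apply: within_continuousD; first exact: continuous_X.
apply: continuous_subspaceT.
exact: (continuous_window (ltW D_gt0) v_int v_neg).
Qed.

Lemma within_Rplus_continuous (f : R -> R) (t : R) : 0 < t ->
  {within Rplus, continuous f} -> {for t, continuous f}.
Proof.
move=> t0 /subspace_continuousP/(_ t (ltW t0)) H.
apply/cvgrPdist_lt => eps eps0; move/cvgrPdist_lt/(_ _ eps0): H.
rewrite near_withinE => H.
have : \forall s \near t, 0 < s by exact: lt_nbhsr.
by apply: filterS2 H => s + s0; apply; exact: ltW.
Qed.

(** Closes a bootstrap: v is a priori only integrable, which already makes u_D, X and the predictor
    integral continuous, hence Z and v = K Z. Only then are the primitives of v differentiable. *)
Lemma continuous_v (t : R) : 0 < t -> {for t, continuous v}.
Proof.
move=> t0; have cKZ : {within Rplus, continuous (fun t => (K *m Z t) 0 0)}.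
  move=> s; rewrite (_ : (fun t => _) = fun t => \sum_i K 0 i * Z t i 0); last first.
    by apply/funext => u; rewrite mxE.
  apply: cvg_sumr => i; apply: within_continuousM; last exact: continuous_Z.
  by move=> u; exact: cvg_cst.
have H := within_Rplus_continuous t0 cKZ.
rewrite /prop_for /continuous_at (v_feedback (ltW t0)).
refine (near_cvg_eq _ H).
have : \forall s \near t, 0 < s by exact: lt_nbhsr.
by apply: filterS => s s0; rewrite v_feedback// ltW.
Qed.

Lemma is_derive_coef (t : R) j : 0 < t -> t != D ->
  is_derive t 1 (fun s => coef (w s) j)
    (lam j * coef (w t) j + uD t * a_coef L c e j + v (t - D) * b_coef L e j
     + coef (d t) j).
Proof.
move=> t0 tD; have [y2 [y1 yy1 yy2] yd] := CL.2.2.1 t t0 tD.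
have dw := w_data (ltW t0) yy1 yy2.
have := is_derive_form_w (bounded_form_inner (Le j)) t0 tD yy1 yy2 yd (@continuous_v (t - D)).
by rewrite (op_coef L_gt0 c_Linfty e_eigen e_basis j dw).
Qed.

Lemma is_derive_X (t : R) i : 0 < t -> t != D ->
  is_derive t 1 (fun s => X s i 0)
    ((A *m X t + v (t - D) *: B + Gam (r t) (d t)) i 0).
Proof.
move=> t0 tD.
have [y2 [y1 yy1 yy2] yd] := CL.2.2.1 t t0 tD.
have cv := @continuous_v (t - D).
have dw := w_data (ltW t0) yy1 yy2.
rewrite /X_of mul_matA /matB /matB1 !scale_col_mx /Gam !add_col_mx.
elim/ord3_ind: i => [|j|].
- rewrite !col_mxEu (_ : (fun s => _) = uD); last by apply/funext => s; exact: X_uD.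
  apply: is_derive_eq (is_derive_uD tD cv) _.
  by rewrite !mxE add0r addr0 mulr1n mulr1.
- rewrite col_mxEu col_mxEd (_ : (fun s => _) = fun s => coef (w s) j); last by apply/funext => s; exact: X_w.
  apply: is_derive_eq (is_derive_coef j t0 tD) _; rewrite !mxE.
  by congr (_ + _ + _); rewrite addrC mulrC.
- rewrite col_mxEd (_ : (fun s => _) = fun s => z s - stable (w s)); last by apply/funext => s; exact: X_zeta.
  have dz : is_derive t 1 z (deriv_at0 (y t) - r t).
    by case: CL => _ [_ [_ [_ [_ [+ _]]]]]; exact.
  apply: is_derive_eq (is_deriveB dz (is_derive_form_w bounded_stable t0 tD yy1 yy2 yd cv)) _.
  have -> : deriv_at0 (y t) = deriv_at0 (w t) + uD t / L.
    have [dw1 dw2 _ _] := dw.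
    rewrite (deriv_at0_wderiv L_gt0 dw1 (wderiv_continuous L_gt0 dw2)).
    by rewrite (deriv_at0_wderiv L_gt0 yy1 (wderiv_continuous L_gt0 yy2)) subrK.
  (* The stable part of w_x(t,0) cancels the image of A w under the functional of zeta; a finite sum
     over the first n modes is left. *)
  rewrite (deriv_at0_stable L_gt0 c_Linfty e_eigen e_basis lam_decr lam_lt0 dw).
  rewrite !mxE !mulr1n /alpha /beta.
  rewrite -[stable_sum _ _ _ (a_coef _ _ _)]/(stable a_fun).
  rewrite -[stable_sum _ _ _ (b_coef _ _)]/(stable b_fun).
  by ring.
Qed.

(** The terms in v(t - D) cancel, and exp(-DA) B v(t) = exp(-DA) B K Z(t) closes the loop: the
    equation of Z has no delay left. *)
Lemma is_derive_Z (t : R) i : 0 < t -> t != D ->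
  is_derive t 1 (fun s => Z s i 0)
    ((matAK L D c e lam K *m Z t + Gam (r t) (d t)) i 0).
Proof.
move=> t0 tD; have cv := @continuous_v (t - D).
have dq := is_derive_window A B (ltW D_gt0) v_int v_neg i t0 tD (continuous_v t0) cv.
have dZ := is_deriveD (is_derive_X i t0 tD) dq.
rewrite (_ : (fun s => Z s i 0) = (fun s => X s i 0) + (fun s => window A B D v s i 0)); last first.
  by apply/funext => s; rewrite Z_window mxE.
apply: is_derive_eq dZ _.
have -> : matAK L D c e lam K *m Z t =
    A *m Z t + v t *: (expmx (- D *: A) *m B).
  rewrite /matAK mulmxDl -mulmxA [K *m Z t]mx11_scalar -v_feedback ?ltW//.
  by rewrite mul_mx_scalar.
rewrite Z_window mulmxDr.
move: B (A *m X t) (A *m window _ _ _ _ _) (expmx _ *m B) (Gam _ _) => b p q s g.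
by rewrite !mxE; ring.
Qed.

End ClosedLoop.

(** * The equilibrium *)

Section Equilibrium.
Context {R : realType} (L D : R) (c : R -> R) (e : nat -> R -> R)
  (lam : nat -> R) (n : nat) (K : 'rV[R]_(1 + n + 1)).
Hypotheses (e_basis : hilbert_basis L e)
  (lam_lt0 : forall j, (n <= j)%N -> lam j < 0)
  (AK_Hurwitz : Hurwitz (matAK L D c e lam K)).
Local Notation coef f j := (inner L f (e j)).
Local Notation A := (matA L c e lam n).
Local Notation B := (matB L e lam n).
Variables (re : R) (de : R -> R).
Local Notation Xe := (X_e L D c e lam K re de).
Local Notation ue := (u_e L D c e lam K re de).

Lemma Gamma_eE : Gamma_e L e lam n re de = Gam L e lam n re de.
Proof. by []. Qed.

Lemma cV3E (x : 'cV[R]_(1 + n + 1)) :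
  x = col_mx (col_mx (x (lshift 1 (lshift n 0)) 0)%:M
                     (\col_j x (lshift 1 (rshift 1 j)) 0))
             (x (rshift (1 + n) 0) 0)%:M.
Proof.
apply/colP; elim/ord3_ind => [|j|].
- by rewrite !col_mxEu [in RHS]mxE mulr1n.
- by rewrite col_mxEu col_mxEd [in RHS]mxE.
- by rewrite col_mxEd [in RHS]mxE mulr1n.
Qed.

Lemma u_eE : ue = Xe (lshift 1 (lshift n 0)) 0.
Proof. by rewrite /u_e !mxE. Qed.

Lemma zeta_eE : zeta_e L D c e lam K re de = Xe (rshift (1 + n) 0) 0.
Proof. by rewrite /zeta_e !mxE. Qed.

Lemma w_e_coefE (j : 'I_n) :
  w_e_coef L D c e lam K re de j = Xe (lshift 1 (rshift 1 j)) 0.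
Proof. by rewrite /w_e_coef valK !mxE. Qed.

Lemma matAK_X_e : matAK L D c e lam K *m Xe + Gam L e lam n re de = 0.
Proof.
by rewrite /X_e mulmxN mulmxA mulmxV ?Hurwitz_unitmx// mul1mx Gamma_eE addNr.
Qed.

Lemma matA_row0 j : A (lshift 1 (lshift n 0)) j = 0.
Proof.
by rewrite /matA block_mxEv col_mxEu /matA1 block_mxEv; elim/ord3_ind: j => [|j|];
  rewrite ?row_mxEl ?row_mxEr ?col_mxEu ?row_mxEl ?row_mxEr ?mxE.
Qed.

(* The first row of A, that of d(u_D)/dt = v_D, vanishes: the first equation  *)
(* of the equilibrium reads K X_e = 0.                                        *)
Lemma feedback_X_e : K *m Xe = 0.
Proof.
have := congr1 (fun M : 'cV[R]_(1 + n + 1) => M (lshift 1 (lshift n 0)) 0) matAK_X_e.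
rewrite /matAK mulmxDl -mulmxA [K *m Xe]mx11_scalar mul_mx_scalar /=.
rewrite ![(_ + _ : 'cV[R]_(1 + n + 1)) _ _]mxE [(0 : 'cV[R]_(1 + n + 1)) _ _]mxE.
rewrite [(A *m Xe) _ _]mxE big1 => [|j _]; last by rewrite matA_row0 mul0r.
rewrite add0r /Gam !col_mxEu [(0 : 'M[R]_(_, _)) _ _]mxE addr0 [(_ *: _ : 'cV[R]_(1 + n + 1)) _ _]mxE.
(* The first row of the exponential is that of the identity and the first entry of B is 1, so the
   first component of exp(-DA) B is 1. *)
rewrite [(expmx _ *m B) _ _]mxE (bigD1 (lshift 1 (lshift n 0)))//=.
rewrite (expmx_row matA_row0) eqxx mul1r big1 => [|j /negPf j0]; last first.
  by rewrite (expmx_row matA_row0) eq_sym j0 mul0r.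
rewrite addr0 /matB /matB1 !col_mxEu [(1%:M : 'M[R]_1) _ _]mxE mulr1 => KXe0.
by apply/matrixP => k j; rewrite [in RHS]mxE [k]ord1 [j]ord1 KXe0 mxE.
Qed.

Lemma matA_X_e : A *m Xe + Gam L e lam n re de = 0.
Proof.
have := matAK_X_e; rewrite /matAK mulmxDl -[_ *m B *m K *m Xe]mulmxA.
by rewrite feedback_X_e mulmx0 addr0.
Qed.

(** For j < n it is a row of A X_e + Gamma_e = 0, which holds because K X_e = 0; for the other modes
    it restates how w_(e,j) is chosen. *)
Lemma equilibrium_coef j :
  lam j * w_e_coef L D c e lam K re de j + a_coef L c e j * ue + coef de j = 0.
Proof.
have [jn|nj] := ltnP j n.
  have := w_e_coefE (Ordinal jn); have := matA_X_e.
  rewrite {1}[Xe]cV3E -u_eE mul_matA; move: Xe ue => x u.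
  move=> /(congr1 (fun M : 'cV[R]_(1 + n + 1) => M (lshift 1 (rshift 1 (Ordinal jn))) 0)).
  rewrite /Gam !add_col_mx col_mxEu col_mxEd !mxE /= => H ->.
  by rewrite -[RHS]H; congr (_ + _); rewrite addrC.
rewrite /w_e_coef insubF ?ltnNge ?nj//.
by field; rewrite lt_eqF// lam_lt0.
Qed.

(** Coefficients are continuous on L^2, and that of index j in a partial sum is constant once N >
    j. *)
Lemma coef_w_e we : is_w_e L D c e lam K re de we -> inL2 L we ->
  forall j, coef we j = w_e_coef L D c e lam K re de j.
Proof.
move=> [_ H] Lwe j; have Le i : inL2 L (e i) by case: e_basis.
set k := w_e_coef L D c e lam K re de in H *.
have LN N : inL2 L (fun x => we x - \sum_(0 <= j < N) k j * e j x).
  by apply: inL2B => //; apply: inL2_sum => i; exact: inL2Z.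
have Hc : coef (fun x => we x - \sum_(0 <= i < N) k i * e i x) j @[N --> \oo] --> 0.
  apply: (L2norm_cvg0_form (bounded_form_inner (Le j)) _ H).
  by near=> N; exact: LN.
have Hc' : coef we j - k j @[N --> \oo] --> 0.
  refine (near_cvg_eq _ Hc); near=> N.
  have jN : (j < N)%N by near: N; exact: nbhs_infty_gt.
  rewrite innerBl//; last by apply: inL2_sum => i; exact: inL2Z.
  congr (_ - _); rewrite (inner_comb e_basis)// big_mkord (bigD1 (Ordinal jN))//=.
  have ortho i i' : inner L (e i) (e i') = (i == i')%:R by case: e_basis.
  rewrite ortho eqxx mulr1 big1 ?addr0// => i.
  by rewrite ortho -val_eqE eq_sym => /negPf /= ->; rewrite mulr0.
have E : limn (fun _ => coef we j - k j) = 0 by exact: (cvg_lim (@Rhausdorff R) Hc').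
by apply/eqP; rewrite -subr_eq0 -E lim_cst.
Unshelve. all: by end_near. Qed.

End Equilibrium.

(** * Estimates along a trajectory *)

Section QuadraticForms.
Context {R : realType} (p m : nat) (S : 'M[R]_(p, m)) (x0 : 'cV[R]_m)
  (F : R -> 'cV[R]_m).

Let SE t i : (S *m (F t - x0)) i 0 = \sum_k S i k * (F t k 0 - x0 k 0).
Proof. by rewrite mxE; apply: eq_bigr => k _; rewrite !mxE. Qed.

Lemma is_derive_sqn (t : R) (dF : 'cV[R]_m) :
  (forall k, is_derive t 1 (fun s => F s k 0) (dF k 0)) ->
  is_derive t 1 (fun s => sqn (S *m (F s - x0)))
    (2 * dotc (S *m (F t - x0)) (S *m dF)).
Proof.
move=> FdF.
have dS i : is_derive t 1 (fun s => (S *m (F s - x0)) i 0) ((S *m dF) i 0).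
  rewrite (_ : (fun s => _) = fun s => \sum_k S i k * (F s k 0 - x0 k 0)); last first.
    by apply/funext => s; exact: SE.
  rewrite mxE; apply: is_derive_sumr => k.
  apply: is_derive_eq (is_deriveZ (S i k) (is_deriveB (FdF k) (is_derive_cst (x0 k 0) t (1 : R)))) _.
  by rewrite subr0.
apply: is_derive_eq (is_derive_sumr (fun i => is_deriveM (dS i) (dS i))) _.
rewrite /dotc mulr_sumr; apply: eq_bigr => i _.
by rewrite /GRing.scale/=; ring.
Qed.

Lemma within_continuous_sqn (P : set R) :
  (forall k, {within P, continuous (fun s => F s k 0)}) ->
  {within P, continuous (fun s => sqn (S *m (F s - x0)))}.
Proof.
move=> cF; have cS i : {within P, continuous (fun s => (S *m (F s - x0)) i 0)}.
  rewrite (_ : (fun s => _) = fun s => \sum_k S i k * (F s k 0 - x0 k 0)); last first.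
    by apply/funext => s; exact: SE.
  have cM k : {within P, continuous (fun s => S i k * (F s k 0 - x0 k 0))}.
    apply: within_continuousM; first by move=> s; exact: cvg_cst.
    by apply: within_continuousB; [exact: cF|move=> s; exact: cvg_cst].
  by move=> t; apply: cvg_sumr => k; exact: cM.
by rewrite /sqn /dotc => t; apply: cvg_sumr => i; exact: (within_continuousM (cS i) (cS i)).
Qed.

End QuadraticForms.

Section Estimates.
Context {R : realType} (L D : R) (c : R -> R) (e : nat -> R -> R)
  (lam : nat -> R) (n : nat) (K : 'rV[R]_(1 + n + 1)).
Hypotheses (L_gt0 : 0 < L) (D_gt0 : 0 < D) (c_Linfty : inLinfty L c)
  (e_eigen : forall j, opA L c (e j) (fun x => lam j * e j x))
  (e_basis : hilbert_basis L e)
  (lam_decr : forall i j, (i < j)%N -> lam j < lam i)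
  (lam_ge0 : forall j, (j < n)%N -> 0 <= lam j)
  (lam_lt0 : forall j, (n <= j)%N -> lam j < 0)
  (AK_Hurwitz : Hurwitz (matAK L D c e lam K)).
Local Notation coef f j := (inner L f (e j)).
Local Notation A := (matA L c e lam n).
Local Notation B := (matB L e lam n).
Local Notation AK := (matAK L D c e lam K).
Local Notation Xe := (X_e L D c e lam K).
Local Notation ue := (u_e L D c e lam K).
Local Notation zetae := (zeta_e L D c e lam K).
Local Notation uD := (uD_of D).
Local Notation w := (w_of L D).
Local Notation zeta := (zeta_of L D e lam n).
Local Notation X := (X_of L D e lam n).
Local Notation Z := (Z_of L D c e lam n).
Local Notation stable := (stable_form L e lam n).
Local Notation GamL := (Gam L e lam n).

Let Le j : inL2 L (e j). Proof. by case: e_basis. Qed.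

Let bounded_stable : bounded_form L stable.
Proof.
exact: (bounded_form_stable L_gt0 c_Linfty e_eigen e_basis lam_decr lam_lt0).
Qed.

Definition input_dev (re : R) (de : R -> R) (r : R -> R) (d : R -> R -> R) t : R :=
  (r t - re) ^+ 2 + inner L (fun x => d t x - de x) (fun x => d t x - de x).

Definition initial_dev re de (we : R -> R) y z v : R :=
  `|uD v 0 - ue re de| + `|zeta y z v 0 - zetae re de| +
  fine (H10norm L (fun x => w y v 0 x - we x)).

(* The weight g absorbs both the inputs and the memory of the initial state,  *)
(* so that all the estimates below take the form: square <= C * g t.          *)
Definition dominated theta re de we r d y z v g :=
  [/\ inL2 L de, is_w_e L D c e lam K re de we,
      forall t, 0 <= t -> inL2 L (d t),
      exists y0 z0, closed_loop L D c e lam K r d y0 z0 y z v &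
      [/\ slowly_decreasing theta g,
          forall t, 0 <= t -> input_dev re de r d t <= g t &
          forall t, 0 <= t -> initial_dev re de we y z v ^+ 2 * expR (- theta * t) <= g t]].

Lemma sqn3 (x : 'cV[R]_(1 + n + 1)) : sqn x =
  x (lshift 1 (lshift n 0)) 0 ^+ 2 + \sum_j x (lshift 1 (rshift 1 j)) 0 ^+ 2
  + x (rshift (1 + n) 0) 0 ^+ 2.
Proof.
rewrite /sqn /dotc !big_split_ord/= !big_ord1 !expr2.
by under [in RHS]eq_bigr do rewrite expr2.
Qed.

Lemma sqn3B (x x' : 'cV[R]_(1 + n + 1)) : sqn (x - x') =
  (x (lshift 1 (lshift n 0)) 0 - x' (lshift 1 (lshift n 0)) 0) ^+ 2 +
  \sum_j (x (lshift 1 (rshift 1 j)) 0 - x' (lshift 1 (rshift 1 j)) 0) ^+ 2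
  + (x (rshift (1 + n) 0) 0 - x' (rshift (1 + n) 0) 0) ^+ 2.
Proof. by rewrite sqn3 !mxE; under eq_bigr do rewrite !mxE. Qed.

Lemma GamB r1 d1 r2 d2 : inL2 L d1 -> inL2 L d2 ->
  GamL r1 d1 - GamL r2 d2 = GamL (r1 - r2) (fun x => d1 x - d2 x).
Proof.
move=> Ld1 Ld2; rewrite /Gam !opp_col_mx !add_col_mx; congr (col_mx (col_mx _ _) _).
- by rewrite subrr.
- by apply/colP => j; rewrite !mxE innerBl.
- have [SD SZ _] := bounded_stable.
  have -> : stable (fun x => d1 x - d2 x) = stable d1 - stable d2.
    rewrite -mulN1r -SZ// -SD//; last exact: inL2Z.
    by congr stable_form; apply/funext => x; rewrite mulN1r.
  by rewrite -raddfB/=; congr (_%:M); ring.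
Qed.

Lemma Gam_bound : exists2 C, 0 < C & forall a f, inL2 L f ->
  sqn (GamL a f) <= C * (a ^+ 2 + inner L f f).
Proof.
have [_ _ [Phi HPhi]] := bounded_stable.
(* The modes cost |f|^2 by Bessel, the last component at most 2 a^2 + 2 |Phi| |f|^2. *)
exists (3 + 2 * `|Phi|) => [|a f Lf]; first by rewrite ltr_wpDr ?mulr_ge0.
rewrite sqn3 /Gam.
under eq_bigr do rewrite col_mxEu col_mxEd mxE.
rewrite !col_mxEu col_mxEd ![_ 0 0]mxE mulr1n expr0n add0r.
have H1 : \sum_(j < n) coef f j ^+ 2 <= inner L f f.
  by have := bessel e_basis n Lf; rewrite big_mkord.
have H2 : (- a - stable f) ^+ 2 <= 2 * a ^+ 2 + 2 * stable f ^+ 2.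
  have := sqr_ge0 (a - stable f); nra.
have H3 : stable f ^+ 2 <= `|Phi| * inner L f f.
  by apply: (le_trans (HPhi f Lf)); rewrite ler_wpM2r ?inner_ge0// ler_norm.
have := sqr_ge0 a; have := inner_ge0 L f; have := normr_ge0 Phi; nra.
Qed.

Section Trajectory.
Variables (theta re : R) (de we r : R -> R) (d y : R -> R -> R) (z v g : R -> R).
Hypothesis dom : dominated theta re de we r d y z v g.
Local Notation init := (initial_dev re de we y z v).

Lemma inL2_we : inL2 L we.
Proof.
case: dom => _ [/inDA_data[w1 [w2 dw]] _] _ _ _.
by have [] := dirichlet_data_inL2 L_gt0 dw.
Qed.

Lemma dev_data t : 0 <= t -> exists w1 w2,
  dirichlet_data L (fun x => w y v t x - we x) w1 w2.
Proof.
case: dom => _ [/inDA_data[w1 [w2 dw]] _] _ [y0 [z0 CL]] _ t0.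
have [v1 [v2 dv]] := w_data_ex L_gt0 CL t0.
by exists (fun x => v1 x - w1 x), (fun x => v2 x - w2 x); exact: dirichlet_dataB.
Qed.

Lemma inL2_w t : 0 <= t -> inL2 L (w y v t).
Proof.
case: dom => _ _ _ [y0 [z0 CL]] _ t0.
have [v1 [v2 dv]] := w_data_ex L_gt0 CL t0.
by have [] := dirichlet_data_inL2 L_gt0 dv.
Qed.

Lemma coef_dev t j : 0 <= t -> coef (fun x => w y v t x - we x) j =
  coef (w y v t) j - w_e_coef L D c e lam K re de j.
Proof.
move=> t0; case: dom => _ we_def _ _ _.
rewrite -(coef_w_e e_basis we_def inL2_we) innerBl//; last exact: inL2_we.
exact: inL2_w.
Qed.

Lemma X_dev0 t : X y z v t (lshift 1 (lshift n 0)) 0 - Xe re de (lshift 1 (lshift n 0)) 0 =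
  uD v t - ue re de.
Proof. by rewrite X_uD -u_eE. Qed.

Lemma X_dev1 t j : 0 <= t ->
  X y z v t (lshift 1 (rshift 1 j)) 0 - Xe re de (lshift 1 (rshift 1 j)) 0 =
  coef (fun x => w y v t x - we x) j.
Proof. by move=> t0; rewrite X_w coef_dev// w_e_coefE. Qed.

Lemma X_dev2 t : X y z v t (rshift (1 + n) 0) 0 - Xe re de (rshift (1 + n) 0) 0 =
  zeta y z v t - zetae re de.
Proof. by rewrite X_zeta -zeta_eE. Qed.

Lemma initial_devE w1 w2 : dirichlet_data L (fun x => w y v 0 x - we x) w1 w2 ->
  init = `|uD v 0 - ue re de| + `|zeta y z v 0 - zetae re de| + Num.sqrt (inner L w1 w1).
Proof. by move=> [ww1 w12 _ _]; rewrite /initial_dev (H10normE L_gt0 ww1 w12). Qed.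

Lemma init_ge0 : 0 <= init.
Proof.
have [w1 [w2 dw]] := dev_data (lexx 0); rewrite (initial_devE dw).
by rewrite !addr_ge0// sqrtr_ge0.
Qed.

Lemma initial_sqr w1 w2 : dirichlet_data L (fun x => w y v 0 x - we x) w1 w2 ->
  (uD v 0 - ue re de) ^+ 2 + (zeta y z v 0 - zetae re de) ^+ 2 + inner L w1 w1 <= init ^+ 2.
Proof.
move=> dw; rewrite (initial_devE dw).
rewrite -[X in X + _ + _]real_normK ?num_real// -[X in _ + X + _]real_normK ?num_real//.
rewrite -{1}[inner L w1 w1]sqr_sqrtr ?inner_ge0//.
have := normr_ge0 (uD v 0 - ue re de); have := normr_ge0 (zeta y z v 0 - zetae re de).
have := sqrtr_ge0 (inner L w1 w1).
move: `|_| `|_| (Num.sqrt _) => a b k k0 b0 a0; nra.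
Qed.

Lemma initial_Z : sqn (Z y z v 0 - Xe re de) <= (1 + L ^+ 2) * init ^+ 2.
Proof.
have [w1 [w2 dw]] := dev_data (lexx 0); have i2 := initial_sqr dw.
case: dom => _ _ _ [y0 [z0 CL]] _.
(* Z(0) = X(0); the modal part of its deviation is bounded through Bessel and Poincare by L^2 times
   the squared H^1_0 norm. *)
rewrite Z_window window0 ?addr0//; [|exact: ltW|exact: v_int CL|exact: v_neg CL].
rewrite sqn3B X_dev0 X_dev2.
under eq_bigr do rewrite X_dev1//.
have [Ldw _] := dirichlet_data_inL2 L_gt0 dw.
have := bessel e_basis n Ldw; rewrite big_mkord.
have [ww1 _ dw0 _] := dw; have := poincare L_gt0 ww1 dw0.
have := inner_ge0 L w1; have := sqr_ge0 L.
have := sqr_ge0 (uD v 0 - ue re de); have := sqr_ge0 (zeta y z v 0 - zetae re de).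
move: i2; move: (_ ^+ 2) (_ ^+ 2) (L ^+ 2) (inner L w1 w1) (inner L _ _) (\sum_(_ < _) _) (init ^+ 2).
move=> a b l I J s i; nra.
Qed.

Lemma g_ge0 t : 0 <= t -> 0 <= g t.
Proof. by case: dom => _ _ _ _ [[+ _] _ _] t0; exact. Qed.

End Trajectory.

(** theta is quantified after sigma because it must also lie below - lam_n, and before C, which
    depends on the gap sigma - theta. *)
Lemma Z_estimate : exists2 sigma, 0 < sigma & forall theta, 0 < theta -> theta < sigma ->
  exists2 C, 0 < C & forall re de we r d y z v g,
    dominated theta re de we r d y z v g ->
    forall t, 0 <= t -> sqn (Z y z v t - Xe re de) <= C * g t.
Proof.
have n0 : (0 < 1 + n + 1)%N by rewrite addn1.
have [S [N [s [s0 NS Lyap]]]] := Hurwitz_lyapunov n0 AK_Hurwitz.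
have [CS CS0 HS] := sqn_mulmx S; have [CN CN0 HN] := sqn_mulmx N.
have [CG CG0 HG] := Gam_bound.
(* Half of the Lyapunov rate is spent on absorbing the forcing by Young's inequality; the other half
   remains as decay rate. *)
exists (s / 2) => [|theta th0 ths]; first by rewrite divr_gt0.
have gap : 0 < s / 2 - theta by rewrite subr_gt0.
pose C1 := (s / 2)^-1 * (CS * CG).
have C10 : 0 < C1 by rewrite mulr_gt0 ?invr_gt0 ?divr_gt0// mulr_gt0.
pose C2 := CS * (1 + L ^+ 2) + C1 / (s / 2 - theta).
have C20 : 0 < C2.
  by rewrite addr_gt0 ?divr_gt0// mulr_gt0// ltr_pwDl// sqr_ge0.
exists (CN * C2) => [|re de we r d y z v g dom t t0]; first exact: mulr_gt0.
have := dom => -[Lde we_def Ld [y0 [z0 CL]] [slow inp ini]].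
pose V s := sqn (S *m (Z y z v s - Xe re de)).
have cV : {within Rplus, continuous V}.
  apply: within_continuous_sqn => k.
  exact: (continuous_Z L_gt0 D_gt0 c_Linfty e_eigen e_basis lam_decr lam_lt0 CL).
have dV (u : R) : 0 < u -> u != D -> is_derive u 1 V
    (2 * dotc (S *m (Z y z v u - Xe re de)) (S *m (AK *m Z y z v u + GamL (r u) (d u)))).
  move=> u0 uneD; apply: is_derive_sqn => k.
  exact: (is_derive_Z L_gt0 D_gt0 c_Linfty e_eigen e_basis lam_decr lam_lt0 Ld CL).
have dVle (u : R) : 0 < u -> u != D ->
    2 * dotc (S *m (Z y z v u - Xe re de)) (S *m (AK *m Z y z v u + GamL (r u) (d u)))
    <= - (s / 2) * V u + C1 * g u.
  move=> u0 _; have Ldu := Ld _ (ltW u0).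
  (* Subtracting the equilibrium equation leaves only deviations. *)
  have -> : AK *m Z y z v u + GamL (r u) (d u) =
      AK *m (Z y z v u - Xe re de) + (GamL (r u) (d u) - GamL re de).
    have := matAK_X_e AK_Hurwitz re de => /eqP; rewrite addr_eq0 => /eqP E.
    by rewrite mulmxBr E opprK addrACA subrr addr0.
  rewrite mulmxDr dotcDr mulrDr GamB//.
  have s20 : 0 < s / 2 by rewrite divr_gt0.
  have Lg := inL2B Ldu Lde.
  have h1 := Lyap (Z y z v u - Xe re de).
  have h2 := dotc_young (S *m (Z y z v u - Xe re de))
    (S *m GamL (r u - re) (fun x => d u x - de x)) s20.
  have h3 := HS (GamL (r u - re) (fun x => d u x - de x)).
  have h4 := HG (r u - re) _ Lg.
  have h5 : (s / 2)^-1 * sqn (S *m GamL (r u - re) (fun x => d u x - de x)) <= C1 * g u.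
    rewrite /C1 -mulrA ler_wpM2l ?invr_ge0 ?(ltW s20)//.
    apply: (le_trans h3); rewrite -mulrA ler_wpM2l ?(ltW CS0)//.
    by apply: (le_trans h4); rewrite ler_wpM2l ?(ltW CG0)//; exact: inp (ltW u0).
  rewrite /V; lra.
have VT := gronwall_weight (ltW C10) ths slow cV dV dVle t0.
have E : Z y z v t - Xe re de = N *m (S *m (Z y z v t - Xe re de)).
  by rewrite mulmxA NS mul1mx.
rewrite E -mulrA; apply: (le_trans (HN _)); rewrite ler_wpM2l ?(ltW CN0)//.
rewrite -/(V t); apply: (le_trans VT); rewrite /C2 mulrDl lerD2r.
have V0 : V 0 <= CS * ((1 + L ^+ 2) * initial_dev re de we y z v ^+ 2).
  apply: (le_trans (HS _)); rewrite ler_wpM2l ?(ltW CS0)//; exact: initial_Z dom.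
apply: (@le_trans _ _ (expR (- theta * t) * (CS * ((1 + L ^+ 2) * initial_dev re de we y z v ^+ 2)))).
  refine (ler_pM (expR_ge0 _) (sqn_ge0 _) _ V0).
  by rewrite ler_expR ler_wpM2r// lerN2 ltW.
have -> : expR (- theta * t) * (CS * ((1 + L ^+ 2) * initial_dev re de we y z v ^+ 2)) =
   CS * (1 + L ^+ 2) * (initial_dev re de we y z v ^+ 2 * expR (- theta * t)) by ring.
rewrite ler_wpM2l//; last exact: ini.
by rewrite mulr_ge0 ?(ltW CS0)// addr_ge0// sqr_ge0.
Qed.

Lemma v_estimate theta CZ : 0 < CZ -> exists2 C, 0 < C & forall re de we r d y z v g,
  dominated theta re de we r d y z v g ->
  (forall t, 0 <= t -> sqn (Z y z v t - Xe re de) <= CZ * g t) ->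
  forall t, 0 <= t -> v t ^+ 2 <= C * g t.
Proof.
move=> CZ0; have [CK CK0 HK] := sqn_mulmx K.
exists (CK * CZ) => [|re de we r d y z v g dom HZ t t0]; first exact: mulr_gt0.
case: dom => _ _ _ [y0 [z0 CL]] _.
(* As K X_e = 0, the control is K applied to the deviation of Z, without any offset. *)
have -> : v t ^+ 2 = sqn (K *m (Z y z v t - Xe re de)).
  rewrite mulmxBr (feedback_X_e AK_Hurwitz) subr0 (v_feedback CL t0).
  by rewrite /sqn /dotc big_ord1 expr2.
by rewrite -mulrA (le_trans (HK _))// ler_wpM2l ?(ltW CK0)//; exact: HZ.
Qed.

(** Slow decrease is what makes the delay harmless: g s <= exp(theta D) g t for s in [t - D, t], and
    v vanishes at negative times. *)
Lemma delayed_v_estimate theta Cv re de we r d y z v g : 0 < Cv -> 0 <= theta ->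
  dominated theta re de we r d y z v g ->
  (forall t, 0 <= t -> v t ^+ 2 <= Cv * g t) ->
  forall t s, 0 <= t -> t - D <= s <= t -> v s ^+ 2 <= Cv * expR (theta * D) * g t.
Proof.
move=> Cv0 th0 dom Hv t s t0 /andP[ts st].
case: dom => _ _ _ [y0 [z0 CL]] [[g0 slow] _ _].
have [s0|s0] := ltP s 0.
  rewrite (v_neg CL s0) expr0n/= mulr_ge0 ?g0// mulr_ge0 ?expR_ge0// ltW//.
apply: (le_trans (Hv s s0)); rewrite -mulrA ler_wpM2l ?(ltW Cv0)//.
apply: (le_trans (slow s t s0 st)); rewrite ler_wpM2r ?g0//.
by rewrite ler_expR ler_wpM2l//; lra.
Qed.

Lemma X_estimate theta CZ Cv : 0 < CZ -> 0 < Cv -> 0 <= theta ->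
  exists2 C, 0 < C & forall re de we r d y z v g,
  dominated theta re de we r d y z v g ->
  (forall t, 0 <= t -> sqn (Z y z v t - Xe re de) <= CZ * g t) ->
  (forall t, 0 <= t -> v t ^+ 2 <= Cv * g t) ->
  forall t i, 0 <= t -> (X y z v t i 0 - Xe re de i 0) ^+ 2 <= C * g t.
Proof.
move=> CZ0 Cv0 th0; have [M M0 HM] := window_bound A B (ltW D_gt0).
pose Cd := Cv * expR (theta * D).
have Cd0 : 0 < Cd by rewrite mulr_gt0// expR_gt0.
exists (2 * CZ + 2 * (M ^+ 2 * Cd)) => [|re de we r d y z v g dom HZ Hv t i t0].
  by apply: addr_gt0; apply: mulr_gt0 => //; apply: mulr_gt0 => //; exact: exprn_gt0.
have Hd := delayed_v_estimate Cv0 th0 dom Hv t0.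
have g0 := g_ge0 dom t0.
case: dom => _ _ _ [y0 [z0 CL]] _.
have Hw : window A B D v t i 0 ^+ 2 <= M ^+ 2 * (Cd * g t).
  have iv := integrable_zero_neg (@v_int _ _ _ _ _ _ _ _ _ _ _ _ _ _ _ CL) (@v_neg _ _ _ _ _ _ _ _ _ _ _ _ _ _ _ CL) (t - D) t.
  have vb s : t - D <= s <= t -> `|v s| <= Num.sqrt (Cd * g t).
    by move=> sI; rewrite -sqrtr_sqr ler_wsqrtr//; exact: Hd.
  have := HM v t (Num.sqrt (Cd * g t)) iv vb i.
  rewrite -[window _ _ _ _ _ _ _ ^+ 2]real_normK ?num_real// => H.
  have Cg0 : 0 <= Cd * g t by rewrite mulr_ge0// ltW.
  rewrite -[X in _ <= _ * X]sqr_sqrtr// -exprMn ler_pXn2r ?nnegrE//.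
  by rewrite mulr_ge0 ?sqrtr_ge0// ltW.
have H1 : (Z y z v t i 0 - Xe re de i 0) ^+ 2 <= CZ * g t.
  have := sqr_le_sqn (Z y z v t - Xe re de) i; rewrite [in leLHS]mxE [X in _ + X]mxE.
  by move=> H; exact: le_trans H (HZ t t0).
have -> : X y z v t i 0 = Z y z v t i 0 - window A B D v t i 0.
  by rewrite Z_window [in RHS]mxE addrK.
move: H1 Hw; move: (Z _ _ _ _ _ _) (Xe _ _ _ _) (window _ _ _ _ _ _ _) => a b q H1 Hw.
have := sqr_ge0 ((a - b) + q); nra.
Qed.

(** The functional is - lam_j times the squared deviation, summed over n <= j < N. Its derivative
    loses 2 lam_j^2 o^2 per mode, half of which absorbs the forcing; the factor - lam_j thus turns
    an L^2 bound of the forcing into an H^1_0 bound of w, and Bessel makes it uniform in N. *)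
Lemma w_estimate theta Cx Cv : 0 < Cx -> 0 < Cv -> 0 <= theta -> theta < - lam n ->
  exists2 C, 0 < C & forall re de we r d y z v g,
  dominated theta re de we r d y z v g ->
  (forall t, 0 <= t -> v t ^+ 2 <= Cv * g t) ->
  (forall t i, 0 <= t -> (X y z v t i 0 - Xe re de i 0) ^+ 2 <= Cx * g t) ->
  forall t w1 w2, 0 <= t -> dirichlet_data L (fun x => w y v t x - we x) w1 w2 ->
  inner L w1 w1 <= C * g t.
Proof.
move=> Cx0 Cv0 th0 th_mu.
have [C1 C10 HC1] := energy_lower L_gt0 c_Linfty e_eigen e_basis lam_ge0 lam_lt0.
have [C2 C20 HC2] := energy_upper L_gt0 c_Linfty e_eigen e_basis lam_decr lam_ge0 lam_lt0.
have mu0 : 0 < - lam n by rewrite oppr_gt0 lam_lt0.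
have gap : 0 < - lam n - theta by rewrite subr_gt0.
pose fa := fun x : R => x / L * c x; pose fb := fun x : R => - (x / L).
have La : inL2 L fa by exact: inL2_a_fun.
have Lb : inL2 L fb by exact: inL2_b_fun.
pose Cd := Cv * expR (theta * D).
have Cd0 : 0 < Cd by rewrite mulr_gt0// expR_gt0.
(* [innerD_le] is applied twice, whence 4 = 2 * 2 for the terms in a and b and 2 for the
   disturbance. *)
pose CF := 4 * (Cx * inner L fa fa + Cd * inner L fb fb) + 2.
have CF0 : 0 < CF.
  by rewrite ltr_wpDl// mulr_ge0// addr_ge0// mulr_ge0 ?inner_ge0// ltW.
pose CV := C1 + CF / (- lam n - theta).
have CV0 : 0 < CV by rewrite addr_gt0// divr_gt0.
exists (C2 * (n%:R * Cx + CV)) => [|re de we r d y z v g dom Hv HX t w1 w2 t0 dw].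
  by rewrite mulr_gt0// ltr_wpDl// mulr_ge0// ltW.
have := dom => -[Lde we_def Ld [y0 [z0 CL]] [slow inp ini]].
have g0 s : 0 <= s -> 0 <= g s by move=> ?; exact: (g_ge0 dom).
(* The forcing of the deviation w - w_e. The delayed control enters without offset because its
   equilibrium value K X_e is 0. *)
pose F s x := ((uD v s - ue re de) * fa x + v (s - D) * fb x) + (d s x - de x).
have LF s : 0 <= s -> inL2 L (F s).
  move=> s0; apply: inL2D; first by apply: inL2D; exact: inL2Z.
  by apply: inL2B => //; exact: Ld.
have coefF s j : 0 <= s -> coef (F s) j = (uD v s - ue re de) * a_coef L c e j
    + v (s - D) * b_coef L e j + (coef (d s) j - coef de j).
  move=> s0; have Lds := Ld s s0.
  have L1 := inL2Z (uD v s - ue re de) La; have L2 := inL2Z (v (s - D)) Lb.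
  rewrite (innerDl (inL2D L1 L2) (inL2B Lds Lde) (Le j)) (innerDl L1 L2 (Le j)).
  by rewrite (innerBl Lds Lde (Le j)) (innerZl _ La (Le j)) (innerZl _ Lb (Le j)).
have HF s : 0 <= s -> inner L (F s) (F s) <= CF * g s.
  move=> s0; have Lds := Ld s s0.
  have L1 := inL2Z (uD v s - ue re de) La; have L2 := inL2Z (v (s - D)) Lb.
  have h1 := innerD_le (inL2D L1 L2) (inL2B Lds Lde); have h2 := innerD_le L1 L2.
  rewrite (innerZl _ La L1) (innerZr _ La La) (innerZl _ Lb L2) (innerZr _ Lb Lb) in h2.
  have h3 : inner L (fun x => d s x - de x) (fun x => d s x - de x) <= g s.
    by apply: le_trans (inp s s0); rewrite lerDr sqr_ge0.
  have h4 : (uD v s - ue re de) ^+ 2 <= Cx * g s by rewrite -(X_dev0 re de y z); exact: HX.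
  have h5 : v (s - D) ^+ 2 <= Cd * g s.
    by apply: (delayed_v_estimate Cv0 th0 dom Hv s0); rewrite lexx/= gerBl ltW.
  have h6 := ler_wpM2r (inner_ge0 L fa) h4; have h7 := ler_wpM2r (inner_ge0 L fb) h5.
  apply: (le_trans h1); apply: (@le_trans _ _ (2 * (2 * (Cx * g s * inner L fa fa +
    Cd * g s * inner L fb fb) + g s))); last by rewrite /CF; lra.
  rewrite ler_wpM2l// lerD//; apply: (le_trans h2); rewrite ler_wpM2l// lerD//.
    by rewrite mulrA -expr2.
  by rewrite mulrA -expr2.
pose om j s := coef (w y v s) j - w_e_coef L D c e lam K re de j.
have omE j s : 0 <= s -> coef (fun x => w y v s x - we x) j = om j s.
  by move=> s0; exact: (coef_dev dom).
have dom_ j (s : R) : 0 < s -> s != D ->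
    is_derive s 1 (om j) (lam j * om j s + coef (F s) j).
  move=> s0 sD.
  have ds := is_derive_coef L_gt0 D_gt0 c_Linfty e_eigen e_basis lam_decr lam_lt0 Ld CL j s0 sD.
  apply: is_derive_eq (is_deriveB ds (is_derive_cst _ s (1 : R))) _.
  rewrite subr0 coefF ?ltW// /om.
  have := equilibrium_coef lam_lt0 AK_Hurwitz re de j; lra.
have c_om j : {within Rplus, continuous (om j)}.
  apply: within_continuousB; last by move=> s; exact: cvg_cst.
  exact: (continuous_form_w L_gt0 CL (bounded_form_inner (Le j))).
have HN N : \sum_(n <= j < N) (- lam j * om j t ^+ 2) <= CV * g t.
  (* The index is shifted by n so that the sum runs over an ordinal type, as in [is_derive_sumr]. *)
  pose V s := \sum_(k < N - n) (- lam (k + n)%N * om (k + n)%N s ^+ 2).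
  have shift (G : nat -> R) : \sum_(n <= j < N) G j = \sum_(k < N - n) G (k + n)%N.
    by rewrite -{1}[n]add0n big_addn big_mkord.
  have VE s : \sum_(n <= j < N) (- lam j * om j s ^+ 2) = V s by exact: shift.
  pose dV s := \sum_(k < N - n) (- lam (k + n)%N * (2 * om (k + n)%N s *
    (lam (k + n)%N * om (k + n)%N s + coef (F s) (k + n)%N))).
  have cV : {within Rplus, continuous V}.
    have cM k : {within Rplus, continuous (fun s => - lam (k + n)%N * om (k + n)%N s ^+ 2)}.
      apply: within_continuousM; first by move=> u; exact: cvg_cst.
      exact: (within_continuousM (c_om _) (c_om _)).
    by move=> s; apply: cvg_sumr => k; exact: cM.
  have dV_ (s : R) : 0 < s -> s != D -> is_derive s 1 V (dV s).
    move=> s0 sD; apply: is_derive_sumr => k.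
    have dk := dom_ (k + n)%N s s0 sD.
    apply: is_derive_eq (is_deriveZ (- lam (k + n)%N) (is_deriveM dk dk)) _.
    by rewrite /GRing.scale/=; ring.
  have dVle (s : R) : 0 < s -> s != D -> dV s <= - (- lam n) * V s + CF * g s.
    move=> s0 _; apply: (@le_trans _ _ (- (- lam n) * V s + inner L (F s) (F s))); last first.
      by rewrite lerD2l; apply: HF; exact: ltW.
    apply: (@le_trans _ _ (- (- lam n) * V s + \sum_(k < N - n) coef (F s) (k + n)%N ^+ 2)); last first.
      rewrite lerD2l; apply: le_trans (bessel e_basis N (LF s (ltW s0))).
      rewrite -(shift (fun j => coef (F s) j ^+ 2)).
      rewrite big_geq_mkord big_mkord big_mkcond; apply: ler_sum => j _ /=.
      by case: ifP; rewrite ?sqr_ge0.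
    rewrite /V mulr_sumr -big_split/=; apply: ler_sum => k _.
    have lk : - lam n <= - lam (k + n)%N.
      have : (n <= k + n)%N by exact: leq_addl.
      by rewrite leq_eqVlt => /predU1P[<-//|nk]; rewrite lerN2 ltW// lam_decr.
    move: (om _ _) (coef _ _) => o f.
    have m0 : 0 <= - lam (k + n)%N by exact: le_trans (ltW mu0) lk.
    move: lk m0; move: (lam (k + n)%N) (lam n) => l l' lk m0.
    (* The square gives - 2 l o f <= l^2 o^2 + f^2, which leaves - l^2 o^2 + f^2; then l^2 o^2 is at
       least - lam_n times - l o^2. *)
    have h1 := sqr_ge0 (l * o + f).
    have h2 : - l' * (- l * o ^+ 2) <= l ^+ 2 * o ^+ 2.
      by rewrite mulrA ler_wpM2r ?sqr_ge0//; nra.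
    nra.
  have := gronwall_weight (ltW CF0) th_mu slow cV dV_ dVle t0; rewrite VE => VT.
  apply: (le_trans VT); rewrite /CV [leRHS]mulrDl lerD2r.
  have [v1 [v2 dv]] := dev_data dom (lexx 0).
  have V0 : V 0 <= C1 * initial_dev re de we y z v ^+ 2.
    rewrite -VE; under eq_bigr do rewrite -omE//.
    apply: (le_trans (HC1 _ _ _ N dv)); rewrite ler_wpM2l ?(ltW C10)//.
    refine (le_trans _ (initial_sqr re de z dv)); rewrite lerDr; apply: addr_ge0; exact: sqr_ge0.
  have V00 : 0 <= V 0.
    apply: sumr_ge0 => k _; rewrite mulr_ge0 ?sqr_ge0// oppr_ge0 ltW// lam_lt0//.
    exact: leq_addl.
  apply: (@le_trans _ _ (expR (- theta * t) * (C1 * initial_dev re de we y z v ^+ 2))).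
    refine (ler_pM (expR_ge0 _) V00 _ V0).
    by rewrite ler_expR ler_wpM2r// lerN2 ltW.
  rewrite mulrCA ler_wpM2l ?(ltW C10)// mulrC; exact: ini.
have HN' N : \sum_(n <= j < N) (- lam j * coef (fun x => w y v t x - we x) j ^+ 2) <= CV * g t.
  by under eq_bigr do rewrite omE//; exact: HN.
apply: (le_trans (HC2 _ _ _ _ dw HN')); rewrite -mulrA ler_wpM2l ?(ltW C20)//.
rewrite [leRHS]mulrDl lerD2r -mulrA mulr_natl -[X in _ *+ X]card_ord -sumr_const.
apply: ler_sum => j _; rewrite -(X_dev1 dom)//; exact: HX.
Qed.

End Estimates.

(** * Sup bounds of the norms and continuity of the inputs *)

Section Norms.
Context {R : realType} (L : R).
Hypothesis L_gt0 : 0 < L.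
Local Notation mu := (@lebesgue_measure R).
Local Notation I := (`]0, L[%classic : set R).

Let mI : measurable (I : set (measurableTypeR R)). Proof. exact: measurable_itv. Qed.

Lemma Linftynorm_le (f : R -> R) M : 0 <= M ->
  (forall x, x \in `]0, L[ -> `|f x| <= M) -> (Linftynorm L f <= M%:E)%E.
Proof.
move=> M0 fM; rewrite /Linftynorm unlock; case: ifP => _; last by rewrite lee_fin.
apply/ess_supP/nearW => x /=; rewrite patchE lee_fin; case: ifP => [/set_mem|_]; first exact: fM.
by rewrite normr0.
Qed.

Lemma L2norm_le (f : R -> R) M : inL2 L f -> 0 <= M ->
  (forall x, x \in `]0, L[ -> `|f x| <= M) -> (L2norm L f <= (Num.sqrt L * M)%:E)%E.
Proof.
move=> Lf M0 fM; rewrite L2normE// lee_fin.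
rewrite -[X in _ * X](ger0_norm M0) -sqrtr_sqr -sqrtrM ?(ltW L_gt0)// ler_wsqrtr//.
apply: (@le_trans _ _ (\int[mu]_(x in I) (M ^+ 2))).
  apply: le_Rintegral => //; first exact: integrable_inL2M.
    exact: (inL2_integrable (inL2_cst L _)).
  move=> x xI; rewrite -expr2 -[f x ^+ 2]real_normK ?num_real//.
  by rewrite ler_pXn2r ?nnegrE//; exact: fM.
by rewrite Rintegral_cst//= lebesgue_measure_itv/= lte_fin L_gt0 /= subr0 mulrC.
Qed.

(** Near t the difference quotient stays bounded in L^2, so F is Lipschitz at t. *)
Lemma L2_is_derive_continuous (F : R -> R -> R) (t : R) g : 0 <= t ->
  (forall s, 0 <= s -> inL2 L (F s)) -> inL2 L g -> L2_is_derive L F t g ->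
  L2norm L (F s \- F t) @[s --> within Rplus (nbhs t)] --> 0%E.
Proof.
move=> t0 LF Lg dF; pose q s x := (F s x - F t x) / (s - t).
have LFB s : 0 <= s -> inL2 L (fun x => F s x - F t x) by move=> s0; apply: inL2B; exact: LF.
have Lq s : 0 <= s -> inL2 L (q s).
  by move=> s0; rewrite /q; under eq_fun do rewrite mulrC; apply: inL2Z; exact: LFB.
have Lqg : \forall s \near within Rplus t^', inL2 L (fun x => q s x - g x).
  by rewrite near_withinE; near=> s => s0; apply: inL2B => //; exact: Lq.
(* The quotient q is (q - g) + g with |q - g|^2 < 1 near t, so |q|^2 <= 2 (1 + |g|^2). *)
pose M := Num.sqrt (2 * (1 + inner L g g)).
have H : \forall s \near within Rplus (nbhs t),
    (L2norm L (F s \- F t)%R <= (M * `|s - t|)%:E)%E.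
  have q0 : inner L (fun x => q s x - g x) (fun x => q s x - g x)
      @[s --> within Rplus t^'] --> 0 by exact: (L2norm_cvg0_inner Lqg dF).
  move/cvgrPdist_lt/(_ 1 ltr01): q0.
  rewrite !near_withinE; apply: filterS => s H s0.
  have -> : F s \- F t = fun x => (s - t) * q s x.
    apply/funext => x; rewrite /q /=; have [->|st] := eqVneq s t.
      by rewrite !subrr mul0r.
    by rewrite mulrC divfK// subr_eq0.
  rewrite L2normE; last by apply: inL2Z; exact: Lq.
  have Lq_s := Lq s s0.
  rewrite (innerZl _ Lq_s (inL2Z _ Lq_s)) (innerZr _ Lq_s Lq_s) mulrA -expr2.
  rewrite sqrtrM ?sqr_ge0// sqrtr_sqr mulrC lee_fin ler_wpM2r//.
  (* At s = t, which the punctured filter does not cover, the quotient is 0 by the convention on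
     division by 0. *)
  have [->|st] := eqVneq s t.
    have -> : q t = fun _ => 0 by apply/funext => x; rewrite /q !subrr mul0r.
    by rewrite inner0l sqrtr0 sqrtr_ge0.
  have := H st s0; rewrite sub0r normrN ger0_norm ?inner_ge0// => {}H.
  apply: ler_wsqrtr; have Lqgs := inL2B Lq_s Lg.
  have := innerD_le Lqgs Lg; under eq_fun do rewrite subrK.
  by move/le_trans; apply; rewrite ler_wpM2l// lerD2r ltW.
have H0 : \forall s \near within Rplus (nbhs t),
    (0 <= L2norm L (F s \- F t)%R <= (M * `|s - t|)%:E)%E.
  by apply: filterS H => s ->; rewrite Lnorm_ge0.
apply: (squeeze_cvge H0 (cvg_cst 0%E)).
apply: cvg_EFin; first exact: nearW.
have : M * `|s - t| @[s --> t] --> M * `|t - t|.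
  apply: cvgMr; apply: cvg_norm; apply: cvgB; [exact: cvg_id|exact: cvg_cst].
rewrite subrr normr0 mulr0; apply: cvg_trans; apply: cvg_app; exact: cvg_within.
Unshelve. all: by end_near. Qed.

(** Write F s - f = (F s - F t) + h with h = F t - f and expand the square: all terms but that in h
    alone vanish as s tends to t. *)
Lemma inner_dev_continuous (F : R -> R -> R) f :
  (forall s, 0 <= s -> inL2 L (F s)) -> inL2 L f -> L2_continuous L F ->
  {within Rplus, continuous (fun s => inner L (fun x => F s x - f x) (fun x => F s x - f x))}.
Proof.
move=> LF Lf cF; apply/subspace_continuousP => t t0; apply/subr_cvg0.
have Lh := inL2B (LF t t0) Lf; pose h x := F t x - f x.
have LFB : \forall s \near within Rplus (nbhs t), inL2 L (F s \- F t).
  by rewrite near_withinE; near=> s => s0; apply: inL2B; exact: LF.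
have c1 : inner L (F s \- F t) (F s \- F t) @[s --> within Rplus (nbhs t)] --> 0.
  exact: (L2norm_cvg0_inner LFB (cF t t0)).
have c2 : inner L (F s \- F t) h @[s --> within Rplus (nbhs t)] --> 0.
  exact: (L2norm_cvg0_form (bounded_form_inner Lh) LFB (cF t t0)).
have c3 : inner L (F s \- F t) (F s \- F t) + (inner L (F s \- F t) h + inner L (F s \- F t) h)
    @[s --> within Rplus (nbhs t)] --> 0.
  by rewrite -[0]addr0 -[X in _ + X]addr0; apply: cvgD => //; exact: cvgD.
refine (near_cvg_eq _ c3); rewrite near_withinE; near=> s => s0.
have Ld : inL2 L (F s \- F t) by apply: inL2B; exact: LF.
rewrite /from_subspace -/h; have -> : (fun x => F s x - f x) = (fun x => (F s \- F t) x + h x).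
  by apply/funext => x; rewrite /h /=; ring.
rewrite (innerDl Ld Lh (inL2D Ld Lh)) (innerDr Ld Lh Ld) (innerDr Ld Lh Lh).
by rewrite (innerC L h); ring.
Unshelve. all: by end_near. Qed.

End Norms.

Lemma cvg0_bounded {R : realType} (f : R -> R) :
  (forall t, 0 <= t -> 0 <= f t) -> {within Rplus, continuous f} ->
  f t @[t --> +oo] --> 0 -> exists B, forall t, 0 <= t -> 0 <= f t <= B.
Proof.
move=> f0 cf f_cvg; have /cvgrPdist_le/(_ 1 ltr01)[T [_ HT]] := f_cvg.
have T0 : 0 <= Num.max T 0 by rewrite le_max lexx orbT.
have [k _ Hk] : exists2 k, k \in `[0, Num.max T 0] &
    forall t, t \in `[0, Num.max T 0] -> f t <= f k.
  apply: EVT_max => //; apply: continuous_subspaceW cf => t /=.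
  by rewrite in_itv/= => /andP[].
exists (Num.max 1 (f k)) => t t0; rewrite f0//= le_max.
have [tT|Tt] := leP t (Num.max T 0).
  by rewrite Hk ?orbT// in_itv/= t0.
have /HT : T < t by rewrite (le_lt_trans _ Tt)// le_max lexx.
by rewrite sub0r normrN ger0_norm ?f0// => ->.
Qed.

(** * Final estimates in terms of the weight *)

Section Assembly.
Context {R : realType} (L D : R) (c : R -> R) (e : nat -> R -> R)
  (lam : nat -> R) (n : nat) (K : 'rV[R]_(1 + n + 1)).
Hypotheses (L_gt0 : 0 < L) (D_gt0 : 0 < D) (c_Linfty : inLinfty L c)
  (e_eigen : forall j, opA L c (e j) (fun x => lam j * e j x))
  (e_basis : hilbert_basis L e)
  (lam_decr : forall i j, (i < j)%N -> lam j < lam i)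
  (lam_ge0 : forall j, (j < n)%N -> 0 <= lam j)
  (lam_lt0 : forall j, (n <= j)%N -> lam j < 0)
  (AK_Hurwitz : Hurwitz (matAK L D c e lam K)).
Local Notation ue := (u_e L D c e lam K).
Local Notation zetae := (zeta_e L D c e lam K).
Local Notation ye := (y_e L D c e lam K).
Local Notation w := (w_of L D).
Local Notation zeta := (zeta_of L D e lam n).

(** The weight is also required not to increase, because u is only known through u_D, hence at a
    time later by D. *)
Lemma closed_loop_estimate : exists theta C, [/\ 0 < theta, 0 < C &
  forall re de we r d y z v g, dominated L D c e lam K theta re de we r d y z v g ->
    (forall s t, 0 <= s -> s <= t -> g t <= g s) ->
    forall t, 0 <= t -> let b := C * Num.sqrt (g t) in
    [/\ (H10norm L (w y v t \- we)%R <= b%:E)%E,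
        (Linftynorm L (y t \- ye re de we)%R <= b%:E)%E,
        (L2norm L (y t \- ye re de we)%R <= b%:E)%E,
        `|u_of v t - ue re de| <= b & `|zeta y z v t - zetae re de| <= b]].
Proof.
have [sigma sigma0 HZ] := Z_estimate L_gt0 D_gt0 c_Linfty e_eigen e_basis lam_decr lam_lt0 AK_Hurwitz.
have mu0 : 0 < - lam n by rewrite oppr_gt0 lam_lt0.
(* Half of the smaller decay rate, so as to lie strictly below both. *)
pose theta := Num.min sigma (- lam n) / 2.
have min0 : 0 < Num.min sigma (- lam n) by rewrite lt_min sigma0.
have th0 : 0 < theta by rewrite divr_gt0.
have th_min : theta < Num.min sigma (- lam n) by rewrite ltr_pdivrMr// ltr_pMr// ltr1n.
have /andP[th_sigma th_mu] : (theta < sigma) && (theta < - lam n) by rewrite -lt_min.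
have [CZ CZ0 {}HZ] := HZ theta th0 th_sigma.
have [Cv Cv0 Hv] := v_estimate AK_Hurwitz theta CZ0.
have [Cx Cx0 Hx] := X_estimate L c e lam K D_gt0 CZ0 Cv0 (ltW th0).
have [Cw Cw0 Hw] := w_estimate L_gt0 D_gt0 c_Linfty e_eigen e_basis lam_decr lam_ge0 lam_lt0
  AK_Hurwitz Cx0 Cv0 (ltW th0) th_mu.
(* From y - y_e = (w - w_e) + (x / L) (u_D - u_e), with 0 <= x / L <= 1: the first term is bounded
   in sup norm by its H^1_0 norm, the second by the estimate of X. *)
pose Cs := Num.sqrt (L * Cw) + Num.sqrt Cx.
have sCx : 0 < Num.sqrt Cx by rewrite sqrtr_gt0.
have Cs0 : 0 < Cs by rewrite ltr_wpDl// sqrtr_ge0.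
pose C := Num.sqrt Cw + Cs + Num.sqrt L * Cs.
have C1 : Num.sqrt Cw <= C by rewrite /C -addrA lerDl addr_ge0 ?mulr_ge0 ?sqrtr_ge0// ltW.
have C2 : Cs <= C by rewrite /C addrAC lerDr addr_ge0 ?mulr_ge0 ?sqrtr_ge0// ltW.
have C3 : Num.sqrt L * Cs <= C by rewrite /C lerDr addr_ge0 ?sqrtr_ge0// ltW.
have C4 : Num.sqrt Cx <= C by apply: le_trans C2; rewrite lerDr sqrtr_ge0.
exists theta, C; split=> // [|re de we r d y z v g dom g_anti t t0 b].
  exact: lt_le_trans C4.
have g0 := g_ge0 dom t0.
have {}Hv := Hv _ _ _ _ _ _ _ _ _ dom (HZ _ _ _ _ _ _ _ _ _ dom).
have {}Hx := Hx _ _ _ _ _ _ _ _ _ dom (HZ _ _ _ _ _ _ _ _ _ dom) Hv.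
have {}Hw := Hw _ _ _ _ _ _ _ _ _ dom Hv Hx.
have leC a k : 0 <= k -> Num.sqrt k <= C -> a ^+ 2 <= k * g t -> `|a| <= b.
  move=> k0 kC ak; rewrite -sqrtr_sqr; apply: (le_trans (ler_wsqrtr ak)).
  by rewrite sqrtrM// ler_wpM2r// sqrtr_ge0.
have [w1 [w2 dw]] := dev_data L_gt0 dom t0.
have {}Hw := Hw _ _ _ t0 dw.
have Hu s : 0 <= s -> (uD_of D v s - ue re de) ^+ 2 <= Cx * g s.
  by move=> s0; rewrite -(X_dev0 L D c e lam K re de y z); exact: Hx.
have Hz : (zeta y z v t - zetae re de) ^+ 2 <= Cx * g t.
  by rewrite -(X_dev2 L D c e lam K re de); exact: Hx.
have [ww1 w12 dw0 dwL] := dw.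
have sup x : x \in `]0, L[ -> `|(y t \- ye re de we) x| <= Cs * Num.sqrt (g t).
  rewrite in_itv/= => /andP[x0 xL].
  have -> : y t x - ye re de we x =
      (w y v t x - we x) + x / L * (uD_of D v t - ue re de).
    by rewrite /y_e /w_of; ring.
  apply: (le_trans (ler_normD _ _)); rewrite mulrDl lerD//.
    rewrite -sqrtrM ?mulr_ge0 ?(ltW L_gt0) ?(ltW Cw0)// -sqrtr_sqr ler_wsqrtr//.
    apply: (le_trans (sqr_le_dirichlet L_gt0 ww1 dw0 _)); first by rewrite !ltW.
    by rewrite -mulrA ler_wpM2l ?(ltW L_gt0).
  rewrite normrM -[leRHS]mul1r; apply: ler_pM => //.
    by rewrite ger0_norm ?divr_ge0 ?(ltW x0) ?(ltW L_gt0)// ler_pdivrMr// mul1r ltW.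
  by rewrite -sqrtrM ?(ltW Cx0)// -sqrtr_sqr ler_wsqrtr//; exact: Hu.
have Ldy : inL2 L (y t \- ye re de we).
  have [Ldw _] := dirichlet_data_inL2 L_gt0 dw.
  apply: inL2_eq (inL2D Ldw (inL2Z (- (uD_of D v t - ue re de)) (inL2_b_fun L_gt0))) => x _.
  by rewrite /y_e /w_of/=; ring.
have s0 : 0 <= Cs * Num.sqrt (g t) by rewrite mulr_ge0 ?sqrtr_ge0// ltW.
split.
- rewrite (H10normE L_gt0 ww1 w12) lee_fin.
  apply: (le_trans (ler_wsqrtr Hw)).
  by rewrite sqrtrM ?(ltW Cw0)// ler_wpM2r// sqrtr_ge0.
- apply: (le_trans (Linftynorm_le s0 sup)).
  by rewrite lee_fin ler_wpM2r// sqrtr_ge0.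
- apply: (le_trans (L2norm_le L_gt0 Ldy s0 sup)).
  by rewrite lee_fin mulrA ler_wpM2r// sqrtr_ge0.
- apply: (leC _ _ (ltW Cx0) C4).
  (* u(t) = u_D(t + D), and the bound at t + D is at most that at t by monotonicity of the
     weight. *)
  have tD : 0 <= t + D by rewrite addr_ge0// ltW.
  have := Hu _ tD; rewrite /uD_of addrK => /le_trans; apply.
  by rewrite ler_wpM2l ?(ltW Cx0)//; apply: g_anti => //; rewrite lerDl ltW.
- exact: (leC _ _ (ltW Cx0) C4).
Qed.

(** Continuity and the limits at infinity bound the squared deviations of r and d on all of R_+, as
    the construction of the weight requires. No trajectory enters. *)
Lemma input_weight theta re de (r : R -> R) (d : R -> R -> R) : 0 < theta ->
  inL2 L de -> {within Rplus, continuous r} -> L2_C1 L d ->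
  r t @[t --> +oo] --> re -> L2norm L (d t \- de) @[t --> +oo] --> 0%E ->
  exists p : R -> R, [/\ p t @[t --> +oo] --> 0,
    forall t, 0 <= t -> input_dev L re de r d t <= p t,
    slowly_decreasing theta p & forall s t, s <= t -> p t <= p s].
Proof.
move=> th0 Lde cr [d' dd' _] r_cvg d_cvg.
have Ld t : 0 <= t -> inL2 L (d t) by move=> /dd'[].
have eta0 t : 0 <= t -> 0 <= input_dev L re de r d t.
  by move=> t0; rewrite addr_ge0 ?sqr_ge0 ?inner_ge0.
have Ldev : \forall t \near +oo, inL2 L (d t \- de).
  by near=> t; apply: inL2B => //; apply: Ld; near: t; apply: nbhs_pinfty_ge; exact: num_real.
have eta_cvg : input_dev L re de r d t @[t --> +oo] --> 0.
  rewrite -[0]addr0; apply: cvgD; last exact: (L2norm_cvg0_inner Ldev d_cvg).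
  rewrite (_ : 0 = (re - re) * (re - re)); last by rewrite subrr mulr0.
  by under eq_fun do rewrite expr2; apply: cvgM; (apply: cvgB; [exact: r_cvg|exact: cvg_cst]).
have eta_cont : {within Rplus, continuous (input_dev L re de r d)}.
  have cd : L2_continuous L d.
    by move=> t t0; have [_ Ld' Dd] := dd' t t0; exact: (L2_is_derive_continuous t0 Ld Ld' Dd).
  have c1 : {within Rplus, continuous (fun t => r t - re)}.
    by apply: within_continuousB => // s; exact: cvg_cst.
  have c2 := within_continuousM c1 c1; have c3 := inner_dev_continuous Ld Lde cd.
  exact: (within_continuousD c2 c3).
have [B HB] := cvg0_bounded eta0 eta_cont eta_cvg.
exact: (weight_exists th0 HB eta_cvg).
Unshelve. all: by end_near. Qed.

End Assembly.

Lemma expR_Nmul_cvg0 {R : realType} (k : R) : 0 < k -> expR (- k * t) @[t --> +oo] --> 0.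
Proof.
move=> k0; apply/cvgrPdist_le => eps eps0.
have /cvgrPdist_le/(_ _ eps0)[T [_ HT]] := @cvgr_expR R.
near=> t; have /HT : T < k * t.
  by rewrite mulrC -ltr_pdivrMr//; near: t; apply: nbhs_pinfty_gt; exact: num_real.
by rewrite mulNr.
Unshelve. all: by end_near. Qed.

(** Subadditivity of the square root separates the initial state from the inputs and halves the
    rate, hence kappa = theta / 2. *)
Lemma sqrt_weight_le {R : realType} (a k p : R) : 0 <= a -> 0 <= p ->
  Num.sqrt (a ^+ 2 * expR (- k) + p) <= expR (- (k / 2)) * a + Num.sqrt p.
Proof.
move=> a0 p0; have b0 := sqrtr_ge0 p; have e0 := expR_ge0 (- (k / 2)).
have -> : expR (- k) = expR (- (k / 2)) ^+ 2.
  by rewrite expr2 -expRD; congr expR; field.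
have ea0 := mulr_ge0 e0 a0.
rewrite -[X in _ <= X]ger0_norm ?addr_ge0// -sqrtr_sqr ler_wsqrtr//.
rewrite -{1}[p]sqr_sqrtr//; nra.
Qed.

Theorem corollary2 (R : realType) (L D : R) (c : R -> R)
    (e : nat -> R -> R) (lam : nat -> R) (n : nat) (K : 'rV[R]_(1 + n + 1))
    (L_gt0 : 0 < L) (D_gt0 : 0 < D) (c_Linfty : inLinfty L c)
    (e_eigen : forall j, opA L c (e j) (fun x => lam j * e j x))
    (e_basis : hilbert_basis L e)
    (lam_decr : forall i j, (i < j)%N -> lam j < lam i)
    (lam_cvg : lam j @[j --> \oo] --> -oo)
    (lam_ge0 : forall j, (j < n)%N -> 0 <= lam j)
    (lam_lt0 : forall j, (n <= j)%N -> lam j < 0)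
    (AK_Hurwitz : Hurwitz (matAK L D c e lam K)) :
  exists C kappa : R, 0 < C /\ 0 < kappa /\
  forall (re : R) (de we : R -> R),
    inL2 L de -> is_w_e L D c e lam K re de we ->
  let ue := u_e L D c e lam K re de in
  let zetae := zeta_e L D c e lam K re de in
  let ye := y_e L D c e lam K re de we in
  forall (r : R -> R) (d : R -> R -> R),
    {within Rplus, continuous r} -> L2_C1 L d ->
    r t @[t --> +oo] --> re ->
    L2norm L (d t \- de) @[t --> +oo] --> 0%E ->
  exists rho : R -> R, rho t @[t --> +oo] --> 0 /\
  forall (y0 : R -> R) (z0 : R) (y : R -> R -> R) (z v : R -> R),
    inDA L y0 -> closed_loop L D c e lam K r d y0 z0 y z v ->
  let u := u_of v in
  let uD := uD_of D v in
  let w := w_of L D y v in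
  let zeta := zeta_of L D e lam n y z v in
  let bound (t : R) : R :=
    C * expR (- kappa * t) *
      (`|uD 0 - ue| + `|zeta 0 - zetae| + fine (H10norm L (w 0 \- we)))
    + rho t in
  (H10norm L (w t \- we) @[t --> +oo] --> 0%E /\
   Linftynorm L (y t \- ye) @[t --> +oo] --> 0%E /\
   L2norm L (y t \- ye) @[t --> +oo] --> 0%E /\
   u t @[t --> +oo] --> ue /\
   zeta t @[t --> +oo] --> zetae) /\
  (forall t : R, 0 <= t ->
     (H10norm L (w t \- we)%R <= (bound t)%:E)%E /\
     (Linftynorm L (y t \- ye)%R <= (bound t)%:E)%E /\
     (L2norm L (y t \- ye)%R <= (bound t)%:E)%E /\
     `|u t - ue| <= bound t /\
     `|zeta t - zetae| <= bound t).
Proof.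
have [theta [C [th0 C0 H]]] := closed_loop_estimate L_gt0 D_gt0 c_Linfty e_eigen
  e_basis lam_decr lam_ge0 lam_lt0 AK_Hurwitz.
exists C, (theta / 2); split=> //; split; first by rewrite divr_gt0.
move=> re de we Lde we_def ue zetae ye r d cr cd r_cvg d_cvg.
have [p [p_cvg p_ge p_slow p_anti]] := input_weight th0 Lde cr cd r_cvg d_cvg.
have p0 t : 0 <= t -> 0 <= p t by case: p_slow => + _; exact.
have rho_cvg : C * Num.sqrt (p t) @[t --> +oo] --> 0.
  rewrite -[0](mulr0 C); apply: cvgMr; rewrite -[X in _ --> X](@sqrtr0 R).
  by apply: continuous_cvg => //; exact: sqrt_continuous.
have exp_cvg (a : R) : C * expR (- (theta / 2) * t) * a @[t --> +oo] --> 0.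
  rewrite -[0](mul0r a); apply: cvgMl; rewrite -[0](mulr0 C); apply: cvgMr.
  by apply: expR_Nmul_cvg0; rewrite divr_gt0.
(* [rho] is fixed before any trajectory is given: it depends on the inputs and their limits only. *)
exists (fun t => C * Num.sqrt (p t)); split=> //.
move=> y0 z0 y z v y0_DA CL u uD w zeta bound.
pose I := initial_dev L D c e lam K re de we y z v.
pose g t := I ^+ 2 * expR (- (theta * t)) + p t.
have g_anti s t : 0 <= s -> s <= t -> g t <= g s.
  move=> s0 st; apply: lerD; last exact: p_anti.
  by rewrite ler_wpM2l ?sqr_ge0// ler_expR lerN2 ler_wpM2l// ltW.
have dom : dominated L D c e lam K theta re de we r d y z v g.
  split=> //; first by move=> t t0; have [d' /(_ t t0)[]] := cd.
    by exists y0, z0.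
  split=> [|t t0|t t0].
  (* The exponential term decays exactly at rate theta and [p] at most at that rate, so their sum is
     slowly decreasing. *)
  - split=> [t t0|s t s0 st].
      by rewrite addr_ge0 ?p0// mulr_ge0 ?sqr_ge0// expR_ge0.
    rewrite /g mulrDr; apply: lerD; last by case: p_slow => _; exact.
    rewrite mulrCA -expRD; rewrite ler_wpM2l ?sqr_ge0// ler_expR; lra.
  - by apply: (le_trans (p_ge t t0)); rewrite lerDr mulr_ge0 ?sqr_ge0// expR_ge0.
  - by rewrite mulNr lerDl p0.
have {}H := H _ _ _ _ _ _ _ _ _ dom g_anti.
have g_bound t : 0 <= t -> C * Num.sqrt (g t) <= bound t.
  move=> t0; have -> : bound t = C * (expR (- (theta * t / 2)) * I + Num.sqrt (p t)).
    rewrite mulrDr mulrA; transitivity (C * expR (- (theta / 2) * t) * I + C * Num.sqrt (p t)) => //.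
    by congr (C * expR _ * _ + _); ring.
  by rewrite ler_wpM2l ?(ltW C0)//; apply: sqrt_weight_le; [exact: init_ge0 dom|exact: p0].
have bounds t : 0 <= t ->
    [/\ (H10norm L (w t \- we)%R <= (bound t)%:E)%E,
        (Linftynorm L (y t \- ye)%R <= (bound t)%:E)%E,
        (L2norm L (y t \- ye)%R <= (bound t)%:E)%E,
        `|u t - ue| <= bound t & `|zeta t - zetae| <= bound t].
  move=> t0; have [h1 h2 h3 h4 h5] := H t t0; have gb := g_bound t t0.
  by split; (apply: le_trans; [eassumption|by rewrite ?lee_fin]).
have bound_cvg : bound t @[t --> +oo] --> 0.
  by rewrite -[0]addr0; exact: (cvgD (exp_cvg _) rho_cvg).
have t_ge0 : \forall t \near +oo, 0 <= (t : R) by apply: nbhs_pinfty_ge; exact: num_real.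
have bound_cvge : (bound t)%:E @[t --> +oo] --> 0%E.
  by apply: cvg_EFin; [exact: nearW|exact: bound_cvg].
have norm_cvg (N : R -> \bar R) : (forall t, 0 <= N t)%E ->
    (forall t, 0 <= t -> (N t <= (bound t)%:E)%E) -> N t @[t --> +oo] --> 0%E.
  move=> N0 Nb; apply: (squeeze_cvge _ (cvg_cst 0%E) bound_cvge).
  by apply: filterS t_ge0 => t t0; rewrite N0 Nb.
have dist_cvg (f : R -> R) l : (forall t, 0 <= t -> `|f t - l| <= bound t) ->
    f t @[t --> +oo] --> l.
  move=> fb; apply/subr_cvg0/norm_cvg0P.
  apply: (squeeze_cvgr _ (cvg_cst 0) bound_cvg).
  by apply: filterS t_ge0 => t t0; rewrite normr_ge0 fb.
split; last by move=> t /bounds[].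
split; [|split; [|split; [|split]]].
- by apply: norm_cvg => t; [exact: Lnorm_ge0|case/bounds].
- by apply: norm_cvg => t; [exact: Lnorm_ge0|case/bounds].
- by apply: norm_cvg => t; [exact: Lnorm_ge0|case/bounds].
- by apply: dist_cvg => t; case/bounds.
- by apply: dist_cvg => t; case/bounds.
Qed.
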